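(* Let $\mathfrak{g}=\tilde{\mathfrak{p}}(n)$ over $\mathbf{k}$. Suppose $\chi\in\mathfrak{g}_{\bar 0}^*$ is the regular nilpotent $p$-character satisfying $\chi(\mathfrak{h})=0$, $\chi(X_{-\alpha})=1$ for all $\alpha\in\Pi_0$, and $\chi(X_\beta)=0$ for all other roots $\beta$ of $\mathfrak{g}_{\bar 0}$ (i.e. all $\beta\in\Phi_0\setminus(-\Pi_0)$), and let $\lambda\in\Lambda(\chi)$. Then $Z_\chi(\lambda)$ is an irreducible $U_\chi(\mathfrak{g})$-module.
   Context: $\mathbf{k}$ is an algebraically closed field of characteristic $p>2$. Vector spaces, modules and subalgebras are understood in the super sense. $\tilde{\mathfrak{p}}(n)$ is the Lie subsuperalgebra of $\mathfrak{gl}(n|n)$ of all matrices $\begin{pmatrix} A & B\\ C & -A^{t}\end{pmatrix}$ with $A,B,C$ of size $n\times n$, $B=B^{t}$, $C=-C^{t}$. Its even part $\mathfrak{g}_{\bar 0}$ is given by $B=C=0$ and is identified with $\mathfrak{gl}(n)$ via $A\mapsto \mathrm{diag}(A,-A^t)$; the $p$-mapping $[p]$ on $\mathfrak{g}_{\bar 0}$ is the $p$-th power of matrices. $\mathfrak{g}_{1}\subset\mathfrak{g}_{\bar 1}$ is given by $A=C=0$. $H_i=E_{i,i}-E_{n+i,n+i}$ ($1\le i\le n$) is a basis of the torus $\mathfrak{h}\subset\mathfrak{g}_{\bar 0}$, and $\{\epsilon_i\}$ is the dual basis of $\mathfrak{h}^*$. The root system of $\mathfrak{g}_{\bar 0}$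 is $\Phi_0=\{\epsilon_i-\epsilon_j\mid 1\le i\ne j\le n\}$, with simple roots $\Pi_0=\{\epsilon_i-\epsilon_{i+1}\mid 1\le i\le n-1\}$, and root vectors $X_{\epsilon_i-\epsilon_j}=E_{i,j}-E_{n+j,n+i}$. $\mathfrak{n}_{\bar 0}^+$ is the span of $X_{\epsilon_i-\epsilon_j}$ with $i<j$, $\mathfrak{b}_{\bar 0}=\mathfrak{h}\oplus\mathfrak{n}_{\bar 0}^+$, and $\mathcal{B}=\mathfrak{b}_{\bar 0}\oplus\mathfrak{g}_1$. For $\chi\in\mathfrak{g}_{\bar 0}^*$, $U_\chi(\mathfrak{g})$ is the quotient of $U(\mathfrak{g})$ by the ideal generated by $x^p-x^{[p]}-\chi(x)^p$, $x\in\mathfrak{g}_{\bar 0}$; similarly for restricted subalgebras (with $\chi$ restricted to the even part). $\Lambda(\chi)=\{\lambda\in\mathfrak{h}^*\mid \lambda(H_i)^p-\lambda(H_i)=\chi(H_i)^p,\ i=1,\dots,n\}$. For $\lambda\in\Lambda(\chi)$, $\mathbf{k}_\lambda$ is the one-dimensional $U_\chi(\mathcal{B})$-module on which $\mathfrak{h}$ acts via $\lambda$ and $\mathfrak{n}_{\bar 0}^+\oplus\mathfrak{g}_1$ acts trivially, and the baby Verma module is $Z_\chi(\lambda)=U_\chi(\mathfrak{g})\otimes_{U_\chi(\mathcal{B})}\mathbf{k}_\lambda$. *)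

(* Defs.v *)
From HB Require Import structures.
From mathcomp Require Import all_boot all_order all_algebra.
From mathcomp Require Import finmap boolp monalg.

Set Implicit Arguments.
Unset Strict Implicit.
Unset Printing Implicit Defensive.

Import GRing.Theory.
Local Open Scope ring_scope.

(* The additive subgroup generated by [S]. *)
Inductive in_span (V : zmodType) (S : V -> Prop) : V -> Prop :=
| InSpan0 : in_span S 0
| InSpanB x y : in_span S x -> in_span S y -> in_span S (x - y)
| InSpanS x : S x -> in_span S x.

Section ZQuot.
Context (V : zmodType) (S : V -> Prop).

Definition span_pred : {pred V} := fun x => `[< in_span S x >].

Lemma span_predP x : reflect (in_span S x) (x \in span_pred).
Proof. exact: asboolP. Qed.

Lemma span_pred_zmod_closed : zmod_closed span_pred.
Proof.
split; first by apply/span_predP; exact: InSpan0.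
by move=> x y /span_predP hx /span_predP hy; apply/span_predP; exact: InSpanB.
Qed.

HB.instance Definition _ :=
  GRing.isZmodClosed.Build V span_pred span_pred_zmod_closed.

Definition zquot := Quotient.quot span_pred.
HB.instance Definition _ := GRing.Zmodule.on zquot.

Definition zpi (x : V) : zquot := (\pi_((Quotient.quot span_pred)) x)%qT.

Lemma zpi_is_zmod_morphism : zmod_morphism zpi.
Proof. by move=> x y; exact: (raddfB \pi_((Quotient.quot span_pred))%qT). Qed.
HB.instance Definition _ :=
  GRing.isZmodMorphism.Build V zquot zpi zpi_is_zmod_morphism.

Definition zrepr (x : zquot) : V := generic_quotient.repr x.

Lemma zreprK x : zpi (zrepr x) = x.
Proof. exact: (@generic_quotient.reprK _ (Quotient.quot span_pred) x). Qed.

Lemma zpi_eq x y : zpi x = zpi y <-> in_span S (x - y).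
Proof.
rewrite /zpi; split.
  move/eqP; rewrite -Quotient.idealrBE; exact: span_predP.
by move/span_predP => h; apply/eqP; rewrite -Quotient.idealrBE.
Qed.

Lemma zrepr_pi x : in_span S (x - zrepr (zpi x)).
Proof. by apply/zpi_eq; rewrite zreprK. Qed.

Lemma in_spanN x : in_span S x -> in_span S (- x).
Proof. by move=> h; rewrite -sub0r; apply: InSpanB => //; exact: InSpan0. Qed.

Lemma in_spanD x y : in_span S x -> in_span S y -> in_span S (x + y).
Proof. by move=> hx hy; rewrite -[y]opprK; apply/InSpanB/in_spanN. Qed.

Lemma in_span_map (W : zmodType) (T : W -> Prop) (f : {additive V -> W}) :
  (forall x, S x -> in_span T (f x)) -> forall x, in_span S x -> in_span T (f x).
Proof.
move=> h x; elim=> [|{}x y _ hx _ hy|{}x /h //].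
  by rewrite raddf0; exact: InSpan0.
by rewrite raddfB; exact: InSpanB.
Qed.

Lemma in_span_kill (W : zmodType) (f : {additive V -> W}) :
  (forall x, S x -> f x = 0) -> forall x, in_span S x -> f x = 0.
Proof.
move=> h x; elim=> [|{}x y _ hx _ hy|{}x /h //]; first exact: raddf0.
by rewrite raddfB hx hy subrr.
Qed.

End ZQuot.

Section RQuot.
Context (A : pzRingType) (S : A -> Prop).

Definition ideal_gen (z : A) : Prop := exists a s b, S s /\ z = a * s * b.

Lemma idealMl a x : in_span ideal_gen x -> in_span ideal_gen (a * x).
Proof.
apply: (in_span_map (f := a \*o idfun)) => _ [b [s [c [hs ->]]]]; apply: InSpanS => /=.
by exists (a * b), s, c; rewrite !mulrA.
Qed.

Lemma idealMr a x : in_span ideal_gen x -> in_span ideal_gen (x * a).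
Proof.
apply: (in_span_map (f := a \o* idfun)) => _ [b [s [c [hs ->]]]]; apply: InSpanS => /=.
by exists b, s, (c * a); rewrite !mulrA.
Qed.

Definition rquot := zquot ideal_gen.
HB.instance Definition _ := GRing.Zmodule.on rquot.

Definition rpi : A -> rquot := @zpi A ideal_gen.
HB.instance Definition _ := GRing.Additive.on rpi.

Definition rquot_mul (x y : rquot) : rquot := rpi (zrepr x * zrepr y).

Lemma rpi_mul x y : rquot_mul (rpi x) (rpi y) = rpi (x * y).
Proof.
apply/zpi_eq; rewrite -opprB; apply: in_spanN.
have -> : x * y - zrepr (rpi x) * zrepr (rpi y)
        = (x - zrepr (rpi x)) * y + zrepr (rpi x) * (y - zrepr (rpi y)).
  by rewrite mulrBl mulrBr addrA subrK.
by apply: in_spanD; [apply/idealMr|apply/idealMl]; exact: zrepr_pi.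
Qed.

Lemma rquotW (P : rquot -> Prop) : (forall x, P (rpi x)) -> forall x, P x.
Proof. by move=> h x; rewrite -[x]zreprK; exact: h. Qed.

Lemma rquot_mulA : associative rquot_mul.
Proof.
by elim/rquotW=> x; elim/rquotW=> y; elim/rquotW=> z; rewrite !rpi_mul mulrA.
Qed.
Lemma rquot_mul1 : left_id (rpi 1) rquot_mul.
Proof. by elim/rquotW=> x; rewrite rpi_mul mul1r. Qed.
Lemma rquot_mulr1 : right_id (rpi 1) rquot_mul.
Proof. by elim/rquotW=> x; rewrite rpi_mul mulr1. Qed.
Lemma rquot_mulDl : left_distributive rquot_mul +%R.
Proof.
elim/rquotW=> x; elim/rquotW=> y; elim/rquotW=> z.
by rewrite -raddfD !rpi_mul -raddfD mulrDl.
Qed.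
Lemma rquot_mulDr : right_distributive rquot_mul +%R.
Proof.
elim/rquotW=> x; elim/rquotW=> y; elim/rquotW=> z.
by rewrite -raddfD !rpi_mul -raddfD mulrDr.
Qed.

HB.instance Definition _ := GRing.Zmodule_isPzRing.Build rquot
  rquot_mulA rquot_mul1 rquot_mulr1 rquot_mulDl rquot_mulDr.

Lemma rpi_is_monoid_morphism : monoid_morphism rpi.
Proof. by split=> // x y; rewrite -rpi_mul. Qed.
HB.instance Definition _ :=
  GRing.isMonoidMorphism.Build A rquot rpi rpi_is_monoid_morphism.

Lemma rpi0 x : S x -> rpi x = 0.
Proof.
move=> hx; rewrite -(raddf0 rpi); apply/zpi_eq; rewrite subr0; apply: InSpanS.
by exists 1, x, 1; rewrite mul1r mulr1.
Qed.

Section Lift.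
Context (B : pzRingType) (f : {rmorphism A -> B}).
Hypothesis fS : forall x, S x -> f x = 0.

Definition rquot_lift of (forall x, S x -> f x = 0) :=
  fun x : rquot => f (zrepr x).
Local Notation F := (rquot_lift fS).

Lemma rquot_lift_pi x : F (rpi x) = f x.
Proof.
apply/eqP; rewrite eq_sym -subr_eq0 -raddfB; apply/eqP.
apply: (@in_span_kill A ideal_gen B f); last exact: zrepr_pi.
move=> _ [a [s [b [/fS hs ->]]]].
by rewrite /= !rmorphM hs mulr0 mul0r.
Qed.

Lemma rquot_lift_is_zmod_morphism : zmod_morphism F.
Proof.
by elim/rquotW=> x; elim/rquotW=> y; rewrite -raddfB !rquot_lift_pi raddfB.
Qed.
Lemma rquot_lift_is_monoid_morphism : monoid_morphism F.
Proof.
split; first by rewrite -(rmorph1 rpi) rquot_lift_pi rmorph1.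
by elim/rquotW=> x; elim/rquotW=> y; rewrite -rmorphM !rquot_lift_pi rmorphM.
Qed.
HB.instance Definition _ := GRing.isZmodMorphism.Build rquot B F
  rquot_lift_is_zmod_morphism.
HB.instance Definition _ := GRing.isMonoidMorphism.Build rquot B F
  rquot_lift_is_monoid_morphism.
End Lift.
End RQuot.

Section MalgExt.
Context (K : choiceType) (G V : zmodType) (h : K -> {additive G -> V}).

Definition malg_ext (g : {malg G[K]}) : V := \sum_(q <- msupp g) h q g@_q.

Lemma malg_extEw (d : {fset K}) g : (msupp g `<=` d)%fset ->
  malg_ext g = \sum_(q <- d) h q g@_q.
Proof.
move=> le; rewrite /malg_ext (big_fset_incl _ le) => //= x xd /mcoeff_outdom ->.
exact: raddf0.
Qed.

Lemma malg_extU c q : malg_ext << c *g q >> = h q c.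
Proof. by rewrite (malg_extEw msuppU_le) big_seq_fset1 mcoeffUU. Qed.

Lemma malg_ext_is_zmod_morphism : zmod_morphism malg_ext.
Proof.
move=> x y; pose d := (msupp x `|` msupp y)%fset.
rewrite !(@malg_extEw d) ?fsubsetUl ?fsubsetUr ?msuppB_le //.
by rewrite -sumrB; apply: eq_bigr => q _; rewrite !raddfB.
Qed.
HB.instance Definition _ :=
  GRing.isZmodMorphism.Build {malg G[K]} V malg_ext malg_ext_is_zmod_morphism.
End MalgExt.

Lemma malg_ind_add (K : choiceType) (G : zmodType) (P : {malg G[K]} -> Prop) :
  P 0 -> (forall x y, P x -> P y -> P (x + y)) ->
  (forall c q, P << c *g q >>) -> forall g, P g.
Proof.
by move=> P0 PD PU g; rewrite (monalgE g); elim/big_ind: _.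
Qed.

Section FreeLift.
Context (k : fieldType) (X : choiceType) (S : pzRingType).
Context (f : {rmorphism k -> S}) (phi : X -> S).
Hypothesis fC : forall c s, GRing.comm (f c) s.

Definition word_eval (m : {fmonom X}) (c : k) : S :=
  f c * \prod_(x <- m : seq X) phi x.

Lemma word_eval_is_zmod_morphism m : zmod_morphism (word_eval m).
Proof. by move=> x y; rewrite /word_eval raddfB mulrBl. Qed.
HB.instance Definition _ m := GRing.isZmodMorphism.Build k S (word_eval m)
  (word_eval_is_zmod_morphism m).

Definition free_lift of (forall c s, GRing.comm (f c) s) :
  {malg k[{fmonom X}]} -> S := malg_ext word_eval.
Local Notation F := (free_lift fC).
HB.instance Definition _ := GRing.Additive.copy F (malg_ext word_eval).

Lemma free_liftU c m : F << c *g m >> = f c * \prod_(x <- m : seq X) phi x.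
Proof. exact: malg_extU. Qed.

Lemma free_lift_is_monoid_morphism : monoid_morphism F.
Proof.
split; first by rewrite free_liftU rmorph1 mul1r fm1 big_nil.
elim/malg_ind_add=> [y|x x' hx hx' y|c m]; first by rewrite !(mul0r, raddf0).
  by rewrite mulrDl !raddfD /= hx hx' mulrDl.
elim/malg_ind_add=> [|y y' hy hy'|d m']; first by rewrite !(mulr0, raddf0).
  by rewrite mulrDr !raddfD /= hy hy' mulrDr.
rewrite malgM_def fgmulUU !free_liftU rmorphM fmM big_cat /= -!mulrA.
by congr (_ * _); rewrite !mulrA -(fC d).
Qed.
End FreeLift.

Section FreeLiftMorphism.
Context (k : fieldType) (X : choiceType) (S : pzRingType).
Context (f : {rmorphism k -> S}) (phi : X -> S).
Hypothesis fC : forall c s, GRing.comm (f c) s.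
HB.instance Definition _ := GRing.isMonoidMorphism.Build _ _ (free_lift phi fC)
  (free_lift_is_monoid_morphism phi fC).
End FreeLiftMorphism.

(* [A] is a right [R]-module through [j]; [tensor] is the tensor product of
   [A] and [N] over [R], with its left [A]-module structure. *)

Section Tensor.
Context (R A : pzRingType) (j : {rmorphism R -> A}) (N : lmodType R).
Local Notation pairs := {malg int[(A * N)%type]}.

Inductive tens_rel : pairs -> Prop :=
| TensDl a b x : tens_rel (<< (a + b, x) >> - (<< (a, x) >> + << (b, x) >>))
| TensDr a x y : tens_rel (<< (a, x + y) >> - (<< (a, x) >> + << (a, y) >>))
| TensM a r x : tens_rel (<< (a * j r, x) >> - << (a, r *: x) >>).

Definition tensor := zquot tens_rel.
HB.instance Definition _ := GRing.Zmodule.on tensor.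

Definition tens (a : A) (x : N) : tensor := zpi tens_rel << (a, x) >>.

Definition pairs_act (a : A) : pairs -> pairs :=
  malg_ext (fun q : A * N => mkmalgU (a * q.1, q.2)).
HB.instance Definition _ a := GRing.Additive.on (pairs_act a).

Lemma pairs_actU a c q : pairs_act a << c *g q >> = << c *g (a * q.1, q.2) >>.
Proof. exact: malg_extU. Qed.

Lemma pairs_act_rel a x : in_span tens_rel x -> in_span tens_rel (pairs_act a x).
Proof.
apply: (in_span_map (f := pairs_act a)) => {}x hx; apply: InSpanS.
case: hx => [b c y|b y z|b r y].
- by rewrite raddfB raddfD /= !pairs_actU /= mulrDr; exact: TensDl.
- by rewrite raddfB raddfD /= !pairs_actU; exact: TensDr.
- by rewrite raddfB /= !pairs_actU /= mulrA; exact: TensM.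
Qed.

Definition tens_act (a : A) (z : tensor) : tensor :=
  zpi tens_rel (pairs_act a (zrepr z)).

Lemma tens_act_pi a x : tens_act a (zpi tens_rel x) = zpi tens_rel (pairs_act a x).
Proof.
apply/zpi_eq; rewrite -raddfB; apply: pairs_act_rel.
by rewrite -opprB; apply/in_spanN/zrepr_pi.
Qed.

Lemma tensorW (P : tensor -> Prop) :
  P 0 -> (forall x y, P x -> P y -> P (x + y)) -> (forall x, P x -> P (- x)) ->
  (forall a x, P (tens a x)) -> forall z, P z.
Proof.
move=> P0 PD PN PU z; rewrite -[z]zreprK.
elim/malg_ind_add: (zrepr z) => [|x y hx hy|c [a x]].
- by rewrite raddf0; exact: P0.
- by rewrite raddfD; exact: PD.
have PM (m : nat) : P (zpi tens_rel << m%:Z *g (a, x) >>).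
  elim: m => [|m ih]; first by rewrite monalgU0 raddf0; exact: P0.
  rewrite intS monalgUD raddfD; apply: PD; [exact: PU|exact: ih].
by case: c => m; rewrite ?NegzE ?monalgUN ?raddfN; [|apply: PN]; exact: PM.
Qed.

Lemma tens_actE a b x : tens_act a (tens b x) = tens (a * b) x.
Proof. by rewrite tens_act_pi pairs_actU. Qed.

Lemma tens_actD a : {morph tens_act a : x y / x + y}.
Proof.
move=> x y; rewrite -[x]zreprK -[y]zreprK -raddfD !tens_act_pi.
by rewrite -raddfD -raddfD.
Qed.

Lemma tens_act0 a : tens_act a 0 = 0.
Proof. by apply: (addIr (tens_act a 0)); rewrite -tens_actD !add0r. Qed.

Lemma tens_actN a : {morph tens_act a : x / - x}.
Proof.
by move=> x; apply: (addIr (tens_act a x)); rewrite -tens_actD !addNr tens_act0.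
Qed.

Lemma tensDl a b x : tens (a + b) x = tens a x + tens b x.
Proof. by rewrite -raddfD; apply/zpi_eq/InSpanS/TensDl. Qed.

Lemma tensDr a x y : tens a (x + y) = tens a x + tens a y.
Proof. by rewrite -raddfD; apply/zpi_eq/InSpanS/TensDr. Qed.

Lemma tensM a r x : tens (a * j r) x = tens a (r *: x).
Proof. exact/zpi_eq/InSpanS/TensM. Qed.

Lemma tens_act_comp a b z : tens_act a (tens_act b z) = tens_act (a * b) z.
Proof.
elim/tensorW: z => [|x y hx hy|x hx|c x]; first by rewrite !tens_act0.
- by rewrite !tens_actD hx hy.
- by rewrite !tens_actN hx.
- by rewrite !tens_actE mulrA.
Qed.

Lemma tens_act1 : left_id 1 tens_act.
Proof.
elim/tensorW => [|x y hx hy|x hx|c x]; first by rewrite !tens_act0.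
- by rewrite !tens_actD hx hy.
- by rewrite !tens_actN hx.
- by rewrite !tens_actE mul1r.
Qed.

Lemma tens_act_addl z : {morph tens_act^~ z : a b / a + b}.
Proof.
move=> a b; elim/tensorW: z => [|x y hx hy|x hx|c x].
- by rewrite !tens_act0 addr0.
- by rewrite !tens_actD hx hy addrACA.
- by rewrite !tens_actN hx opprD.
- by rewrite !tens_actE mulrDl tensDl.
Qed.

HB.instance Definition _ := GRing.Zmodule_isLmodule.Build A tensor
  tens_act_comp tens_act1 tens_actD tens_act_addl.
End Tensor.

Section OneDim.
Context (k : fieldType) (R : pzRingType) (rho : {rmorphism R -> k}).

Definition one_dim of {rmorphism R -> k} : Type := k.
HB.instance Definition _ := GRing.Zmodule.on (one_dim rho).

Definition one_dim_act (r : R) (c : one_dim rho) : one_dim rho := rho r * (c : k).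

Lemma one_dim_actA a b v : one_dim_act a (one_dim_act b v) = one_dim_act (a * b) v.
Proof. by rewrite /one_dim_act rmorphM mulrA. Qed.
Lemma one_dim_act1 : left_id 1 one_dim_act.
Proof. by move=> v; rewrite /one_dim_act rmorph1 mul1r. Qed.
Lemma one_dim_actDr : right_distributive one_dim_act +%R.
Proof. by move=> a u v; exact: (mulrDr (rho a) (u : k) v). Qed.
Lemma one_dim_actDl v : {morph one_dim_act^~ v : a b / a + b}.
Proof. by move=> a b; rewrite /one_dim_act raddfD /= mulrDl. Qed.

HB.instance Definition _ := GRing.Zmodule_isLmodule.Build R (one_dim rho)
  one_dim_actA one_dim_act1 one_dim_actDr one_dim_actDl.
End OneDim.

(* [par b] is the homogeneous component of parity [b]; [true] is odd. *)

Definition super_submod (A : pzRingType) (M : lmodType A) (par : bool -> M -> Prop)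
    (N : {pred M}) : Prop :=
  submod_closed N /\
  forall x, x \in N -> exists x0 x1,
    [/\ par false x0, par true x1, x0 \in N, x1 \in N & x = x0 + x1].

Definition super_irreducible (A : pzRingType) (M : lmodType A)
    (par : bool -> M -> Prop) : Prop :=
  (exists x : M, x != 0) /\
  forall N : {pred M}, super_submod par N ->
    (forall x, x \in N -> x = 0) \/ (forall x, x \in N).

Lemma comm_map (A B : pzRingType) (f : {rmorphism A -> B}) x y :
  GRing.comm x y -> GRing.comm (f x) (f y).
Proof. by move=> h; rewrite /GRing.comm -(rmorphM f) h (rmorphM f). Qed.

(* Stated for abstract [A]: rewriting in free algebras is slow. *)
Lemma morph_lin (k : fieldType) (A : lalgType k) (B : pzRingType)
    (f : {rmorphism A -> B}) (c : k) (x y z : A) :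
  f (z - (c *: x + y)) = f z - (f c%:A * f x + f y).
Proof. by rewrite (rmorphB f) (rmorphD f) -(rmorphM f) mulr_algl. Qed.

Lemma morph_bracket (k : fieldType) (A : lalgType k) (B : pzRingType)
    (f : {rmorphism A -> B}) (c : k) (x y z : A) :
  f (x * y - c *: (y * x) - z) = f x * f y - f c%:A * (f y * f x) - f z.
Proof.
rewrite !(rmorphB f) (rmorphM f).
by rewrite -(rmorphM f y) -(rmorphM f c%:A) mulr_algl.
Qed.

Lemma subr0_sym (V : zmodType) (x y : V) : x - y = 0 -> y = x.
Proof. by move/eqP; rewrite subr_eq0 => /eqP. Qed.

Lemma morph_bracketE (A B : pzRingType) (f : {rmorphism A -> B}) (s x y z : A) :
  z = x * y - s * (y * x) -> f z = f x * f y - f s * (f y * f x).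
Proof. by move=> ->; rewrite (rmorphB f) !(rmorphM f). Qed.

Lemma morph_p (A B : pzRingType) (f : {rmorphism A -> B}) m (x y z : A) :
  f (x ^+ m - y - z) = 0 -> f x ^+ m - f y = f z.
Proof.
by rewrite !(rmorphB f) (rmorphXn f) => /eqP; rewrite subr_eq0 => /eqP.
Qed.

Section Matrices.
Context (k : fieldType) (n : nat).
Implicit Types (A : 'M[k]_n) (x y : 'M[k]_(n + n)).

(* [x] is homogeneous of parity [b] *)
Definition homog (b : bool) x : Prop :=
  if b then ulsubmx x = 0 /\ drsubmx x = 0 else ursubmx x = 0 /\ dlsubmx x = 0.

Definition sbracket (b c : bool) x y : 'M[k]_(n + n) :=
  x *m y - (-1) ^+ (b && c) *: (y *m x).

Definition ptilde : {pred 'M[k]_(n + n)} := fun x =>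
  [&& drsubmx x == - (ulsubmx x)^T, ursubmx x == (ursubmx x)^T
    & dlsubmx x == - (dlsubmx x)^T].

(* b_0 + g_1: A is upper triangular and C = 0. *)
Definition borel : {pred 'M[k]_(n + n)} := fun x =>
  [&& x \in ptilde, [forall i : 'I_n, forall j : 'I_n, (j < i)%N ==> (ulsubmx x i j == 0)]
    & dlsubmx x == 0].

Definition gl_emb A : 'M[k]_(n + n) := block_mx A 0 0 (- A^T).

(* Under [gl_emb], [H_i] and the root vector of [epsilon_i - epsilon_j]
   correspond to elementary matrices of gl(n) (lemmas [Hgl_emb], [Xgl_emb]). *)
Definition Hgl (i : 'I_n) : 'M[k]_n := delta_mx i i.
Definition Xgl (i j : 'I_n) : 'M[k]_n := delta_mx i j.

Lemma Xgl_emb i j : gl_emb (Xgl i j) =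
  delta_mx (lshift n i) (lshift n j) - delta_mx (rshift n j) (rshift n i).
Proof.
apply/matrixP=> a b; rewrite /gl_emb trmx_delta !mxE.
case: splitP => a' /= ea; rewrite !mxE; case: splitP => b' /= eb; rewrite !mxE.
- rewrite -!val_eqE /= ea eb.
  have /negbTE -> : (a' : nat) != (n + j)%N.
    by rewrite neq_ltn (leq_trans (ltn_ord a') (leq_addr _ _)).
  by rewrite subr0.
- rewrite -!val_eqE /= ea eb.
  have /negbTE -> : (a' : nat) != (n + j)%N.
    by rewrite neq_ltn (leq_trans (ltn_ord a') (leq_addr _ _)).
  have /negbTE -> : (n + b')%N != j.
    by rewrite eq_sym neq_ltn (leq_trans (ltn_ord j) (leq_addr _ _)).
  by rewrite andbF subr0.
- rewrite -!val_eqE /= ea eb.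
  have /negbTE -> : (n + a')%N != i.
    by rewrite eq_sym neq_ltn (leq_trans (ltn_ord i) (leq_addr _ _)).
  have /negbTE -> : (b' : nat) != (n + i)%N.
    by rewrite neq_ltn (leq_trans (ltn_ord b') (leq_addr _ _)).
  by rewrite andbF subr0.
- rewrite -!val_eqE /= ea eb !eqn_add2l.
  have /negbTE -> : (n + a')%N != i.
    by rewrite eq_sym neq_ltn (leq_trans (ltn_ord i) (leq_addr _ _)).
  by rewrite sub0r.
Qed.

Lemma Hgl_emb i : gl_emb (Hgl i) =
  delta_mx (lshift n i) (lshift n i) - delta_mx (rshift n i) (rshift n i).
Proof. exact: Xgl_emb. Qed.

Lemma ulsubmxM x y :
  ulsubmx (x *m y) = ulsubmx x *m ulsubmx y + ursubmx x *m dlsubmx y.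
Proof. by rewrite -{1}[x]submxK -{1}[y]submxK mulmx_block block_mxKul. Qed.
Lemma ursubmxM x y :
  ursubmx (x *m y) = ulsubmx x *m ursubmx y + ursubmx x *m drsubmx y.
Proof. by rewrite -{1}[x]submxK -{1}[y]submxK mulmx_block block_mxKur. Qed.
Lemma dlsubmxM x y :
  dlsubmx (x *m y) = dlsubmx x *m ulsubmx y + drsubmx x *m dlsubmx y.
Proof. by rewrite -{1}[x]submxK -{1}[y]submxK mulmx_block block_mxKdl. Qed.
Lemma drsubmxM x y :
  drsubmx (x *m y) = dlsubmx x *m ursubmx y + drsubmx x *m drsubmx y.
Proof. by rewrite -{1}[x]submxK -{1}[y]submxK mulmx_block block_mxKdr. Qed.

Lemma ulsubmxBZ a x y : ulsubmx (x - a *: y) = ulsubmx x - a *: ulsubmx y.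
Proof. by apply/matrixP=> i j; rewrite !mxE. Qed.
Lemma ursubmxBZ a x y : ursubmx (x - a *: y) = ursubmx x - a *: ursubmx y.
Proof. by apply/matrixP=> i j; rewrite !mxE. Qed.
Lemma dlsubmxBZ a x y : dlsubmx (x - a *: y) = dlsubmx x - a *: dlsubmx y.
Proof. by apply/matrixP=> i j; rewrite !mxE. Qed.
Lemma drsubmxBZ a x y : drsubmx (x - a *: y) = drsubmx x - a *: drsubmx y.
Proof. by apply/matrixP=> i j; rewrite !mxE. Qed.

Lemma sbracket_ptilde b c x y : x \in ptilde -> y \in ptilde ->
  homog b x -> homog c y -> sbracket b c x y \in ptilde.
Proof.
move=> /and3P[/eqP dx /eqP ux /eqP lx] /and3P[/eqP dy /eqP uy /eqP ly] hx hy.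
have lx' : (dlsubmx x)^T = - dlsubmx x by rewrite {2}lx opprK.
have ly' : (dlsubmx y)^T = - dlsubmx y by rewrite {2}ly opprK.
have [ux' uy'] := (esym ux, esym uy).
apply/and3P; rewrite /sbracket !(ulsubmxBZ, ursubmxBZ, dlsubmxBZ, drsubmxBZ).
rewrite !(ulsubmxM, ursubmxM, dlsubmxM, drsubmxM).
rewrite !(raddfB trmx) !linearZ !(raddfD trmx) /= !trmx_mul.
case: b hx => [[ex1 ex2]|[ex1 ex2]]; case: c hy => [[ey1 ey2]|[ey1 ey2]];
  rewrite ?ex1 ?ex2 ?ey1 ?ey2 ?dx ?dy !(trmx0, mul0mx, mulmx0, addr0, add0r,
    subr0, oppr0, scaler0, expr0, expr1, scale1r, scaleN1r) /=; split=> //;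
  rewrite ?(mulNmx, mulmxN) ?(raddfN trmx) /= ?trmx_mul ?trmxK ?lx' ?ly' ?ux' ?uy'
    ?(mulNmx, mulmxN) ?(raddfN trmx) /= ?trmx_mul ?trmxK
    ?(mulNmx, mulmxN, opprB, opprD, opprK) ?lx' ?ly' ?ux' ?uy'
    ?(mulNmx, mulmxN, opprK) //; by rewrite addrC.
Qed.

Lemma borel_sub x : x \in borel -> x \in ptilde.
Proof. by case/and3P. Qed.

Definition upper A := forall i j : 'I_n, (j < i)%N -> A i j = 0.

Lemma upperM A B : upper A -> upper B -> upper (A *m B).
Proof.
move=> hA hB i j ji; rewrite mxE big1 // => l _.
have [li|il] := ltnP l i; first by rewrite hA ?mul0r.
by rewrite hB ?mulr0 // (leq_trans ji).
Qed.

Lemma upperM_diag A B i : upper A -> upper B -> (A *m B) i i = A i i * B i i.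
Proof.
move=> hA hB; rewrite mxE (bigD1 i) //= big1 ?addr0 // => l li.
have [lti|il] := ltnP l i; first by rewrite hA ?mul0r.
by rewrite hB ?mulr0 // ltn_neqAle il andbT eq_sym.
Qed.

Lemma upper_exp A m : upper A -> upper (A ^+ m).
Proof.
move=> hA; elim: m => [|m ih]; last by rewrite exprS; exact: upperM.
by move=> i j; rewrite expr0 mxE => ji; rewrite -val_eqE /= gtn_eqF.
Qed.

Lemma upper_exp_diag A m i : upper A -> (A ^+ m) i i = A i i ^+ m.
Proof.
move=> hA; elim: m => [|m ih]; first by rewrite !expr0 mxE eqxx.
by rewrite !exprS -ih upperM_diag //; exact: upper_exp.
Qed.

Lemma borelP x :
  x \in borel <-> [/\ x \in ptilde, upper (ulsubmx x) & dlsubmx x = 0].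
Proof.
split=> [/and3P[h1 h2 /eqP h3]|[h1 h2 h3]].
  split=> // i j ji; move/forallP: h2 => /(_ i)/forallP/(_ j)/implyP/(_ ji).
  by move/eqP.
apply/and3P; split=> //; last exact/eqP.
by apply/forallP => i; apply/forallP => j; apply/implyP => /h2 ->.
Qed.

Lemma gl_emb_ptilde A : gl_emb A \in ptilde.
Proof.
apply/and3P; rewrite /gl_emb block_mxKul block_mxKur block_mxKdl block_mxKdr.
by rewrite !trmx0 oppr0.
Qed.

Lemma gl_emb_borel A : gl_emb A \in borel <-> upper A.
Proof.
rewrite borelP /gl_emb block_mxKul block_mxKdl; split=> [[]//|hA].
by split=> //; exact: gl_emb_ptilde.
Qed.

Lemma sbracket_borel b c x y : x \in borel -> y \in borel ->
  homog b x -> homog c y -> sbracket b c x y \in borel.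
Proof.
move=> /borelP[px ux lx] /borelP[py uy ly] hx hy; apply/borelP; split.
- exact: sbracket_ptilde.
- move=> i j ji; rewrite /sbracket ulsubmxBZ !ulsubmxM lx ly !mulmx0 !addr0.
  rewrite mxE (upperM ux uy ji) add0r mxE mxE (upperM uy ux ji).
  by rewrite mulr0 oppr0.
- by rewrite /sbracket dlsubmxBZ !dlsubmxM lx ly !mul0mx !mulmx0 !addr0 scaler0 subr0.
Qed.

End Matrices.

(* [L] is meant to be a graded subspace of [gl(n|n)] closed under the
   superbracket and the [p]-mapping, with even part inside
   g_0 = [gl_emb] gl(n); [chi] is a linear form on g_0, identified with gl(n)
   through [gl_emb].  [env] is the enveloping superalgebra U(L), and [redenv]
   its quotient U_chi(L). *)

Section Enveloping.
Context (k : fieldType) (p n : nat) (chi : {scalar 'M[k]_n}).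
Context (L : {pred 'M[k]_(n + n)}).

Definition elt := {x : 'M[k]_(n + n) | x \in L}.

Definition free_alg := {malg k[{fmonom elt}]}.
Definition fgen (x : elt) : free_alg := << fmu x >>.

Inductive env_rel : free_alg -> Prop :=
| EnvLin a x y z of val z = a *: val x + val y :
    env_rel (fgen z - (a *: fgen x + fgen y))
| EnvBracket b c x y z of homog b (val x) & homog c (val y)
    & val z = sbracket b c (val x) (val y) :
    env_rel (fgen x * fgen y - (-1) ^+ (b && c) *: (fgen y * fgen x) - fgen z).

Definition env := rquot env_rel.
HB.instance Definition _ := GRing.PzRing.on env.
Definition env_gen (x : elt) : env := rpi env_rel (fgen x).
Definition env_scal (c : k) : env := rpi env_rel c%:A.

Inductive red_rel : env -> Prop :=
| RedP A x z of val x = gl_emb A & val z = gl_emb (A ^+ p) :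
    red_rel (env_gen x ^+ p - env_gen z - env_scal (chi A ^+ p)).

Definition redenv := rquot red_rel.
HB.instance Definition _ := GRing.PzRing.on redenv.
Definition red_gen (x : elt) : redenv := rpi red_rel (env_gen x).
Definition red_scal (c : k) : redenv := rpi red_rel (env_scal c).

(* [red_par b] is the component of parity [b] of U_chi(L). *)
Inductive red_par : bool -> redenv -> Prop :=
| RedPar0 b : red_par b 0
| RedPar1 : red_par false 1
| RedParD b u v : red_par b u -> red_par b v -> red_par b (u + v)
| RedParZ b c u : red_par b u -> red_par b (red_scal c * u)
| RedParM b c x u : homog c (val x) -> red_par b u ->
    red_par (c (+) b) (red_gen x * u).

Lemma red_scal_is_zmod_morphism : zmod_morphism red_scal.
Proof.
move=> a b; rewrite /red_scal /env_scal scalerBl.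
by rewrite (rmorphB (rpi env_rel)) (rmorphB (rpi red_rel)).
Qed.
HB.instance Definition _ := GRing.isZmodMorphism.Build k redenv red_scal
  red_scal_is_zmod_morphism.
Lemma red_scal_is_monoid_morphism : monoid_morphism red_scal.
Proof.
split=> [|a b]; rewrite /red_scal /env_scal.
  by rewrite scale1r (rmorph1 (rpi env_rel)) (rmorph1 (rpi red_rel)).
rewrite -(rmorphM (rpi red_rel)) -(rmorphM (rpi env_rel)).
by rewrite mulr_algl scalerA.
Qed.
HB.instance Definition _ := GRing.isMonoidMorphism.Build k redenv red_scal
  red_scal_is_monoid_morphism.

Lemma malgC_comm (c : k) (g : free_alg) : c%:A * g = g * c%:A.
Proof.
rewrite -!(mul_malgC _ 1) mulr1.
elim/malg_ind_add: g => [|x y hx hy|d m]; first by rewrite mulr0 mul0r.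
  by rewrite mulrDl mulrDr hx hy.
by rewrite !malgM_def !fgmulUU mul1m mulm1 mulrC.
Qed.

Lemma red_scal_comm c u : GRing.comm (red_scal c) u.
Proof.
elim/rquotW: u => u; elim/rquotW: u => u.
rewrite /red_scal; apply: (comm_map (rpi red_rel)).
rewrite /env_scal; apply: (comm_map (rpi env_rel)).
exact: malgC_comm.
Qed.

Section Universal.
Context (S : pzRingType) (f : {rmorphism k -> S}) (phi : elt -> S).
Hypothesis fC : forall c s, GRing.comm (f c) s.
Hypothesis phiL : forall a x y z, val z = a *: val x + val y ->
  phi z = f a * phi x + phi y.
Hypothesis phiB : forall b c x y z, homog b (val x) -> homog c (val y) ->
  val z = sbracket b c (val x) (val y) ->
  phi z = phi x * phi y - (-1) ^+ (b && c) * (phi y * phi x).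
Hypothesis phiP : forall A x z, val x = gl_emb A -> val z = gl_emb (A ^+ p) ->
  phi x ^+ p - phi z = f (chi A ^+ p).

Lemma free_lift_gen x : free_lift phi fC (fgen x) = phi x.
Proof. by rewrite free_liftU rmorph1 mul1r fmU big_seq1. Qed.

Lemma free_lift_scal c : free_lift phi fC c%:A = f c.
Proof. by rewrite -mul_malgC mulr1 free_liftU fm1 big_nil mulr1. Qed.

Lemma env_lift_rel x : env_rel x -> free_lift phi fC x = 0.
Proof.
case=> [a u v z h|b c u v z hu hv h].
  rewrite (morph_lin (free_lift phi fC)) /= !free_lift_gen free_lift_scal.
  by rewrite (phiL h) subrr.
rewrite (morph_bracket (free_lift phi fC)) /= !free_lift_gen free_lift_scal.
by rewrite (phiB hu hv h) (rmorphXn f) (rmorphN f) (rmorph1 f) subrr.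
Qed.

Definition env_lift : {rmorphism env -> S} := rquot_lift env_lift_rel.

Lemma env_lift_pi x : env_lift (rpi env_rel x) = free_lift phi fC x.
Proof. exact: rquot_lift_pi. Qed.

Lemma red_lift_rel x : red_rel x -> env_lift x = 0.
Proof.
case=> A u z hu hz.
have FB u' v : env_lift (u' - v) = env_lift u' - env_lift v := raddfB env_lift u' v.
rewrite !FB (rmorphXn env_lift) !env_lift_pi !free_lift_gen free_lift_scal (phiP hu hz).
exact: subrr.
Qed.

Definition red_lift : {rmorphism redenv -> S} := rquot_lift red_lift_rel.

Lemma red_lift_pi x : red_lift (rpi red_rel x) = env_lift x.
Proof. exact: rquot_lift_pi. Qed.

Lemma red_lift_gen x : red_lift (red_gen x) = phi x.
Proof. by rewrite red_lift_pi env_lift_pi free_lift_gen. Qed.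

Lemma red_lift_scal c : red_lift (red_scal c) = f c.
Proof. by rewrite red_lift_pi env_lift_pi free_lift_scal. Qed.
End Universal.

Lemma red_gen_lin a x y z : val z = a *: val x + val y ->
  red_gen z = red_scal a * red_gen x + red_gen y.
Proof.
move=> h; have := rpi0 (EnvLin h).
rewrite morph_lin => /eqP; rewrite subr_eq0 => /eqP e.
by rewrite /red_gen {1}/env_gen e (rmorphD (rpi red_rel)) (rmorphM (rpi red_rel)).
Qed.

Lemma red_gen_bracket b c x y z : homog b (val x) -> homog c (val y) ->
  val z = sbracket b c (val x) (val y) ->
  red_gen z = red_gen x * red_gen y
    - (-1) ^+ (b && c) * (red_gen y * red_gen x).
Proof.
move=> hx hy h; have := rpi0 (EnvBracket hx hy h).
rewrite morph_bracket => /subr0_sym e.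
rewrite [LHS](morph_bracketE (rpi red_rel) e).
congr (_ - _ * _).
rewrite -[LHS]/(red_scal ((-1) ^+ _)) (rmorphXn red_scal) (rmorphN red_scal).
by rewrite (rmorph1 red_scal).
Qed.

Lemma red_gen_p A x z : val x = gl_emb A -> val z = gl_emb (A ^+ p) ->
  red_gen x ^+ p - red_gen z = red_scal (chi A ^+ p).
Proof. by move=> hx hz; exact: morph_p (rpi0 (RedP hx hz)). Qed.
End Enveloping.

Section BabyVerma.
Context (k : fieldType) (p n : nat) (chi : {scalar 'M[k]_n}).
Context (lambda : 'I_n -> k).
Local Notation Ug := (redenv p chi (@ptilde k n)).
Local Notation Ub := (redenv p chi (@borel k n)).

Definition borel_elt (x : elt (@borel k n)) : elt (@ptilde k n) :=
  exist _ (val x) (borel_sub (valP x)).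

Definition borel_incl : {rmorphism Ub -> Ug} :=
  red_lift (f := red_scal p chi (@ptilde k n))
    (phi := fun x => red_gen p chi (borel_elt x))
    (@red_scal_comm _ _ _ _ _)
    (fun a x y z => @red_gen_lin _ _ _ _ _ a (borel_elt x) (borel_elt y) (borel_elt z))
    (fun b c x y z =>
      @red_gen_bracket _ _ _ _ _ b c (borel_elt x) (borel_elt y) (borel_elt z))
    (fun A x z => @red_gen_p _ _ _ _ _ A (borel_elt x) (borel_elt z)).

(* [lambda] is given by its coordinates in the basis [epsilon_i] dual to [H_i] *)
Definition in_Lambda : Prop := forall i, lambda i ^+ p - lambda i = chi (Hgl k i) ^+ p.

(* lambda on the torus component of x, extended by 0 on n_0^+ and g_1 *)
Definition weight_ext (x : elt (@borel k n)) : k :=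
  \sum_i lambda i * ulsubmx (val x) i i.

Hypothesis kp : p \in [pchar k].
Hypothesis chi_nplus : forall i j : 'I_n, (i < j)%N -> chi (Xgl k i j) = 0.
Hypothesis lambda_chi : in_Lambda.

Lemma weight_ext_lin a x y z : val z = a *: val x + val y ->
  weight_ext z = a * weight_ext x + weight_ext y.
Proof.
rewrite /weight_ext => ->; rewrite mulr_sumr -big_split /=.
by apply: eq_bigr => i _; rewrite !mxE mulrDr mulrCA.
Qed.

Lemma weight_ext_odd x : homog true (val x) -> weight_ext x = 0.
Proof.
by case=> h _; rewrite /weight_ext h big1 // => i _; rewrite mxE mulr0.
Qed.

Lemma weight_ext_bracket b c x y z : homog b (val x) -> homog c (val y) ->
  val z = sbracket b c (val x) (val y) ->
  weight_ext z = weight_ext x * weight_ext y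
    - (-1) ^+ (b && c) * (weight_ext y * weight_ext x).
Proof.
move=> hx hy hz.
have [_ ux lx] := (borelP _).1 (valP x).
have [_ uy ly] := (borelP _).1 (valP y).
transitivity (0 : k).
  rewrite /weight_ext hz big1 // => i _.
  rewrite /sbracket ulsubmxBZ !ulsubmxM lx ly !mulmx0 !addr0.
  rewrite mxE [X in _ + X]mxE [X in - X]mxE !upperM_diag //.
  case: b hx hz => [[-> _] _|_ _].
    by rewrite mxE !(mul0r, mulr0) subr0 mulr0.
  by rewrite mul1r [X in _ - X]mulrC subrr mulr0.
case: b hx {hz} => hx; last by rewrite mul1r [X in _ - X]mulrC subrr.
by rewrite (weight_ext_odd hx) mul0r !mulr0 subr0.
Qed.

Lemma chi_upper A : upper A -> chi A = \sum_i A i i * chi (Hgl k i).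
Proof.
move=> hA; rewrite {1}[A]matrix_sum_delta raddf_sum; apply: eq_bigr => i _ /=.
rewrite raddf_sum (bigD1 i) //= linearZ /= big1 ?addr0 // => j ji.
rewrite linearZ /=; have [lij|lji] := ltnP i j.
  by rewrite (chi_nplus lij) mulr0.
by rewrite hA ?mul0r // ltn_neqAle lji ji.
Qed.

Lemma weight_ext_p A x z : val x = gl_emb A -> val z = gl_emb (A ^+ p) ->
  weight_ext x ^+ p - weight_ext z = chi A ^+ p.
Proof.
move=> hx hz; have := valP x; rewrite hx => /gl_emb_borel uA.
rewrite /weight_ext hx hz /gl_emb !block_mxKul (chi_upper uA).
have FS (F : 'I_n -> k) : (\sum_i F i) ^+ p = \sum_i F i ^+ p.
  rewrite -(pFrobenius_autE kp) raddf_sum; apply: eq_bigr => i _.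
  exact: pFrobenius_autE.
rewrite !FS -sumrB; apply: eq_bigr => i _.
rewrite (upper_exp_diag _ _ uA) !exprMn -lambda_chi.
by rewrite mulrBr [X in _ = X - _]mulrC [X in _ = _ - X]mulrC.
Qed.

Definition borel_char : {rmorphism Ub -> k} :=
  red_lift (f := GRing.RMorphism.clone _ _ (@idfun k) _) (phi := weight_ext)
    (fun c s => mulrC c s) weight_ext_lin weight_ext_bracket weight_ext_p.

Definition k_lambda : lmodType Ub := one_dim borel_char.

Definition baby_verma : lmodType Ug := tensor borel_incl k_lambda.

(* [k_lambda] is placed in even degree *)
Definition baby_verma_par (b : bool) (z : baby_verma) : Prop :=
  exists2 u : Ug, red_par b u & z = tens borel_incl u (1 : k_lambda).
End BabyVerma.

Definition regular_nilpotent (k : fieldType) (n : nat) (chi : {scalar 'M[k]_n}) : Prop :=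
  [/\ forall i, chi (Hgl k i) = 0,
      forall i j : 'I_n, i = j.+1 :> nat -> chi (Xgl k i j) = 1
    & forall i j : 'I_n, i != j -> i != j.+1 :> nat -> chi (Xgl k i j) = 0].

Lemma regular_nilpotent_nplus (k : fieldType) (n : nat) (chi : {scalar 'M[k]_n}) :
  regular_nilpotent chi ->
  forall i j : 'I_n, (i < j)%N -> chi (Xgl k i j) = 0.
Proof.
case=> _ _ h i j ij; apply: h; first by rewrite -val_eqE neq_ltn ij.
by rewrite neq_ltn (ltn_trans ij).
Qed.

(* Main.v *)
Require Import Defs.
From HB Require Import structures.
From mathcomp Require Import all_boot all_order all_algebra.
From mathcomp Require Import zify ring.
From mathcomp Require Import finmap boolp monalg.

Set Implicit Arguments.
Unset Strict Implicit.
Unset Printing Implicit Defensive.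

Import Order.TTheory GRing.Theory Num.Theory.
Local Open Scope ring_scope.

(* Let m = n_0^- + g_{-1}.  On m, chi is a character, and m acts on Z by
   operators x - chi(x) that are nilpotent, so a nonzero submodule N contains a
   Whittaker vector w, killed by all x - chi(x).  As chi is regular nilpotent,
   the form (x, y) |-> chi([x, y]) pairs m nondegenerately with a subspace d of
   b_0 + g_1.  For the Kazhdan filtration (an element of degree i has weight
   i + 1), the product of all (x - chi(x))^(p-1) resp. x over a basis of m,
   applied to the product of all powers y^(p-1) resp. y over the dual basis of d
   and to w, is a nonzero multiple of w.  That product annihilates the
   augmentation part J Z of Z, and Z = k v + J Z for the highest weight vector
   v.  Hence v lies in N + J Z, so Z = N + J Z and Z = N by Nakayama.

   That Z is nonzero is shown by a highest weight vector in a tensor product of n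
   oscillator representations of gl(n|n), on polynomials in even and odd
   variables; the i-th factor has a p-character supported at the single root
   vector of -alpha_i. *)

(** * Nilpotent families *)

(** [U_chi(g)] is given by generators and relations, so no basis of it is at hand. Simplicity is
    therefore argued with spanning sets alone: a product that the operators of m annihilate from
    both sides, and one explicit scalar, take the place of a PBW basis and a dimension count. Linear
    independence enters only in [Z <> 0], where a concrete module decides. The shift by one in the
    weight is forced by the pairing: x in degree -h and its dual y in degree h - 1 have [x, y] in
    degree -1, the degree where chi lives, and this degree has weight 0. Modulo lower terms x -
    chi(x) then acts on powers of y as a multiple of d/dy, which accounts for the factor (p-1)! in
    the scalar. In a single oscillator representation the operators x_a d_b have p-th powers al_a
    be_b, a rank one array; for n >= 3 its off-diagonal entries cannot be those of chi, while a sum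
    of several such arrays can. The relation x^p - x^[p] = chi(x)^p has to hold on all of gl(n) and
    not only on root vectors; this is what Jacobson's formula is for. *)

Definition central (R : pzRingType) (c : R) := forall x, GRing.comm c x.

Lemma central_sign (R : pzRingType) (b : bool) : central ((-1) ^+ b : R).
Proof. by move=> x; exact/commr_sym/commr_sign. Qed.

Section Nested.
Context (R : pzRingType) (I : eqType) (th : I -> R) (e h : I -> nat).
Context (sg : I -> I -> bool).
Implicit Types (s : seq I) (i j l : I).

Definition nested s := forall i j, i \in s -> j \in s ->
  exists2 c : I -> R, (forall l, central (c l)) &
    th i * th j = (-1) ^+ sg i j * (th j * th i)
      + \sum_(l <- s | (h i < h l)%N && (h j < h l)%N) c l * th l.

Definition depth_sorted s := pairwise (fun i j => h i <= h j)%N s.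

(** The head has least depth, so it never occurs among the strictly deeper terms of a bracket. *)
Lemma nested_cons t s : depth_sorted (t :: s) -> nested (t :: s) -> nested s.
Proof.
rewrite /depth_sorted /= => /andP[/allP ts _] nt i j si sj.
have [|| c cC ->] := nt i j; rewrite ?inE ?si ?sj ?orbT //; exists c => //.
by rewrite big_cons /= ltnNge (ts _ si).
Qed.

Lemma nested_head t s j : depth_sorted (t :: s) -> nested (t :: s) -> j \in s ->
  exists2 c : I -> R, (forall l, central (c l)) &
    th t * th j = (-1) ^+ sg t j * (th j * th t) + \sum_(l <- s) c l * th l.
Proof.
rewrite /depth_sorted /= => /andP[/allP ts _] nt sj.
have [|| c cC ->] := nt t j; rewrite ?inE ?eqxx ?sj ?orbT //.
exists (fun l => if (h t < h l)%N && (h j < h l)%N then c l else 0).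
  by move=> l; case: ifP => // _ x; rewrite /GRing.comm mul0r mulr0.
rewrite big_cons /= ltnn big_mkcond /=; congr (_ + _).
by apply: eq_bigr => l _; case: ifP; rewrite ?mul0r.
Qed.

Lemma nested_headV t s j : depth_sorted (t :: s) -> nested (t :: s) -> j \in s ->
  exists2 c : I -> R, (forall l, central (c l)) &
    th j * th t = (-1) ^+ sg j t * (th t * th j) + \sum_(l <- s) c l * th l.
Proof.
rewrite /depth_sorted /= => /andP[/allP ts _] nt sj.
have [|| c cC ->] := nt j t; rewrite ?inE ?eqxx ?sj ?orbT //.
exists (fun l => if (h j < h l)%N && (h t < h l)%N then c l else 0).
  by move=> l; case: ifP => // _ x; rewrite /GRing.comm mul0r mulr0.
rewrite big_cons /= ltnn andbF big_mkcond /=; congr (_ + _).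
by apply: eq_bigr => l _; case: ifP; rewrite ?mul0r.
Qed.

Definition top s : R := \prod_(i <- s) th i ^+ e i.

(** Brackets with the head fall into the span of the tail, so the head preserves the common kernel
    of the tail. *)
Lemma head_stable_mod (M : lmodType R) t s (u : M) :
  depth_sorted (t :: s) -> nested (t :: s) ->
  (forall j, j \in s -> th j *: u = 0) ->
  forall j, j \in s -> th j *: (th t *: u) = 0.
Proof.
move=> ds ns us j sj; have [c _ E] := nested_headV ds ns sj.
rewrite scalerA E scalerDl -scalerA -scalerA us // !scaler0 add0r scaler_suml.
by rewrite big_seq big1 // => l sl; rewrite -scalerA us // scaler0.
Qed.

Lemma head_stable t s (u : R) : depth_sorted (t :: s) -> nested (t :: s) ->
  (forall j, j \in s -> th j * u = 0) -> forall m j, j \in s -> th j * (th t ^+ m * u) = 0.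
Proof.
move=> ds ns us; elim=> [|m ih] j sj; first by rewrite expr0 mul1r us.
by rewrite exprS -mulrA; apply: (@head_stable_mod R^o t s).
Qed.

Hypothesis th_nil : forall i, th i ^+ (e i).+1 = 0.

(** Engel's argument: starting from a vector killed by the tail, the last nonzero image under powers
    of the head is killed by the head as well, and still by the tail. *)
Lemma whittaker_exists (M : lmodType R) (N : M -> Prop) s :
  (forall i u, N u -> N (th i *: u)) -> depth_sorted s -> nested s ->
  (exists2 u, N u & u != 0) ->
  exists u, [/\ N u, u != 0 & forall j, j \in s -> th j *: u = 0].
Proof.
move=> Nth; elim: s => [|t s ih] ds ns Nu.
  by have [u hu u0] := Nu; exists u.
have [|u [hu u0 us]] := ih _ (nested_cons ds ns) Nu; first by case/andP: ds.
have H m : N (th t ^+ m *: u) /\ forall j, j \in s -> th j *: (th t ^+ m *: u) = 0.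
  elim: m => [|m [h1 h2]]; first by rewrite expr0 scale1r.
  rewrite exprS -scalerA; split; first exact: Nth.
  exact: head_stable_mod.
have : exists m, th t ^+ m *: u == 0 by exists (e t).+1; rewrite th_nil scale0r.
case/ex_minnP => [[|m]]; first by rewrite expr0 scale1r (negbTE u0).
move=> hm mmin; exists (th t ^+ m *: u); have [h1 h2] := H m; split=> //.
  by apply/negP => /mmin; rewrite ltnn.
move=> j; rewrite inE => /predU1P[->|]; last exact: h2.
by rewrite scalerA -exprS; apply/eqP.
Qed.

Lemma th_top s : depth_sorted s -> nested s -> forall j, j \in s -> th j * top s = 0.
Proof.
elim: s => [//|t s ih] ds ns j; rewrite /top big_cons inE => /predU1P[->|sj].
  by rewrite mulrA -exprS th_nil mul0r.
have ds' : depth_sorted s by case/andP: ds.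
exact: (head_stable ds ns (ih ds' (nested_cons ds ns))).
Qed.

(** Moving [th t] to the left past a factor creates deeper terms, and these annihilate the product
    to their right by [th_top]; only signs survive. *)
Lemma top_comm t s : depth_sorted s -> nested s ->
  (forall j, j \in s -> exists2 c : I -> R, (forall l, central (c l)) &
    th j * th t = (-1) ^+ sg j t * (th t * th j)
      + \sum_(l <- s | (h j < h l)%N) c l * th l) ->
  exists b : bool, top s * th t = (-1) ^+ b * (th t * top s).
Proof.
elim: s => [|u s ih] ds ns ts.
  by exists false; rewrite /top big_nil mul1r mulr1 mul1r.
have ds2 : depth_sorted s by case/andP: ds.
have ns2 := nested_cons ds ns.
have tm := head_stable ds ns (th_top ds2 ns2).
have [|b Eb] := ih ds2 ns2.
  move=> j sj; have [|c cC ->] := ts j; first by rewrite inE sj orbT.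
  exists c => //; rewrite big_cons ltnNge.
  by have /andP[/allP -> //] := ds.
have [|c cC Eu] := ts u; first by rewrite inE eqxx.
have [b' Eb'] : exists b : bool,
    th u ^+ e u * th t * top s = (-1) ^+ b * (th t * (th u ^+ e u * top s)).
  elim: (e u) => [|m [b1 IH]]; first by exists false; rewrite !expr0 !mul1r.
  exists (b1 (+) sg u t).
  rewrite exprS -!mulrA [_ * (th t * top s)]mulrA IH !mulrA -(central_sign b1) -!mulrA.
  rewrite [th u * (th t * _)]mulrA Eu mulrDl mulr_suml.
  rewrite [X in _ + X]big1_seq ?addr0 => [|l /andP[ul]].
    by rewrite signr_addb !mulrA.
  by rewrite inE => /predU1P[lu|/(tm m) El]; [rewrite lu ltnn in ul|rewrite -mulrA El mulr0].
exists (b (+) b'); rewrite /top !big_cons -/(top s) -mulrA Eb [LHS]mulrA -(central_sign b).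
by rewrite -mulrA [th u ^+ _ * (th t * _)]mulrA Eb' signr_addb !mulrA.
Qed.

Lemma top_th s : depth_sorted s -> nested s -> forall j, j \in s -> top s * th j = 0.
Proof.
elim: s => [//|t s ih] ds ns j; rewrite inE.
have ds' : depth_sorted s by case/andP: ds.
case/predU1P => [->|sj]; last first.
  by rewrite /top big_cons -mulrA (ih ds' (nested_cons ds ns)) // mulr0.
have [|b E] := @top_comm t s ds' (nested_cons ds ns).
  move=> i si; have [|| c cC ->] := ns i t; rewrite ?inE ?eqxx ?si ?orbT //.
  exists c => //; rewrite big_cons ltnn andbF; congr (_ + _).
  apply: eq_bigl => l; case: (ltnP (h i) (h l)) => //= il.
  by rewrite (leq_ltn_trans _ il) //; case/andP: ds => /allP ->.
rewrite /top big_cons -/(top s) -mulrA E [LHS]mulrA -(central_sign b) -!mulrA.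
by rewrite (mulrA (th t ^+ _)) -exprSr th_nil mul0r mulr0.
Qed.

(** For a subgroup [N] this is [N] plus the sum of the images of [th i] for [i] in [s]. *)
Inductive aug_span (M : lmodType R) (N : M -> Prop) s : M -> Prop :=
| AugN u : N u -> aug_span N s u
| AugD u v : aug_span N s u -> aug_span N s v -> aug_span N s (u + v)
| AugT i u : i \in s -> aug_span N s (th i *: u).

Lemma aug_span_sum (M : lmodType R) (N : M -> Prop) s (r : seq I) (F : I -> M) :
  N 0 -> (forall i, i \in r -> aug_span N s (F i)) -> aug_span N s (\sum_(i <- r) F i).
Proof.
move=> N0 H; rewrite big_seq; elim/big_ind: _ => //; first exact: AugN.
exact: AugD.
Qed.

(** The head is removed first: the span S of [N] and the images of the tail is stable under [th t],
    and M = S + th t M. Iterating this equation [(e t).+1] times gives M = S by nilpotency. *)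
Lemma nakayama (M : lmodType R) (N : M -> Prop) s :
  N 0 -> (forall u v, N u -> N v -> N (u + v)) ->
  (forall i u, N u -> N (th i *: u)) -> depth_sorted s -> nested s ->
  (forall u, aug_span N s u) -> forall u, N u.
Proof.
move=> N0 ND Nth; elim: s => [|t s ih] ds ns H.
  by move=> u; elim: (H u) => [//|v w _ hv _ hw|//]; exact: ND.
have ds' : depth_sorted s by case/andP: ds.
apply: (ih ds' (nested_cons ds ns)).
have tst u : aug_span N s u -> aug_span N s (th t *: u).
  elim=> [v|v w _ hv _ hw|i v si]; first by move/(Nth t); exact: AugN.
    by rewrite scalerDr; exact: AugD.
  have [c cC E] := nested_head ds ns si.
  rewrite scalerA E scalerDl; apply: AugD.
    by rewrite mulrA (central_sign _ (th i)) -mulrA -scalerA; exact: AugT.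
  rewrite scaler_suml; apply: aug_span_sum => // l sl.
  by rewrite (cC l) -scalerA; exact: AugT.
have step m u : exists v w, aug_span N s v /\ u = v + th t ^+ m *: w.
  elim: m => [|m [v [w [hv ->]]]].
    by exists 0, u; rewrite expr0 scale1r add0r; split=> //; exact: AugN.
  have [v' [w' [hv' Ew]]] : exists v' w', aug_span N s v' /\ w = v' + th t *: w'.
    elim: (H w) => [a Na|a b _ [a1 [a2 [h1 ->]]] _ [b1 [b2 [h2 ->]]]|i a].
    - by exists a, 0; rewrite scaler0 addr0; split=> //; exact: AugN.
    - by exists (a1 + b1), (a2 + b2); rewrite scalerDr addrACA; split=> //; exact: AugD.
    rewrite inE => /predU1P[->|si]; last first.
      by exists (th i *: a), 0; rewrite scaler0 addr0; split=> //; exact: AugT.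
    by exists 0, a; rewrite add0r; split=> //; exact: AugN.
  exists (v + th t ^+ m *: v'), w'; split.
    apply: AugD => //; elim: (m) => [|l hl]; first by rewrite expr0 scale1r.
    by rewrite exprS -scalerA; exact: tst.
  by rewrite Ew scalerDr addrA scalerA exprSr.
by move=> u; have [v [w [hv ->]]] := step (e t).+1 u; rewrite th_nil scale0r addr0.
Qed.
End Nested.

(** * The Kazhdan filtration *)

Section KazhdanFiltration.
Context (R : pzRingType) (M : lmodType R) (X : Type).
Context (hom : bool -> int -> X -> Prop) (br : bool -> bool -> X -> X -> X).
Context (rho chi : X -> R).
Hypothesis chiC : forall x, central (chi x).
Hypothesis hom_br : forall b d x c g y, hom b d x -> hom c g y ->
  hom (b (+) c) (d + g) (br b c x y).
Hypothesis rho_br : forall b d x c g y, hom b d x -> hom c g y ->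
  rho x * rho y = (-1) ^+ (b && c) * (rho y * rho x) + rho (br b c x y).
Hypothesis chi_deg : forall b d x, hom b d x -> d < 0 -> b || (d != -1) -> chi x = 0.

Definition shifted x := rho x - chi x.

Lemma shifted_rho b d x c g y : hom b d x -> hom c g y -> d < 0 ->
  shifted x * rho y = rho (br b c x y) + (-1) ^+ (b && c) * (rho y * shifted x).
Proof.
move=> hx hy d0; rewrite /shifted mulrBl mulrBr (rho_br hx hy) (chiC x).
case: b hx => hx /=; last by rewrite !mul1r [_ + rho _]addrC -addrA.
by rewrite (chi_deg hx d0) // mulr0 !subr0 addrC.
Qed.

Context (w : M).

(** Only elements of nonnegative degree build the filtration, so its negative part is zero by
    construction ([kfil_neg]). That elements of negative degree respect it is then a property to
    prove. *)
Inductive kfil : int -> M -> Prop :=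
| KFil0 r : kfil r 0
| KFilD r u v : kfil r u -> kfil r v -> kfil r (u + v)
| KFilZ r c v : central c -> kfil r v -> kfil r (c *: v)
| KFilW r : 0 <= r -> kfil r w
| KFilX b d x r r' v : hom b d x -> 0 <= d -> kfil r v -> r + d + 1 <= r' ->
    kfil r' (rho x *: v).

Lemma kfil_le r r' v : r <= r' -> kfil r v -> kfil r' v.
Proof.
move=> + h; elim: h r' => {r v}
  [r|r u v _ hu _ hv|r c v cC _ hv|r r0|b d x r r1 v hx d0 hv _ r1r] r' rr'.
- exact: KFil0.
- by apply: KFilD; [exact: hu|exact: hv].
- by apply: KFilZ => //; exact: hv.
- by apply: KFilW; exact: le_trans rr'.
- by apply: (KFilX hx d0 hv); exact: le_trans rr'.
Qed.

Lemma kfil_neg r v : kfil r v -> r < 0 -> v = 0.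
Proof.
elim=> {r v} [//|r u v _ hu _ hv r0|r c v _ _ hv r0|r|b d x r r' v _ d0 _ hv ? ?].
- by rewrite hu // hv // addr0.
- by rewrite hv // scaler0.
- by rewrite leNgt => /negbTE ->.
- by rewrite hv ?scaler0 //; lia.
Qed.

Hypothesis w_whit : forall b d x, hom b d x -> d < 0 -> rho x *: w = chi x *: w.

(** An [x] of negative degree is moved to the right until it meets [w]. A bracket weighs one less
    than its two arguments together, so commutators stay within the bound; on [w] the scalar [chi x]
    can be nonzero only in degree -1, where the weight is 0. *)
Lemma kfil_rho b d x r v : hom b d x -> kfil r v -> kfil (r + d + 1) (rho x *: v).
Proof.
move=> hx hv; have [d0|d0] := lerP 0 d; first exact: KFilX hx d0 hv _.
elim: hv b d x hx d0 => {r v}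
  [r|r u v _ hu _ hv|r c v cC _ hv|r r0|c g y r r1 v hy g0 hv IH r1r] b d x hx d0.
- by rewrite scaler0; exact: KFil0.
- by rewrite scalerDr; apply: KFilD; [exact: hu hx d0|exact: hv hx d0].
- by rewrite scalerA -(cC (rho x)) -scalerA; apply: KFilZ => //; exact: hv hx d0.
- rewrite (w_whit hx d0).
  have [bd|] := boolP (b || (d != -1)); first by rewrite (chi_deg hx) // scale0r; exact: KFil0.
  rewrite negb_or negbK => /andP[_ /eqP ->].
  by apply: KFilZ => //; apply: KFilW; lia.
- rewrite scalerA (rho_br hx hy) scalerDl; apply: KFilD.
    rewrite -!scalerA; apply: KFilZ; first exact: central_sign.
    by apply: (KFilX hy g0 (IH _ _ _ hx d0)); lia.
  have hxy := hom_br hx hy; have [dg|dg] := lerP 0 (d + g).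
    by apply: (KFilX hxy dg hv); lia.
  by apply: kfil_le (IH _ _ _ hxy dg); lia.
Qed.

(** Subtracting [chi x] improves the bound of [kfil_rho] by one: nothing is left on [w], and every
    other term replaces some y of weight g + 1 by [x, y] of weight d + g + 1. *)
Lemma kfil_shifted b d x r v : hom b d x -> d < 0 -> kfil r v ->
  kfil (r + d) (shifted x *: v).
Proof.
move=> hx d0; elim=> {r v} [r|r u v _ hu _ hv|r c v cC _ hv|r r0|c g y r r1 v hy g0 hv IH r1r].
- by rewrite scaler0; exact: KFil0.
- by rewrite scalerDr; exact: KFilD.
- by rewrite scalerA -(cC (shifted x)) -scalerA; exact: KFilZ.
- by rewrite scalerBl (w_whit hx d0) subrr; exact: KFil0.
rewrite scalerA (shifted_rho hx hy d0) scalerDl; apply: KFilD.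
  by apply: kfil_le (kfil_rho (hom_br hx hy) hv); lia.
rewrite -!scalerA; apply: KFilZ; first exact: central_sign.
by apply: (KFilX hy g0 IH); lia.
Qed.

Context (I : eqType) (m dual : I -> X) (par : I -> bool) (e h : I -> nat).
Hypothesis m_hom : forall i, hom (par i) (- (h i)%:Z) (m i).
Hypothesis dual_hom : forall i, hom (par i) ((h i)%:Z - 1) (dual i).
Hypothesis h_gt0 : forall i, (0 < h i)%N.
Hypothesis e_odd : forall i, par i -> (e i <= 1)%N.
Local Notation pairing i j := (br (par i) (par j) (m i) (dual j)).

(** The order is reversed so that in [top * dual_top] the two powers belonging to the last index are
    adjacent, and the product collapses from the inside. *)
Definition dual_top (s : seq I) : R := \prod_(i <- rev s) rho (dual i) ^+ e i.
Definition weight (s : seq I) : nat := (\sum_(i <- s) e i * h i)%N.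

Lemma dual_top_rcons s t : dual_top (rcons s t) = rho (dual t) ^+ e t * dual_top s.
Proof. by rewrite /dual_top rev_rcons big_cons. Qed.

Lemma weight_rcons s t : weight (rcons s t) = (weight s + e t * h t)%N.
Proof. by rewrite /weight -cats1 big_cat big_seq1. Qed.

Lemma kfil_dual_pow i a r v : kfil r v ->
  kfil (r + (a * h i)%N%:Z) (rho (dual i) ^+ a *: v).
Proof.
move=> hv; elim: a => [|a ih]; first by rewrite expr0 scale1r addr0.
by rewrite exprS -scalerA; apply: kfil_le (kfil_rho (dual_hom i) ih); lia.
Qed.

Lemma kfil_dual_top s : kfil (weight s)%:Z (dual_top s *: w).
Proof.
elim/last_ind: s => [|s t ih].
  by rewrite /dual_top big_nil scale1r; exact: KFilW.
rewrite dual_top_rcons weight_rcons -scalerA.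
by apply: kfil_le (kfil_dual_pow t (e t) ih); lia.
Qed.

(** The factors of [top] lower the filtration by [weight s] in total, hence below zero. *)
Lemma kfil_shifted_top s r v : (r < (weight s)%:Z)%R ->
  kfil r v -> top (shifted \o m) e s *: v = 0.
Proof.
elim/last_ind: s r v => [|s i ih] r v hr hv.
  by rewrite /top big_nil scale1r; apply: kfil_neg hv _; move: hr; rewrite /weight big_nil.
rewrite /top -cats1 big_cat big_seq1 /= -/(top _ _ s) -scalerA.
apply: (ih (r - (e i * h i)%N%:Z)); first by rewrite weight_rcons in hr; lia.
elim: {ih hr} (e i) => [|a ih]; first by rewrite expr0 scale1r mul0n subr0.
rewrite exprS -scalerA; apply: kfil_le (kfil_shifted (m_hom i) _ ih); have := h_gt0 i; lia.
Qed.

(** The inequality of depths puts the bracket in negative degree. Since [chi] vanishes on it, it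
    equals its shifted form and gains one step over the general bound. *)
Lemma shifted_dual_step t i r v : (h i <= h t)%N -> chi (pairing t i) = 0 ->
  kfil r v -> kfil (r - (h t)%:Z - 1) (shifted (m t) *: v) ->
  kfil (r + (h i)%:Z - (h t)%:Z - 1) (shifted (m t) *: (rho (dual i) *: v)).
Proof.
move=> hit c0 hv htv; have ht := h_gt0 t.
rewrite scalerA (shifted_rho (m_hom t) (dual_hom i)); last by lia.
rewrite scalerDl; apply: KFilD.
  have -> : rho (pairing t i) = shifted (pairing t i) by rewrite /shifted c0 subr0.
  by apply: kfil_le (kfil_shifted (hom_br (m_hom t) (dual_hom i)) _ hv); lia.
rewrite -!scalerA; apply: KFilZ; first exact: central_sign.
by apply: kfil_le (kfil_rho (dual_hom i) htv); lia.
Qed.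

Lemma shifted_dual_top t s :
  (forall i, i \in s -> (h i <= h t)%N /\ chi (pairing t i) = 0) ->
  kfil ((weight s)%:Z - (h t)%:Z - 1) (shifted (m t) *: (dual_top s *: w)).
Proof.
have ht := h_gt0 t; elim/last_ind: s => [|s i ih] H.
  rewrite /dual_top big_nil scale1r scalerBl (w_whit (m_hom t)); last by lia.
  by rewrite subrr; exact: KFil0.
have [|hi ci] := H i; first by rewrite mem_rcons inE eqxx.
rewrite dual_top_rcons weight_rcons -scalerA.
elim: (e i) => [|a IHa].
  rewrite expr0 scale1r mul0n addn0; apply: ih => j sj; apply: H.
  by rewrite mem_rcons inE sj orbT.
rewrite exprS -scalerA.
have := shifted_dual_step hi ci (kfil_dual_pow i a (kfil_dual_top s)) .
by rewrite PoszD in IHa => /(_ IHa); apply: kfil_le; lia.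
Qed.

(** Modulo lower terms [shifted (m t)] acts on powers of [dual t] as [chi (pairing t t)] times a
    derivative. For odd [t] only [a = 0] is allowed, so wherever several equal terms are added the
    sign is 1. *)
Lemma shifted_dual_pow t r v a : (a < e t)%N ->
  kfil r v -> kfil (r - (h t)%:Z - 1) (shifted (m t) *: v) ->
  kfil (r + (a * h t)%N%:Z - 1)
    (shifted (m t) *: (rho (dual t) ^+ a.+1 *: v)
       - (a.+1%:R * chi (pairing t t)) *: (rho (dual t) ^+ a *: v)).
Proof.
move=> ha hv htv; have ht := h_gt0 t.
have E u : shifted (m t) *: (rho (dual t) *: u) = chi (pairing t t) *: u
    + shifted (pairing t t) *: u
    + (-1) ^+ par t *: (rho (dual t) *: (shifted (m t) *: u)).
  rewrite scalerA (shifted_rho (m_hom t) (dual_hom t)); last by lia.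
  by rewrite scalerDl -!scalerA andbb /shifted -scalerDl addrCA subrr addr0.
have Hs a' : kfil (r + (a' * h t)%N%:Z - 1) (shifted (pairing t t) *: (rho (dual t) ^+ a' *: v)).
  by apply: kfil_le (kfil_shifted (hom_br (m_hom t) (dual_hom t)) _ (kfil_dual_pow t a' hv)); lia.
elim: a ha => [|a ih] ha.
  rewrite expr1 expr0 scale1r mul1r E [X in kfil _ X]addrC.
  rewrite -[X in kfil _ (_ + X)]addrA addKr; apply: KFilD.
    by have := Hs 0%N; rewrite expr0 scale1r.
  apply: KFilZ; first exact: central_sign.
  by apply: kfil_le (kfil_rho (dual_hom t) htv); lia.
have pt : (-1) ^+ par t = 1 :> R by have -> : par t = false by apply/negP => /e_odd; lia.
have IH := kfil_rho (dual_hom t) (ih (ltnW ha)).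
have cN n : central (n%:R * chi (pairing t t)).
  by move=> x; apply/commr_sym/commrM; [exact: commr_nat|exact/commr_sym/chiC].
have E2 u : (a.+2%:R * chi (pairing t t)) *: u
    = chi (pairing t t) *: u + (a.+1%:R * chi (pairing t t)) *: u.
  by rewrite -[a.+2]addn1 natrD mulrDl mul1r scalerDl addrC.
rewrite [rho _ ^+ a.+2]exprS -scalerA E pt scale1r E2 opprD addrACA.
rewrite [X in kfil _ (X + _)]addrAC subrr add0r; apply: KFilD; first exact: Hs.
rewrite [X in kfil _ (_ - _ *: (X *: _))]exprS -(scalerA (rho _)).
rewrite (scalerA _ (rho _)) cN -scalerA -scalerBr.
by apply: kfil_le IH; lia.
Qed.

Lemma shifted_dual_exp t r v a : (a <= e t)%N ->
  kfil r v -> kfil (r - (h t)%:Z - 1) (shifted (m t) *: v) ->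
  kfil (r - 1) (shifted (m t) ^+ a *: (rho (dual t) ^+ a *: v)
    - (a`!%:R * chi (pairing t t) ^+ a) *: v).
Proof.
move=> ha hv htv; have ht := h_gt0 t; elim: a ha => [|a ih] ha.
  by rewrite !expr0 !scale1r mul1r scale1r subrr; exact: KFil0.
have cN : central (a.+1%:R * chi (pairing t t)).
  by move=> x; apply/commr_sym/commrM; [exact: commr_nat|exact/commr_sym/chiC].
have down b g u : kfil g u -> kfil (g - (b * h t)%N%:Z) (shifted (m t) ^+ b *: u).
  move=> hu; elim: b => [|b IH]; first by rewrite expr0 scale1r subr0.
  by rewrite exprS -scalerA; apply: kfil_le (kfil_shifted (m_hom t) _ IH); lia.
rewrite [shifted _ ^+ _]exprSr -scalerA.
have H1 := down a _ _ (shifted_dual_pow ha hv htv).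
have H2 := KFilZ cN (ih (ltnW ha)).
rewrite scalerBr [X in kfil _ (_ - X)]scalerA -cN -scalerA in H1.
rewrite scalerBr [X in kfil _ (_ - X)]scalerA in H2.
have -> : (a.+1)`!%:R * chi (pairing t t) ^+ a.+1
    = a.+1%:R * chi (pairing t t) * (a`!%:R * chi (pairing t t) ^+ a).
  by rewrite factS natrM exprS -!mulrA (mulrA (chi _)) (chiC _ a`!%:R) !mulrA.
have := KFilD (kfil_le _ H1) H2; rewrite addrA subrK; apply; lia.
Qed.

(** The innermost pair of powers gives its scalar up to an error one step lower in the filtration;
    what remains of [top] still lowers by [weight s] and kills that error. The identity is therefore
    exact. *)
Lemma top_dual_top s :
  pairwise (fun i j => (h i <= h j)%N && (chi (pairing j i) == 0)) s ->
  top (shifted \o m) e s *: (dual_top s *: w)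
  = (\prod_(i <- rev s) ((e i)`!%:R * chi (pairing i i) ^+ e i)) *: w.
Proof.
elim/last_ind: s => [|s t ih]; first by rewrite /top /dual_top /rev /= !big_nil scale1r.
rewrite -cats1 pairwise_cat allrel1r => /and3P[/allP st ps _].
have {}st i : i \in s -> (h i <= h t)%N /\ chi (pairing t i) = 0.
  by move/st/andP => [-> /eqP].
rewrite cats1 dual_top_rcons rev_rcons big_cons -[X in _ = X]scalerA -ih //.
rewrite /top -cats1 big_cat big_seq1 /= -/(top _ _ s) -[LHS]scalerA -(scalerA (rho _ ^+ _)).
have cK : central ((e t)`!%:R * chi (pairing t t) ^+ e t).
  move=> x; apply/commr_sym/commrM; first exact: commr_nat.
  exact/commrX/commr_sym/chiC.
have := shifted_dual_exp (leqnn _) (kfil_dual_top s) (shifted_dual_top st).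
move/(kfil_shifted_top _) => /(_ s); rewrite scalerBr => H.
apply/eqP; rewrite [X in _ == X]scalerA cK -scalerA -subr_eq0; apply/eqP/H; lia.
Qed.

End KazhdanFiltration.

(** * Grading of gl(n|n) and root vectors *)

Section Grading.
Context (k : fieldType) (n : nat).
Implicit Types (x y z : 'M[k]_(n + n)) (i j : 'I_n).

(* The large shift of the odd blocks makes every entry of the [C] block deeper
   than all entries of the [A] block. *)
Definition height (s : 'I_(n + n)) : int :=
  match fintype.split s with inl i => (i : nat)%:Z | inr i => (4 * n)%N%:Z - (i : nat)%:Z end.

Definition hdeg (d : int) x := forall s t, x s t != 0 -> height t - height s = d.

Definition hom (b : bool) (d : int) x := [/\ x \in @ptilde k n, homog b x & hdeg d x].

Lemma heightl i : height (lshift n i) = (i : nat)%:Z.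
Proof. by rewrite /height (unsplitK (inl i)). Qed.

Lemma heightr i : height (rshift n i) = (4 * n)%N%:Z - (i : nat)%:Z.
Proof. by rewrite /height (unsplitK (inr i)). Qed.

Lemma hdegM d e x y : hdeg d x -> hdeg e y -> hdeg (d + e) (x *m y).
Proof.
move=> hx hy s t; rewrite mxE.
have [u|nz] := pickP (fun u => x s u * y u t != 0).
  by rewrite mulf_eq0 negb_or => /andP[/hx <- /hy <-]; lia.
by rewrite big1 ?eqxx // => u _; apply/eqP/negPn; rewrite nz.
Qed.

Lemma hdegBZ d a x y : hdeg d x -> hdeg d y -> hdeg d (x - a *: y).
Proof.
move=> hx hy s t; rewrite !mxE.
have [->|/hx //] := eqVneq (x s t) 0; have [->|/hy //] := eqVneq (y s t) 0.
by rewrite mulr0 subr0 eqxx.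
Qed.

Lemma homogBZ b a x y : homog b x -> homog b y -> homog b (x - a *: y).
Proof.
by case: b => -[h1 h2] [h3 h4]; split;
  rewrite ?(ulsubmxBZ, ursubmxBZ, dlsubmxBZ, drsubmxBZ) ?(h1, h2, h3, h4) scaler0 subr0.
Qed.

Lemma homogM b c x y : homog b x -> homog c y -> homog (b (+) c) (x *m y).
Proof.
by case: b; case: c => -[h1 h2] [h3 h4]; split;
  rewrite ?(ulsubmxM, ursubmxM, dlsubmxM, drsubmxM) ?(h1, h2, h3, h4)
    ?(mul0mx, mulmx0) addr0.
Qed.

Lemma hom_sbracket b d x c e y : hom b d x -> hom c e y ->
  hom (b (+) c) (d + e) (sbracket b c x y).
Proof.
move=> [px hx dx] [py hy dy]; split; first exact: sbracket_ptilde.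
  by apply: homogBZ; [exact: homogM|rewrite addbC; exact: homogM].
by apply: hdegBZ; [exact: hdegM|rewrite addrC; exact: hdegM].
Qed.

Definition ptE i j : 'M[k]_(n + n) := gl_emb (delta_mx i j).
Definition ptB i j : 'M[k]_(n + n) := block_mx 0 (delta_mx i j + delta_mx j i) 0 0.
Definition ptC i j : 'M[k]_(n + n) := block_mx 0 0 (delta_mx i j - delta_mx j i) 0.

Lemma hdeg_block d (A B C D : 'M[k]_n) :
  (forall i j, A i j != 0 -> (j : nat)%:Z - (i : nat)%:Z = d) ->
  (forall i j, B i j != 0 -> (4 * n)%N%:Z - (j : nat)%:Z - (i : nat)%:Z = d) ->
  (forall i j, C i j != 0 -> (j : nat)%:Z + (i : nat)%:Z - (4 * n)%N%:Z = d) ->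
  (forall i j, D i j != 0 -> (i : nat)%:Z - (j : nat)%:Z = d) ->
  hdeg d (block_mx A B C D).
Proof.
move=> hA hB hC hD s t; case: (split_ordP s) => i ->; case: (split_ordP t) => j ->.
- by rewrite block_mxEul !heightl; exact: hA.
- by rewrite block_mxEur heightl heightr => /hB <-; lia.
- by rewrite block_mxEdl heightl heightr => /hC <-; lia.
- by rewrite block_mxEdr !heightr => /hD <-; lia.
Qed.

Lemma mx0E i j : (0 : 'M[k]_n) i j = 0.
Proof. by rewrite mxE. Qed.

Lemma delta_neq0 i j i' j' : (delta_mx i j : 'M[k]_n) i' j' != 0 -> i' = i /\ j' = j.
Proof. by rewrite mxE; case: andP => [[/eqP -> /eqP ->]//|_]; rewrite eqxx. Qed.

Lemma hom_ptE i j : hom false ((j : nat)%:Z - (i : nat)%:Z) (ptE i j).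
Proof.
split; first exact: gl_emb_ptilde.
  by rewrite /ptE /gl_emb /= block_mxKur block_mxKdl.
apply: hdeg_block => i' j'; rewrite ?mx0E ?eqxx //.
  by move/delta_neq0 => [-> ->].
by rewrite trmx_delta mxE oppr_eq0 => /delta_neq0 [-> ->].
Qed.

Lemma hom_ptB i j : hom true ((4 * n)%N%:Z - (j : nat)%:Z - (i : nat)%:Z) (ptB i j).
Proof.
split.
- apply/and3P; rewrite /ptB block_mxKul block_mxKur block_mxKdl block_mxKdr.
  by rewrite !trmx0 oppr0 !eqxx (raddfD trmx) /= !trmx_delta addrC.
- by rewrite /ptB /= block_mxKul block_mxKdr.
apply: hdeg_block => i' j'; rewrite ?mx0E ?eqxx // => nz.
have [/delta_neq0 [-> ->] //|e0] := boolP ((delta_mx i j : 'M[k]_n) i' j' != 0).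
by move: nz; rewrite mxE (eqP (negPn e0)) add0r => /delta_neq0 [-> ->]; lia.
Qed.

Lemma hom_ptC i j : hom true ((j : nat)%:Z + (i : nat)%:Z - (4 * n)%N%:Z) (ptC i j).
Proof.
split.
- apply/and3P; rewrite /ptC block_mxKul block_mxKur block_mxKdl block_mxKdr.
  by rewrite !trmx0 oppr0 !eqxx (raddfB trmx) /= !trmx_delta opprB.
- by rewrite /ptC /= block_mxKul block_mxKdr.
apply: hdeg_block => i' j'; rewrite ?mx0E ?eqxx // => nz.
have [/delta_neq0 [-> ->] //|e0] := boolP ((delta_mx i j : 'M[k]_n) i' j' != 0).
move: nz; rewrite mxE [X in _ + X]mxE (eqP (negPn e0)) add0r oppr_eq0.
by move=> /delta_neq0 [-> ->]; lia.
Qed.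

Lemma ptE_ptilde i j : ptE i j \in @ptilde k n. Proof. by have [] := hom_ptE i j. Qed.
Lemma ptB_ptilde i j : ptB i j \in @ptilde k n. Proof. by have [] := hom_ptB i j. Qed.
Lemma ptC_ptilde i j : ptC i j \in @ptilde k n. Proof. by have [] := hom_ptC i j. Qed.

Lemma ptilde0 : 0 \in @ptilde k n.
Proof. by apply/and3P; split; apply/eqP/matrixP => i j; rewrite !mxE ?oppr0. Qed.

Lemma ptildeD a x y : x \in @ptilde k n -> y \in @ptilde k n -> a *: x + y \in @ptilde k n.
Proof.
move=> /and3P[/eqP dx /eqP ux /eqP lx] /and3P[/eqP dy /eqP uy /eqP ly].
apply/and3P; split; apply/eqP/matrixP => i j.
- move/matrixP/(_ i j): dx; move/matrixP/(_ i j): dy; rewrite !mxE => -> ->.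
  by rewrite opprD mulrN.
- by move/matrixP/(_ i j): ux; move/matrixP/(_ i j): uy; rewrite !mxE => -> ->.
- move/matrixP/(_ i j): lx; move/matrixP/(_ i j): ly; rewrite !mxE => -> ->.
  by rewrite opprD mulrN.
Qed.

Lemma ptildeP x : x \in @ptilde k n ->
  x = block_mx (ulsubmx x) (ursubmx x) (dlsubmx x) (- (ulsubmx x)^T).
Proof. by case/and3P => /eqP <- _ _; rewrite submxK. Qed.

Lemma hom0 b d : hom b d 0.
Proof.
split; first exact: ptilde0.
  by case: b; split; apply/matrixP => i j; rewrite !mxE.
by move=> s t; rewrite mxE eqxx.
Qed.

Definition embB (B : 'M[k]_n) : 'M[k]_(n + n) := block_mx 0 B 0 0.
Definition embC (C : 'M[k]_n) : 'M[k]_(n + n) := block_mx 0 0 C 0.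

Lemma gl_emb_is_linear : linear (@gl_emb k n).
Proof.
move=> a A B; rewrite /gl_emb scale_block_mx add_block_mx !scaler0 !addr0.
by rewrite linearP opprD scalerN.
Qed.
HB.instance Definition _ := GRing.isLinear.Build k _ _ _ (@gl_emb k n) gl_emb_is_linear.

Lemma embB_is_linear : linear embB.
Proof. by move=> a A B; rewrite /embB scale_block_mx add_block_mx !scaler0 !addr0. Qed.
HB.instance Definition _ := GRing.isLinear.Build k _ _ _ embB embB_is_linear.

Lemma embC_is_linear : linear embC.
Proof. by move=> a A B; rewrite /embC scale_block_mx add_block_mx !scaler0 !addr0. Qed.
HB.instance Definition _ := GRing.isLinear.Build k _ _ _ embC embC_is_linear.

Lemma gl_emb_expand A : gl_emb A = \sum_i \sum_j A i j *: ptE i j.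
Proof.
rewrite {1}[A]matrix_sum_delta linear_sum; apply: eq_bigr => i _ /=.
by rewrite linear_sum; apply: eq_bigr => j _ /=; rewrite linearZ.
Qed.

Hypothesis two_neq0 : 2%:R != 0 :> k.

(** The sum runs over ordered pairs, so an off-diagonal unit occurs twice, and [ptB i i] is twice a
    diagonal unit; both account for the half. *)
Lemma embB_expand B : B = B^T -> embB B = \sum_i \sum_j (B i j / 2%:R) *: ptB i j.
Proof.
move=> sB; have EB : B = \sum_i \sum_j (B i j / 2%:R) *: (delta_mx i j + delta_mx j i).
  have e2 : B = 2%:R^-1 *: B + 2%:R^-1 *: B^T.
    by rewrite -sB -scalerDr -mulr2n -scaler_nat scalerA mulVf // scale1r.
  rewrite [LHS]e2 {1}[B]matrix_sum_delta [B^T]matrix_sum_delta [X in _ + _ *: X]exchange_big.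
  rewrite !scaler_sumr -big_split; apply: eq_bigr => i _ /=.
  rewrite !scaler_sumr -big_split; apply: eq_bigr => j _ /=.
  by rewrite !scalerA mxE scalerDr mulrC.
rewrite {1}EB linear_sum; apply: eq_bigr => i _ /=.
by rewrite linear_sum; apply: eq_bigr => j _ /=; rewrite linearZ.
Qed.

Lemma embC_expand C : C = - C^T ->
  embC C = \sum_(i : 'I_n) \sum_(j : 'I_n | (i < j)%N) C i j *: ptC i j.
Proof.
move=> sC; have skew i j : C j i = - C i j.
  by move/matrixP/(_ i j): sC; rewrite !mxE => ->; rewrite opprK.
have diag i : C i i = 0.
  have := skew i i => /eqP; rewrite -addr_eq0 -mulr2n -mulr_natr mulf_eq0 (negbTE two_neq0) orbF.
  by move/eqP.
have EC : C = \sum_(i : 'I_n) \sum_(j : 'I_n | (i < j)%N) C i j *: (delta_mx i j - delta_mx j i).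
  have E0 : C = \sum_(i : 'I_n) \sum_(j : 'I_n | (i < j)%N) C i j *: delta_mx i j
              + \sum_(j : 'I_n) \sum_(i : 'I_n | (j < i)%N) C i j *: delta_mx i j.
    rewrite [X in _ + X](exchange_big_dep xpredT) //= -big_split /= {1}[C]matrix_sum_delta.
    apply: eq_bigr => i _; rewrite (bigID (fun j : 'I_n => (i < j)%N)) /=; congr (_ + _).
    rewrite (bigD1 i) ?ltnn //= diag scale0r add0r; apply: eq_bigl => j.
    by rewrite -leqNgt ltn_neqAle andbC.
  rewrite [LHS]E0 -big_split; apply: eq_bigr => i _ /=.
  rewrite -big_split; apply: eq_bigr => j _ /=.
  by rewrite (skew i j) scaleNr scalerBr.
rewrite {1}EC linear_sum; apply: eq_bigr => i _ /=.
by rewrite linear_sum; apply: eq_bigr => j _ /=; rewrite linearZ.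
Qed.

End Grading.

(** * Dual bases for the form chi([x, y]) *)

Section RegularNilpotentData.
Context (k : fieldType) (p n : nat) (chi : {scalar 'M[k]_n}).
Hypothesis chi_reg : regular_nilpotent chi.

Lemma chi_delta (i j : 'I_n) : chi (delta_mx i j) = (i == j.+1 :> nat)%:R.
Proof.
have [h1 h2 h3] := chi_reg; have [ij|ij] := eqVneq (i : nat) j.+1; first exact: h2.
have [ij'|ij'] := eqVneq i j; first by rewrite ij'; exact: h1.
exact: h3.
Qed.

Lemma chi_entries A : chi A = \sum_i \sum_j A i j * (i == j.+1 :> nat)%:R.
Proof.
rewrite {1}[A]matrix_sum_delta linear_sum; apply: eq_bigr => i _ /=.
by rewrite linear_sum; apply: eq_bigr => j _ /=; rewrite linearZ /= chi_delta.
Qed.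

(** [chi] extended linearly to all of gl(n|n), vanishing on odd matrices, so that it can be applied
    to brackets without membership proofs. *)
Definition chi_ul (x : 'M[k]_(n + n)) : k := chi (ulsubmx x).

Lemma chi_ul_is_scalar : scalar chi_ul.
Proof.
move=> a x y; rewrite /chi_ul -linearP; congr (chi _).
by apply/matrixP => i j; rewrite !mxE.
Qed.
HB.instance Definition _ := GRing.isLinear.Build k _ k _ chi_ul chi_ul_is_scalar.

Lemma chi_ul_deg b d x : hom b d x -> d < 0 -> b || (d != -1) -> chi_ul x = 0.
Proof.
move=> [_ hx dx] d0 bd; rewrite /chi_ul.
case: b hx bd => [[-> _] _|_ /= d1]; first by rewrite linear0.
rewrite chi_entries big1 // => i _; rewrite big1 // => j _.
case: eqP => [ij|_]; last by rewrite mulr0.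
have [->|nz] := eqVneq (ulsubmx x i j) 0; first by rewrite mul0r.
move: nz; rewrite 2!mxE => /dx; rewrite !heightl => E; move: d1; rewrite -E ij.
by move/eqP; lia.
Qed.

Definition idx : Type := (bool * ('I_n * 'I_n))%type.
Implicit Types q : idx.

(* Positions outside the strict triangles index the zero vector. *)
Definition inner q := if q.1 then (q.2.1 < q.2.2)%N else (q.2.2 < q.2.1)%N.
Definition mvec q : 'M[k]_(n + n) :=
  if inner q then if q.1 then ptC k q.2.1 q.2.2 else ptE k q.2.1 q.2.2 else 0.
(* The bracket of [mvec q] and [dvec q] has a component at the root vector of a
   negative simple root. *)
Definition dvec q : 'M[k]_(n + n) :=
  if inner q then
    if q.1 then ptB k (insubd q.2.1 q.2.1.+1) q.2.2
    else ptE k q.2.2 (insubd q.2.1 q.2.1.-1)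
  else 0.
Definition depth q : nat :=
  if q.1 then (4 * n - q.2.1 - q.2.2)%N
  else if (q.2.2 < q.2.1)%N then (q.2.1 - q.2.2)%N else 1%N.
Definition exponent q : nat := if inner q then if q.1 then 1 else p.-1 else 0.

Lemma mvec_hom q : hom q.1 (- (depth q)%:Z) (mvec q).
Proof.
case: q => b [i j]; rewrite /mvec /depth /inner /=; case: b => /=; case: ltnP => ij;
  try exact: hom0.
  have := hom_ptC k i j; congr hom; have := ltn_ord i; have := ltn_ord j; lia.
by have := hom_ptE k i j; congr hom; lia.
Qed.

Lemma dvec_hom q : hom q.1 ((depth q)%:Z - 1) (dvec q).
Proof.
case: q => b [i j]; rewrite /dvec /depth /inner /=; case: b => /=; case: ltnP => ij;
  try exact: hom0.
  have := hom_ptB k (insubd i i.+1) j; congr hom; have := ltn_ord i; have := ltn_ord j.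
  by rewrite val_insubd => jn _; have -> : (i.+1 < n)%N; lia.
have := hom_ptE k j (insubd i i.-1); congr hom; have := ltn_ord i; have := ltn_ord j.
by rewrite val_insubd => _ ltin; have -> : (i.-1 < n)%N; lia.
Qed.

Lemma depth_gt0 q : (0 < depth q)%N.
Proof.
case: q => b [i j]; rewrite /depth /=; have := ltn_ord i; have := ltn_ord j.
by case: b; [|case: (ltnP j i)]; lia.
Qed.

Lemma exponent_odd q : q.1 -> (exponent q <= 1)%N.
Proof. by rewrite /exponent => ->; case: ifP. Qed.

Lemma chi_deltaM (i j i' j' : 'I_n) :
  chi (delta_mx i j *m delta_mx i' j') = ((j == i') && (i == j'.+1 :> nat))%:R.
Proof.
rewrite mul_delta_mx_cond; case: eqP => _; last by rewrite mulr0n linear0.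
by rewrite mulr1n chi_delta.
Qed.

Definition pairing q r : k := chi_ul (sbracket q.1 r.1 (mvec q) (dvec r)).

Lemma sbracket0l b c (x : 'M[k]_(n + n)) : sbracket b c 0 x = 0.
Proof. by rewrite /sbracket mul0mx mulmx0 scaler0 subr0. Qed.

Lemma sbracket0r b c (x : 'M[k]_(n + n)) : sbracket b c x 0 = 0.
Proof. by rewrite /sbracket mul0mx mulmx0 scaler0 subr0. Qed.

Lemma pairing_outer q r : ~~ inner q || ~~ inner r -> pairing q r = 0.
Proof.
by case/orP => /negbTE nq; rewrite /pairing /mvec /dvec nq ?sbracket0l ?sbracket0r raddf0.
Qed.

Lemma pairing_parity q r : q.1 != r.1 -> pairing q r = 0.
Proof.
move=> qr; have [_ + _] := hom_sbracket (mvec_hom q) (dvec_hom r).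
rewrite /pairing /chi_ul; have -> : q.1 (+) r.1 by case: q.1 r.1 qr => [] [].
by case=> -> _; rewrite linear0.
Qed.

(** The bracket of E_{i,j} and E_{j',i'-1} contributes E_{i,i'-1} when j = j' and -E_{j',j} when i'
    = i + 1. The first term pairs an index with its own dual; the second is the off-diagonal
    part. *)
Lemma pairing_even (i j i' j' : 'I_n) : (j < i)%N -> (j' < i')%N ->
  pairing (false, (i, j)) (false, (i', j'))
  = ((j == j' :> nat) && (i == i' :> nat))%:R
    - ((i' == i.+1 :> nat) && (j' == j.+1 :> nat))%:R.
Proof.
move=> ij ij'; rewrite /pairing /mvec /dvec /inner /= ij ij' /chi_ul /sbracket.
rewrite ulsubmxBZ /ptE /gl_emb !ulsubmxM !block_mxKul !block_mxKur !block_mxKdl !mul0mx !addr0.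
rewrite expr0 scale1r linearB /= !chi_deltaM -!val_eqE /= val_insubd.
have -> : (i'.-1 < n)%N by have := ltn_ord i'; lia.
by congr (_%:R - _%:R); lia.
Qed.

(** The multiplicity two at [j = i.+1] arises because the dual vector [ptB j j] is then twice a
    diagonal unit; nondegeneracy at this place relies on 2 being invertible. *)
Lemma pairing_odd (i j i' j' : 'I_n) : (i < j)%N -> (i' < j')%N ->
  pairing (true, (i, j)) (true, (i', j'))
  = ((i == i'.+1 :> nat) && (j' == j.+1 :> nat))%:R
    - ((i == i' :> nat) && (j == j' :> nat))%:R *+ (j == i.+1 :> nat).+1.
Proof.
move=> ij ij'; rewrite /pairing /mvec /dvec /inner /= ij ij' /chi_ul /sbracket.
rewrite ulsubmxBZ /ptC /ptB !ulsubmxM !block_mxKul !block_mxKur !block_mxKdl !mul0mx !add0r.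
rewrite expr1 scaleN1r opprK mulmxDl !mulmxBr !(linearB, linearD) /= !chi_deltaM.
rewrite -!val_eqE /= val_insubd.
have -> : (i'.+1 < n)%N by have := ltn_ord j'; lia.
have -> : ((j' == i :> nat) && (i'.+1 == j.+1)) = false by lia.
have -> : ((j' == j :> nat) && (i'.+1 == i.+1)) = ((i == i' :> nat) && (j == j' :> nat)) by lia.
have -> : ((i'.+1 == j :> nat) && (j' == i.+1 :> nat))
    = ((i == i' :> nat) && (j == j' :> nat)) && (j == i.+1 :> nat) by lia.
have -> : ((i'.+1 == i :> nat) && (j' == j.+1 :> nat))
    = ((i == i'.+1 :> nat) && (j' == j.+1 :> nat)) by lia.
rewrite sub0r addrCA mulrSr opprD; congr (_ + _).
by case: (_ && _); case: (j == _ :> nat);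
  rewrite ?addr0 ?add0r // ?oppr0 ?addr0 ?mul0rn ?mulr1n ?mulr0n ?oppr0 ?add0r // addrC.
Qed.

(* Ties in depth are broken so as to make the pairing matrix triangular. *)
Definition key q : nat :=
  (depth q * (2 * n).+1 + if q.1 then n - q.2.1 else q.2.1)%N.

Lemma key_depth q r : (key q <= key r)%N -> (depth q <= depth r)%N.
Proof.
rewrite /key leqNgt; apply: contraLR; rewrite -!ltnNge => ltd.
have h (s : idx) : ((if s.1 then n - s.2.1 else s.2.1) < (2 * n).+1)%N.
  by case: s.1; have := ltn_ord s.2.1; lia.
have := h r; have := h q; move: (if _ then _ else _) => a; move: (if _ then _ else _) => b.
by nia.
Qed.

Definition idx_seq : seq idx := sort (fun q r => key q <= key r)%N (enum {: idx}).

Lemma mem_idx_seq q : q \in idx_seq.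
Proof. by rewrite mem_sort mem_enum. Qed.

Lemma idx_seq_sorted : pairwise (fun q r => key q <= key r)%N idx_seq.
Proof.
rewrite -sorted_pairwise; first by apply: sort_sorted => q r; exact: leq_total.
by move=> q r s; exact: leq_trans.
Qed.

Lemma idx_seq_depth : depth_sorted depth idx_seq.
Proof. by apply: sub_pairwise idx_seq_sorted => q r; exact: key_depth. Qed.

(** Off the diagonal, [mvec] at (i, j) pairs nontrivially only with [dvec] at (i+1, j+1) in the even
    case and at (i-1, j+1) in the odd case. Depths agree there, and the tie-break, i or n - i, is
    larger at the second position. *)
Lemma pairing_key q r : (key q <= key r)%N -> q != r -> pairing r q = 0.
Proof.
have [|out _ _] := boolP (inner r && inner q); last first.
  by apply: pairing_outer; rewrite -negb_and.
have [rq|rq _ _ _] := eqVneq r.1 q.1; last exact: pairing_parity.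
case: r q rq => b [i j] [c [i' j']] /= <-; rewrite /inner /key /depth /=.
have [[[hi hj] hi'] hj'] := (ltn_ord i, ltn_ord j, ltn_ord i', ltn_ord j').
case: b => /andP[ij ij'] le ne; rewrite ?(pairing_odd ij ij') ?(pairing_even ij ij').
  have -> : (i == i' :> nat) && (j == j' :> nat) = false.
    by apply: contraNF ne => /andP[/eqP/val_inj -> /eqP/val_inj ->].
  rewrite mul0rn subr0; case: andP => // -[/eqP e1 /eqP e2]; move: le; rewrite e1 e2; nia.
rewrite ij ij' in le.
have -> : (j == j' :> nat) && (i == i' :> nat) = false.
  by apply: contraNF ne => /andP[/eqP/val_inj -> /eqP/val_inj ->].
rewrite sub0r; case: andP => [[/eqP e1 /eqP e2]|_]; last by rewrite oppr0.
move: le; rewrite e1 e2; nia.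
Qed.

Definition mcoef (z : 'M[k]_(n + n)) q : k :=
  if inner q then if q.1 then dlsubmx z q.2.1 q.2.2 else ulsubmx z q.2.1 q.2.2 else 0.

Lemma mcoef_depth b d z q : hom b d z -> mcoef z q != 0 -> d = - (depth q)%:Z.
Proof.
move=> [_ _ dz]; case: q => c [i j]; rewrite /mcoef /depth /inner /=.
have [hi hj] := (ltn_ord i, ltn_ord j).
case: c => /=; case: ltnP => ij; rewrite ?eqxx // 2!mxE => /dz <-;
  rewrite ?heightl ?heightr; lia.
Qed.

Hypothesis two_neq0 : 2%:R != 0 :> k.

Lemma pairing_self q : inner q -> pairing q q != 0.
Proof.
case: q => -[] [i j] ij; rewrite ?(pairing_odd ij ij) ?(pairing_even ij ij) !eqxx.
  rewrite [(i == _.+1 :> nat)]ltn_eqF // sub0r oppr_eq0.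
  by case: (j == _ :> nat); rewrite ?mulr1n ?oner_eq0.
by rewrite [(i == _.+1 :> nat)]ltn_eqF // subr0 oner_eq0.
Qed.

Lemma mvec_expand b d z : hom b d z -> d < 0 -> z = \sum_q mcoef z q *: mvec q.
Proof.
move=> [pz hz dz] d0.
have negA i j : ulsubmx z i j != 0 -> (j < i)%N.
  by rewrite 2!mxE => /dz; rewrite !heightl; lia.
have B0 : ursubmx z = 0.
  apply/matrixP => i j; rewrite [RHS]mxE; apply/eqP; apply: contraTT d0.
  rewrite 2!mxE => /dz; rewrite heightl heightr.
  by have [hi hj] := (ltn_ord i, ltn_ord j); lia.
have -> : \sum_q mcoef z q *: mvec q =
    \sum_(i : 'I_n) \sum_(j : 'I_n | (i < j)%N) dlsubmx z i j *: ptC k i j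
    + \sum_i \sum_j ulsubmx z i j *: ptE k i j.
  rewrite -(pair_big xpredT xpredT (fun b ij => mcoef z (b, ij) *: mvec (b, ij))) /=.
  rewrite big_bool /=; congr (_ + _).
    rewrite -(pair_big xpredT xpredT (fun i j => mcoef z (true, (i, j)) *: mvec (true, (i, j)))) /=.
    apply: eq_bigr => i _; rewrite [RHS]big_mkcond; apply: eq_bigr => j _.
    by rewrite /mcoef /mvec /inner /=; case: ifP => // _; rewrite scale0r.
  rewrite -(pair_big xpredT xpredT (fun i j => mcoef z (false, (i, j)) *: mvec (false, (i, j)))) /=.
  apply: eq_bigr => i _; apply: eq_bigr => j _; rewrite /mcoef /mvec /inner /=.
  case: ifP => // ij; have [->|/negA] := eqVneq (ulsubmx z i j) 0; first by rewrite !scale0r.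
  by rewrite ij.
rewrite -embC_expand // -?gl_emb_expand; last by have /and3P[_ _ /eqP] := pz.
by rewrite {1}(ptildeP pz) B0 /embC /gl_emb add_block_mx !add0r addr0.
Qed.

End RegularNilpotentData.

(** * Simplicity *)

(** The characteristic is expressed by [p%:R = 0], so that the lemma applies to an enveloping
    algebra not yet known to be nonzero. *)
Lemma expr_prime_addr (R : pzRingType) p (x y : R) : prime p -> p%:R = 0 :> R ->
  GRing.comm x y -> (x + y) ^+ p = x ^+ p + y ^+ p.
Proof.
move=> pp p0 cxy; have defp := prednK (prime_gt0 pp).
rewrite exprDn_comm // big_ord_recr subnn -defp big_ord_recl /= defp.
rewrite subn0 mulr1 mul1r bin0 binn big1 ?addr0 // => i _.
have /dvdnP[m ->] : (p %| 'C(p, bump 0 i))%N by rewrite prime_dvd_bin //= -{2}defp ltnS (valP i).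
by rewrite mulnC mulrnA -mulr_natl -[_ *+ p]mulr_natl p0 mul0r mulr0.
Qed.

Section EnvelopingFacts.
Context (k : fieldType) (p n : nat) (chi : {scalar 'M[k]_n}).

Lemma redenv_ind (L : {pred 'M[k]_(n + n)}) (P : redenv p chi L -> Prop) :
  (forall c, P (red_scal p chi L c)) -> (forall u v, P u -> P v -> P (u + v)) ->
  (forall x u, P u -> P (red_gen p chi x * u)) -> forall u, P u.
Proof.
move=> PC PD PM; elim/rquotW=> u; elim/rquotW: u => u.
elim/malg_ind_add: u => [|u v hu hv|c m].
- by have := PC 0; rewrite raddf0 !raddf0.
- by rewrite !raddfD; exact: PD.
have Ec (l : seq (elt L)) : P (rpi _ (rpi _ << c *g FMonom l >>)).
  elim: l => [|x l ih].
    have := PC c; rewrite /red_scal /env_scal -mul_malgC mulr1.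
    congr (P (rpi _ (rpi _ << _ *g _ >>))).
    by apply/eqP; rewrite fmP fm1.
  have := PM x _ ih; rewrite /red_gen /env_gen -!rmorphM; congr (P (rpi _ (rpi _ _))).
  rewrite malgM_def fgmulUU mul1r; congr (<< _ *g _ >>); apply/eqP.
  by rewrite fmP fmM fmuE.
by have := Ec m; rewrite fmK.
Qed.

Local Notation Ug := (redenv p chi (@ptilde k n)).
Local Notation scal := (red_scal p chi (@ptilde k n)).

(** The generators as a total function of matrices, with value 0 off [ptilde], so that sums and
    brackets carry no membership proofs in their types. *)
Definition redenv_mx (x : 'M[k]_(n + n)) : Ug :=
  if insub x is Some y then red_gen p chi y else 0.

Lemma redenv_mxE x (hx : x \in @ptilde k n) : redenv_mx x = red_gen p chi (exist _ x hx).
Proof. by rewrite /redenv_mx insubT. Qed.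

Lemma redenv_mxP a x y : x \in @ptilde k n -> y \in @ptilde k n ->
  redenv_mx (a *: x + y) = scal a * redenv_mx x + redenv_mx y.
Proof.
move=> hx hy; rewrite (redenv_mxE hx) (redenv_mxE hy) (redenv_mxE (ptildeD a hx hy)).
exact: red_gen_lin.
Qed.

Lemma redenv_mx_sbracket b d x c e y : hom b d x -> hom c e y ->
  redenv_mx (sbracket b c x y)
  = redenv_mx x * redenv_mx y - (-1) ^+ (b && c) * (redenv_mx y * redenv_mx x).
Proof.
move=> hx hy; have [pz _ _] := hom_sbracket hx hy.
case: hx hy => px hx _ [py hy _].
rewrite (redenv_mxE px) (redenv_mxE py) (redenv_mxE pz).
exact: red_gen_bracket.
Qed.

Lemma redenv_mx_p A :
  redenv_mx (gl_emb A) ^+ p - redenv_mx (gl_emb (A ^+ p)) = scal (chi A ^+ p).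
Proof.
rewrite (redenv_mxE (gl_emb_ptilde A)) (redenv_mxE (gl_emb_ptilde (A ^+ p))).
exact: red_gen_p.
Qed.

End EnvelopingFacts.

(* [R] stands for [U_chi(g)]: rewriting in the quotient construction itself is
   prohibitively slow. *)
Section AbstractEnveloping.
Context (k : fieldType) (p n : nat) (chi : {scalar 'M[k]_n}).
Context (R : pzRingType) (scal : {rmorphism k -> R}) (pgen : 'M[k]_(n + n) -> R).
Hypothesis scal_central : forall c, central (scal c).
Hypothesis pgenP : forall a x y, x \in @ptilde k n -> y \in @ptilde k n ->
  pgen (a *: x + y) = scal a * pgen x + pgen y.
Hypothesis pgen_bracket : forall b d x c e y, hom b d x -> hom c e y ->
  pgen (sbracket b c x y) = pgen x * pgen y - (-1) ^+ (b && c) * (pgen y * pgen x).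
Hypothesis pgen_p : forall A,
  pgen (gl_emb A) ^+ p - pgen (gl_emb (A ^+ p)) = scal (chi A ^+ p).

Lemma pgen0 : pgen 0 = 0.
Proof.
have := pgenP 1 (ptilde0 k n) (ptilde0 k n); rewrite scaler0 addr0 rmorph1 mul1r.
by move/eqP; rewrite -subr_eq subrr eq_sym => /eqP.
Qed.

Lemma pgenZ a x : x \in @ptilde k n -> pgen (a *: x) = scal a * pgen x.
Proof. by move=> hx; rewrite -[a *: x]addr0 pgenP ?ptilde0 // pgen0 addr0. Qed.

Lemma pgenD x y : x \in @ptilde k n -> y \in @ptilde k n ->
  pgen (x + y) = pgen x + pgen y.
Proof. by move=> hx hy; rewrite -[x]scale1r pgenP // rmorph1 mul1r scale1r. Qed.

Lemma pgen_sum (I : Type) (r : seq I) (P : pred I) (F : I -> 'M[k]_(n + n)) :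
  (forall i, P i -> F i \in @ptilde k n) ->
  pgen (\sum_(i <- r | P i) F i) = \sum_(i <- r | P i) pgen (F i).
Proof.
move=> hF; pose K x u := x \in @ptilde k n /\ pgen x = u.
suff [] : K (\sum_(i <- r | P i) F i) (\sum_(i <- r | P i) pgen (F i)) by [].
elim/big_rec2: _ => [|i u x Pi [px <-]]; first by split; [exact: ptilde0|exact: pgen0].
by split; rewrite ?pgenD ?hF // -[F i]scale1r ptildeD ?hF.
Qed.

Lemma pgen_sbracket b d x c e y : hom b d x -> hom c e y ->
  pgen x * pgen y = (-1) ^+ (b && c) * (pgen y * pgen x) + pgen (sbracket b c x y).
Proof. by move=> hx hy; rewrite (pgen_bracket hx hy) addrC subrK. Qed.

Hypothesis kp : p \in [pchar k].
Hypothesis p_gt2 : (2 < p)%N.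
Hypothesis chi_reg : regular_nilpotent chi.

Lemma two_neq0 : 2%:R != 0 :> k.
Proof. by rewrite -(dvdn_pcharf kp) gtnNdvd. Qed.

Lemma redenv_p0 : p%:R = 0 :> R.
Proof. by rewrite -(rmorph_nat scal) (pcharf0 kp) rmorph0. Qed.

Definition chi_env x : R := scal (chi_ul chi x).
Local Notation theta := (shifted pgen chi_env).

Lemma chi_env_central x : central (chi_env x).
Proof. exact: scal_central. Qed.

Lemma chi_env_deg b d x : hom b d x -> d < 0 -> b || (d != -1) -> chi_env x = 0.
Proof. by move=> hx d0 bd; rewrite /chi_env (chi_ul_deg chi_reg hx) // raddf0. Qed.

Lemma theta0 : theta 0 = 0.
Proof. by rewrite /shifted pgen0 /chi_env linear0 rmorph0 subr0. Qed.

(** Since chi(x) is central, (x - chi(x))^p = x^p - chi(x)^p = x^[p], and an off-diagonal elementary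
    matrix squares to zero. *)
Lemma theta_ptE_exp (i j : 'I_n) : (j < i)%N -> theta (ptE k i j) ^+ p = 0.
Proof.
move=> ij; have pp := pcharf_prime kp.
have c1 : GRing.comm (theta (ptE k i j)) (chi_env (ptE k i j)).
  exact/commr_sym/chi_env_central.
have := expr_prime_addr pp redenv_p0 c1; rewrite {1}/shifted subrK => E.
have dp : (delta_mx i j : 'M[k]_n) ^+ p = 0.
  have -> : p = (p - 2).+2 by lia.
  rewrite !exprS mulrA; have -> : (delta_mx i j : 'M[k]_n) * delta_mx i j = 0.
    by apply: mul_delta_mx_0; rewrite neq_ltn ij.
  by rewrite mul0r.
have := pgen_p (delta_mx i j); rewrite dp linear0 -/(ptE k i j).
rewrite pgen0 subr0 E /chi_env /chi_ul /ptE /gl_emb block_mxKul rmorphXn.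
by move/eqP; rewrite eq_sym -subr_eq subrr eq_sym => /eqP.
Qed.

(** For odd x the superbracket [x, x] is 2 x^2; it vanishes because the matrix squares to zero, and
    2 is invertible. *)
Lemma theta_ptC_sqr (i j : 'I_n) : theta (ptC k i j) ^+ 2 = 0.
Proof.
have h := hom_ptC k i j; have [hi hj] := (ltn_ord i, ltn_ord j).
have -> : theta (ptC k i j) = pgen (ptC k i j).
  by rewrite /shifted (chi_env_deg h) ?subr0 //; lia.
have := pgen_sbracket h h; have -> : sbracket true true (ptC k i j) (ptC k i j) = 0.
  by rewrite /sbracket /ptC mulmx_block !mul0mx !mulmx0 !addr0 block_mx0 scaler0 subr0.
rewrite pgen0 addr0 expr1 mulN1r => /eqP; rewrite -addr_eq0 -mulr2n -mulr_natl => /eqP E.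
rewrite expr2 -[_ * _]mul1r -(rmorph1 scal) -(mulVf two_neq0) rmorphM -mulrA.
by rewrite rmorph_nat E mulr0.
Qed.

Lemma theta_mvec_nil q : theta (mvec k q) ^+ (exponent p q).+1 = 0.
Proof.
rewrite /mvec /exponent; case: ifP => inq; last by rewrite theta0 expr1.
move: inq; rewrite /inner; case: q.1 => ij; first exact: theta_ptC_sqr.
by rewrite prednK ?prime_gt0 ?(pcharf_prime kp) //; exact: theta_ptE_exp.
Qed.

Definition odd_pair (q r : idx n) : bool := q.1 && r.1.

(** Degrees add, so a bracket lies in degree at most -2, deeper than both arguments. There chi
    vanishes, and each component x can be rewritten as x - chi(x). *)
Lemma theta_nested (s : seq (idx n)) : uniq s -> (forall q, q \in s) ->
  nested (theta \o @mvec k n) (@depth n) odd_pair s.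
Proof.
move=> us ms q r _ _; have [hq hr] := (mvec_hom k q, mvec_hom k r).
have [dq dr] := (depth_gt0 q, depth_gt0 r).
have hz := hom_sbracket hq hr; set z := sbracket _ _ _ _ in hz.
exists (fun l => scal (mcoef z l)); first by move=> l; exact: scal_central.
have -> : theta (mvec k q) * theta (mvec k r)
    = (-1) ^+ odd_pair q r * (theta (mvec k r) * theta (mvec k q)) + pgen z.
  rewrite {2}/shifted mulrBr.
  rewrite (shifted_rho chi_env_central pgen_sbracket chi_env_deg hq hr); last by lia.
  rewrite -/z /odd_pair -(chi_env_central _ (theta _)) [theta (mvec k r)]/shifted.
  case Er: r.1; last by rewrite andbF expr0 !mul1r mulrBl [RHS]addrC addrA.
  rewrite Er in hr; rewrite (chi_env_deg hr _ isT); last by lia.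
  by rewrite mul0r !subr0 addrC.
congr (_ + _); have dz : - (depth q)%:Z - (depth r)%:Z < 0 by lia.
rewrite {1}(mvec_expand two_neq0 hz dz) pgen_sum; last first.
  by move=> l _; rewrite -[_ *: _]addr0 ptildeD ?ptilde0 //; case: (mvec_hom k l).
rewrite [RHS]big_mkcond [RHS]big_uniq //=; apply: eq_big => [l|l _]; first by rewrite ms.
rewrite pgenZ; last by case: (mvec_hom k l).
have [->|/(mcoef_depth hz) E] := eqVneq (mcoef z l) 0; first by rewrite !raddf0 !mul0r if_same.
have -> : ((depth q < depth l) && (depth r < depth l))%N by lia.
by rewrite /= /shifted (chi_env_deg (mvec_hom k l)) ?subr0 //; lia.
Qed.

Context (M : lmodType R) (v : M).
Hypothesis v_borel : forall b d x, hom b d x -> 0 <= d ->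
  exists c, pgen x *: v = scal c *: v.
Hypothesis M_gen : forall P : M -> Prop,
  P v -> (forall u w, P u -> P w -> P (u + w)) -> (forall c u, P u -> P (scal c *: u)) ->
  (forall x u, x \in @ptilde k n -> P u -> P (pgen x *: u)) -> forall u, P u.

Local Notation th := (theta \o @mvec k n).
Local Notation s := (idx_seq n).

Let th_nested : nested th (@depth n) odd_pair s.
Proof. by apply: theta_nested; [rewrite sort_uniq enum_uniq|exact: mem_idx_seq]. Qed.

Inductive lower_span : M -> Prop :=
| LowV : lower_span v
| LowD u w : lower_span u -> lower_span w -> lower_span (u + w)
| LowZ c u : lower_span u -> lower_span (scal c *: u)
| LowX b d x u : hom b d x -> d < 0 -> lower_span u -> lower_span (pgen x *: u).

(** The spanning half of the triangular decomposition: a factor of nonnegative degree is moved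
    right, past those of negative degree, until it acts on [v] by a scalar. *)
Lemma lower_span_hom b d x u : hom b d x -> lower_span u -> lower_span (pgen x *: u).
Proof.
move=> hx hu; have [d0|d0] := ltrP d 0; first exact: LowX hx d0 hu.
elim: hu b d x hx d0 => {u} [|u w _ hu _ hw|c u _ hu|c e y u hy e0 hu IH] b d x hx d0.
- by have [c ->] := v_borel hx d0; apply/LowZ/LowV.
- by rewrite scalerDr; apply: LowD; [exact: hu hx d0|exact: hw hx d0].
- by rewrite scalerA -(scal_central c) -scalerA; apply/LowZ/(hu _ _ _ hx d0).
rewrite scalerA (pgen_sbracket hx hy) scalerDl -!scalerA; apply: LowD.
  have -> : (-1) ^+ (b && c) = scal ((-1) ^+ (b && c)) by rewrite rmorph_sign.
  exact/LowZ/(LowX hy e0)/(IH _ _ _ hx d0).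
have hxy := hom_sbracket hx hy; have [de|de] := ltrP (d + e) 0; first exact: LowX hxy de hu.
exact: IH hxy de.
Qed.

Lemma lower_span_all u : lower_span u.
Proof.
elim/M_gen: u => [||c u|x u px hu]; [exact: LowV|exact: LowD|exact: LowZ|].
have L0 : lower_span 0 by rewrite -(scale0r v) -(rmorph0 scal); exact/LowZ/LowV.
have step (F : 'I_n -> 'I_n -> 'M[k]_(n + n)) (b : bool) (d : 'I_n -> 'I_n -> int)
    (c : 'I_n -> 'I_n -> k) : (forall i j, hom b (d i j) (F i j)) ->
    lower_span (pgen (\sum_i \sum_j c i j *: F i j) *: u).
  move=> hF; have pF i j : F i j \in @ptilde k n by case: (hF i j).
  have pS i : \sum_j c i j *: F i j \in @ptilde k n.
    elim/big_rec: _ => [|j y _ py]; [exact: ptilde0|exact: ptildeD].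
  rewrite pgen_sum // scaler_suml; elim/big_rec: _ => // i y _; apply: LowD.
  rewrite pgen_sum; last by move=> j _; rewrite -[_ *: _]addr0 ptildeD ?ptilde0.
  rewrite scaler_suml; elim/big_rec: _ => // j {}y _; apply: LowD.
  by rewrite pgenZ // -scalerA; apply: LowZ; exact: lower_span_hom (hF i j) hu.
have [_ /eqP sB /eqP sC] := and3P px.
have -> : x = gl_emb (ulsubmx x) + (embB (ursubmx x) + embC (dlsubmx x)).
  by rewrite {1}(ptildeP px) /gl_emb /embB /embC !add_block_mx !addr0 !add0r.
rewrite (embB_expand two_neq0 sB) (embC_expand two_neq0 sC) gl_emb_expand.
under [X in _ + (_ + X)]eq_bigr => i _ do rewrite big_mkcond.
have pS (F : 'I_n -> 'I_n -> 'M[k]_(n + n)) (c : 'I_n -> 'I_n -> k) :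
    (forall i j, F i j \in @ptilde k n) -> \sum_i \sum_j c i j *: F i j \in @ptilde k n.
  move=> pF; elim/big_rec: _ => [|i y _ py]; first exact: ptilde0.
  rewrite -[\sum_j _]scale1r ptildeD //.
  by elim/big_rec: _ => [|j z _ pz]; [exact: ptilde0|exact: ptildeD].
have EC : \sum_(i : 'I_n) \sum_(j : 'I_n) (if (i < j)%N then dlsubmx x i j *: ptC k i j else 0)
    = \sum_(i : 'I_n) \sum_(j : 'I_n) (if (i < j)%N then dlsubmx x i j else 0) *: ptC k i j.
  by apply: eq_bigr => i _; apply: eq_bigr => j _; case: ifP; rewrite ?scale0r.
rewrite {}EC pgenD; last 2 first.
- by apply: pS => i j; exact: ptE_ptilde.
- rewrite -[X in X + _]scale1r ptildeD // pS // => i j; [exact: ptB_ptilde|exact: ptC_ptilde].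
rewrite pgenD; last 2 first.
- by apply: pS => i j; exact: ptB_ptilde.
- by apply: pS => i j; exact: ptC_ptilde.
rewrite !scalerDl; apply: LowD; last apply: LowD.
- by apply: step => i j; exact: hom_ptE.
- by apply: step => i j; exact: hom_ptB.
- by apply: step => i j; exact: hom_ptC.
Qed.

Lemma pgen_expand b d z : hom b d z -> d < 0 ->
  pgen z = \sum_(q : idx n) scal (mcoef z q) * pgen (mvec k q).
Proof.
move=> hz d0; rewrite {1}(mvec_expand two_neq0 hz d0) pgen_sum; last first.
  by move=> l _; rewrite -[_ *: _]addr0 ptildeD ?ptilde0 //; case: (mvec_hom k l).
by apply: eq_bigr => l _; rewrite pgenZ //; case: (mvec_hom k l).
Qed.

Lemma chi_env_expand b d z : hom b d z -> d < 0 ->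
  chi_env z = \sum_(q : idx n) scal (mcoef z q) * chi_env (mvec k q).
Proof.
move=> hz d0; rewrite /chi_env {1}(mvec_expand two_neq0 hz d0) !raddf_sum.
by apply: eq_bigr => l _; rewrite /= linearZ /= rmorphM.
Qed.

Local Notation Vline := (fun u => exists c, u = scal c *: v).

Lemma aug_span_scal (N : M -> Prop) c u : (forall a w, N w -> N (scal a *: w)) ->
  aug_span th N s u -> aug_span th N s (scal c *: u).
Proof.
move=> NZ; elim=> {u} [u Nu|u w _ hu _ hw|q u sq].
- exact/AugN/NZ.
- by rewrite scalerDr; exact: AugD.
- by rewrite scalerA (scal_central c) -scalerA; exact: AugT.
Qed.

Lemma aug_span_all u : aug_span th Vline s u.
Proof.
have VZ a w : Vline w -> Vline (scal a *: w).
  by case=> c ->; exists (a * c); rewrite scalerA rmorphM.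
have V0 : Vline 0 by exists 0; rewrite raddf0 scale0r.
elim: (lower_span_all u) => {u} [|u w _ hu _ hw|c u _ hu|b d x u hx d0 _ hu].
- by apply: AugN; exists 1; rewrite rmorph1 scale1r.
- exact: AugD.
- exact: aug_span_scal.
rewrite (pgen_expand hx d0) scaler_suml; apply: aug_span_sum => // q _.
rewrite -scalerA; apply: aug_span_scal => //.
rewrite -[pgen _](subrK (chi_env (mvec k q))) scalerDl; apply: AugD.
  by apply: (@AugT _ _ th); exact: mem_idx_seq.
exact: aug_span_scal.
Qed.

Lemma pairing_env q r :
  chi_env (sbracket q.1 r.1 (mvec k q) (dvec k r)) = scal (pairing chi q r).
Proof. by []. Qed.

Lemma simple_abstract (N : M -> Prop) : N 0 -> (forall u w, N u -> N w -> N (u + w)) ->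
  (forall a u, N u -> N (a *: u)) -> (exists2 u, N u & u != 0) -> forall u, N u.
Proof.
move=> N0 ND NZ Nn0; have ds := idx_seq_depth n.
have [|w [Nw w0 ww]] := whittaker_exists theta_mvec_nil _ ds th_nested Nn0.
  by move=> q u; exact: NZ.
have w_whit b d x : hom b d x -> d < 0 -> pgen x *: w = chi_env x *: w.
  move=> hx d0; rewrite (pgen_expand hx d0) (chi_env_expand hx d0) !scaler_suml.
  apply: eq_bigr => q _; rewrite -!scalerA; congr (_ *: _); apply/eqP.
  by rewrite -subr_eq0 -scalerBl; apply/eqP/ww/mem_idx_seq.
have E : top th (@exponent p n) s *: (dual_top pgen (@dvec k n) (@exponent p n) s *: w)
    = (\prod_(q <- rev s) (((exponent p q)`!)%:R * chi_env
         (sbracket q.1 q.1 (mvec k q) (dvec k q)) ^+ exponent p q)) *: w.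
  apply: (top_dual_top chi_env_central (@hom_sbracket k n) pgen_sbracket chi_env_deg
    w_whit (@mvec_hom k n) (@dvec_hom k n) (@depth_gt0 n) (@exponent_odd p n)).
  have : pairwise (fun q r : idx n => (q != r) && (key q <= key r)%N) s.
    rewrite pairwise_relI idx_seq_sorted andbT -uniq_pairwise sort_uniq; exact: enum_uniq.
  apply: sub_pairwise => q r /andP[qr kqr].
  by rewrite key_depth //= pairing_env (pairing_key chi_reg kqr qr) raddf0.
set K := \prod_(q <- _) _ in E.
(* The factorials are 1 or (p-1)!, the latter invertible by Wilson's theorem; the diagonal pairings
   are 1, -1 or -2, and positions with zero vectors have exponent 0. *)
have [K' K'0 EK] : exists2 K' : k, K' != 0 & K = scal K'.
  exists (\prod_(q <- rev s) (((exponent p q)`!)%:R * pairing chi q q ^+ exponent p q)).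
    rewrite prodf_seq_neq0; apply/allP => q _ /=; rewrite mulf_neq0 //.
      rewrite -(dvdn_pcharf kp) /exponent.
      have pp := pcharf_prime kp.
      case: ifP => _; last by rewrite gtnNdvd ?prime_gt1.
      case: ifP => _; first by rewrite gtnNdvd ?prime_gt1.
      apply/negP => dp; have := Wilson (prime_gt1 pp).
      by rewrite pp => /esym; rewrite -addn1 dvdn_addr // gtnNdvd ?prime_gt1.
    rewrite expf_eq0 negb_and /exponent; case: ifP => // inq.
    by rewrite (pairing_self chi_reg two_neq0) ?orbT.
  rewrite rmorph_prod; apply: eq_bigr => q _.
  by rewrite rmorphM rmorph_nat rmorphXn pairing_env.
set f := dual_top _ _ _ _ *: w in E.
have Nf : N f by exact: NZ.
have NsZ a u : N u -> N (scal a *: u) by exact: NZ.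
(* The remainder [g] lies in N + JZ and is also killed by [top]. Applied to [f], whose image under
   [top] is a nonzero multiple of [w], this forces the coefficient of [v] to be nonzero, and [v] can
   be solved for. *)
have split u : aug_span th Vline s u ->
    exists c g, [/\ u = scal c *: v + g, aug_span th N s g & top th (@exponent p n) s *: g = 0].
  elim=> {u} [u [c ->]|u u' _ [c [g [-> hg tg]]] _ [c' [g' [-> hg' tg']]]|q u sq].
  - by exists c, 0; rewrite addr0 scaler0; split=> //; exact: AugN.
  - exists (c + c'), (g + g'); rewrite rmorphD scalerDl addrACA scalerDr tg tg' addr0.
    by split=> //; exact: AugD.
  exists 0, (th q *: u); rewrite rmorph0 scale0r add0r; split=> //; first exact: AugT.
  by rewrite scalerA (top_th theta_mvec_nil ds th_nested sq) scale0r.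
have Av : aug_span th N s v.
  have [c [g [Ef hg tg]]] := split _ (aug_span_all f).
  have c0 : c != 0.
    apply: contra_neq w0 => c0; move: E; rewrite Ef c0 rmorph0 scale0r add0r tg EK => /esym E.
    by rewrite -[w]scale1r -(rmorph1 scal) -(mulVf K'0) rmorphM -scalerA E scaler0.
  have -> : v = scal c^-1 *: (f + scal (- 1) *: g).
    rewrite rmorphN rmorph1 scaleN1r Ef addrK scalerA -rmorphM mulVf //.
    by rewrite rmorph1 scale1r.
  by apply: aug_span_scal => //; apply: AugD; [exact: AugN|exact: aug_span_scal].
apply: (nakayama theta_mvec_nil N0 ND _ ds th_nested) => [q u|u]; first exact: NZ.
have [c [g [-> hg _]]] := split _ (aug_span_all u).
by apply: AugD => //; exact: aug_span_scal.
Qed.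

End AbstractEnveloping.

(** * Jacobson's formula *)

Section Jacobson.

Definition ad (R : pzRingType) (u v : R) := u * v - v * u.

(** From u y = [u, y] + y u, all powers of u are collected on the right; the coefficients satisfy
    Pascal's rule. In characteristic p and for m = p only the last summand survives. *)
Lemma deriv_exp_ad (R : nzRingType) (u : {poly R}) m :
  (u ^+ m)^`() = \sum_(i < m) (iter i (ad u) u^`() * u ^+ (m - i.+1)) *+ 'C(m, i.+1).
Proof.
elim: m => [|m ih]; first by rewrite expr0 big_ord0 -[1]/(1%:P) derivC.
rewrite exprS derivM ih mulr_sumr.
under eq_bigr => i _.
  rewrite mulrnAr mulrA.
  have -> : u * iter i (ad u) u^`() = iter i.+1 (ad u) u^`() + iter i (ad u) u^`() * u.
    by rewrite [iter i.+1 _ _]iterS {2}/ad subrK.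
  rewrite mulrDl -mulrA -exprS mulrnDl; over.
rewrite big_split /= addrA.
have -> : u^`() * u ^+ m
     + \sum_(i < m) (ad u (iter i (ad u) u^`()) * u ^+ (m - i.+1)) *+ 'C(m, i.+1)
   = \sum_(i < m.+1) (iter i (ad u) u^`() * u ^+ (m - i)) *+ 'C(m, i).
  by rewrite big_ord_recl /= bin0 subn0 mulr1n.
have -> : \sum_(i < m) (iter i (ad u) u^`() * u ^+ (m - i.+1).+1) *+ 'C(m, i.+1)
   = \sum_(i < m.+1) (iter i (ad u) u^`() * u ^+ (m - i)) *+ 'C(m, i.+1).
  rewrite big_ord_recr /= bin_small // mulr0n addr0; apply: eq_bigr => i _.
  by rewrite subnSK.
by rewrite -big_split; apply: eq_bigr => i _ /=; rewrite subSS -mulrnDr binS addnC.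
Qed.

Lemma deriv_exp_pchar (R : nzRingType) p (u : {poly R}) : p \in [pchar R] ->
  (u ^+ p)^`() = iter p.-1 (ad u) u^`().
Proof.
move=> pR; have pP : p \in [pchar {poly R}].
  by rewrite inE (pcharf_prime pR) -polyC_natr (pcharf0 pR) polyC0 eqxx.
have := pcharf_prime pR; rewrite deriv_exp_ad; case: p pR pP => // m pR pP pp.
rewrite big_ord_recr /= binn subnn mulr1 mulr1n big1 ?add0r // => i _.
by rewrite -mulr_natr (bin_lt_pcharf_0 pP) ?mulr0 //= ltnS ltn_ord.
Qed.

Context (A B : nzRingType) (p : nat) (phi : {additive A -> B}).
Hypothesis pA : p \in [pchar A].
Hypothesis pB : p \in [pchar B].
Hypothesis phi_ad : forall a b, phi (ad a b) = ad (phi a) (phi b).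

(** [phi] preserves commutators but not products. This suffices because each coefficient of [f, g]
    is a sum of commutators of coefficients. *)
Lemma map_poly_ad (f g : {poly A}) :
  map_poly phi (ad f g) = ad (map_poly phi f) (map_poly phi g).
Proof.
apply/polyP => j; rewrite coef_map /ad !coefB coefM coefMr coefM coefMr.
rewrite -!sumrB raddf_sum; apply: eq_bigr => i _.
by rewrite !coef_map; exact: phi_ad.
Qed.

Lemma map_poly_iter_ad i (f g : {poly A}) :
  map_poly phi (iter i (ad f) g) = iter i (ad (map_poly phi f)) (map_poly phi g).
Proof. by elim: i => //= i ih; rewrite map_poly_ad ih. Qed.

Lemma coef_lin_mul (R : nzRingType) (c d : R) (q : {poly R}) j :
  ((c%:P + d *: 'X) * q)`_j = c * q`_j + d * (if j is j'.+1 then q`_j' else 0).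
Proof. by rewrite mulrDl coefD coefCM -scalerAl coefZ coefXM; case: j. Qed.

Lemma coef_lin_exp_gt (R : nzRingType) (c d : R) m j : (m < j)%N ->
  ((c%:P + d *: 'X) ^+ m)`_j = 0.
Proof.
elim: m j => [|m ih] [|j] //= mj; first by rewrite expr0 coef1.
by rewrite exprS coef_lin_mul !ih ?mulr0 ?addr0 // ltnW.
Qed.

Lemma coef_lin_exp0 (R : nzRingType) (c d : R) m : ((c%:P + d *: 'X) ^+ m)`_0 = c ^+ m.
Proof.
by elim: m => [|m ih]; rewrite ?expr0 ?coef1 // exprS coef_lin_mul ih mulr0 addr0 exprS.
Qed.

Lemma coef_lin_expn (R : nzRingType) (c d : R) m : ((c%:P + d *: 'X) ^+ m)`_m = d ^+ m.
Proof.
elim: m => [|m ih]; rewrite ?expr0 ?coef1 // exprS coef_lin_mul ih.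
by rewrite coef_lin_exp_gt // mulr0 add0r exprS.
Qed.

(** Evaluation of (c + d t)^m at t = 1, done by recursion on coefficients since [c] and [d] need not
    commute. *)
Lemma sum_coef_lin_exp (R : nzRingType) (c d : R) m :
  (c + d) ^+ m = \sum_(i < m.+1) ((c%:P + d *: 'X) ^+ m)`_i.
Proof.
elim: m => [|m ih]; first by rewrite big_ord1 !expr0 coef1.
rewrite exprS ih; under [RHS]eq_bigr => i _ do rewrite exprS coef_lin_mul.
rewrite big_split /= -!mulr_sumr mulrDl; congr (_ * _ + _ * _).
  by rewrite [RHS]big_ord_recr /= coef_lin_exp_gt ?addr0.
by rewrite [RHS]big_ord_recl /= add0r.
Qed.

(** Bezout inverts [i] modulo [p]. This recovers the i-th coefficient of a polynomial from its
    derivative. *)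
Lemma mulrn_pchar_inj (R : nzRingType) (x y : R) i : p \in [pchar R] ->
  (0 < i < p)%N -> x *+ i = y *+ i -> x = y.
Proof.
move=> pR /andP[i0 ip] /eqP; rewrite -subr_eq0 -mulrnBl => /eqP zi.
apply/eqP; rewrite -subr_eq0; have pp := pcharf_prime pR.
have [a _ /dvdnP[m]] := Bezoutl i (prime_gt0 pp).
have /eqP -> : coprime p i by rewrite prime_coprime // gtnNdvd.
move/(congr1 (fun e => (x - y) *+ e)); rewrite mulrnDr mulr1n mulnC mulrnA zi mul0rn addr0.
by rewrite mulnC mulrnA (mulrn_pchar pR) mul0rn => ->.
Qed.

(* The coefficients of [t^j], [0 < j < p], in [(a + t b)^p] are Lie polynomials
   in [a] and [b]: the derivative of [(a + t b)^p] is [ad (a + t b)^(p-1) b]. *)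
Lemma jacobson_defect_additive a b :
  phi (a + b) ^+ p - phi ((a + b) ^+ p)
  = (phi a ^+ p - phi (a ^+ p)) + (phi b ^+ p - phi (b ^+ p)).
Proof.
pose u : {poly A} := a%:P + b *: 'X; have pp := pcharf_prime pA.
have mapu : map_poly phi u = (phi a)%:P + phi b *: 'X.
  apply/polyP => i; rewrite coef_map /u !(coefD, coefC, coefZ, coefX) raddfD.
  by case: i => [|[|i]]; rewrite /= ?mulr0 ?mulr1 ?raddf0.
have du (R : nzRingType) (c d : R) : (c%:P + d *: 'X)^`() = d%:P.
  by rewrite derivD derivC derivZ derivX add0r alg_polyC.
have mid i : (0 < i < p)%N ->
    phi ((u ^+ p)`_i) = (((phi a)%:P + phi b *: 'X) ^+ p)`_i.
  move=> ip; apply: (mulrn_pchar_inj pB ip); case: i ip => // i ip.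
  rewrite -raddfMn -!coef_deriv -coef_map (deriv_exp_pchar _ pA) (deriv_exp_pchar _ pB).
  by rewrite map_poly_iter_ad mapu !du map_polyC.
rewrite raddfD (sum_coef_lin_exp (phi a)) (sum_coef_lin_exp a) -/u raddf_sum -sumrB.
have ends (F : nat -> B) : (forall i, (0 < i < p)%N -> F i = 0) ->
    \sum_(i < p.+1) F i = F 0%N + F p.
  move=> F0; rewrite big_ord_recr (bigD1 (Ordinal (prime_gt0 pp))) //= big1 ?addr0 // => i i0.
  by apply: F0; rewrite ltn_ord andbT lt0n.
rewrite (ends (fun i => ((((phi a)%:P + phi b *: 'X) ^+ p)`_i) - phi ((u ^+ p)`_i)));
  last by move=> i /mid ->; rewrite subrr.
by rewrite !coef_lin_exp0 !coef_lin_expn.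
Qed.

End Jacobson.

(** * Oscillator representations *)

Lemma expr_prime_sum (R : pzRingType) p (I : eqType) (r : seq I) (F : I -> R) :
  prime p -> p%:R = 0 :> R -> {in r &, forall i j, GRing.comm (F i) (F j)} ->
  (\sum_(i <- r) F i) ^+ p = \sum_(i <- r) F i ^+ p.
Proof.
move=> pp p0; elim: r => [_|i r ih cF]; first by rewrite !big_nil expr0n gtn_eqF ?prime_gt0.
rewrite !big_cons expr_prime_addr // ?ih //.
  by move=> j l jr lr; apply: cF; rewrite inE ?jr ?lr orbT.
rewrite big_seq; elim/big_rec: _ => [|j x jr cx]; first exact: commr0.
by apply: commrD => //; apply: cF; rewrite inE ?eqxx ?jr ?orbT.
Qed.

Section Oscillators.
Context (k : fieldType) (n : nat) (S : nzRingType) (scal : {rmorphism k -> S}).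
Hypothesis scal_central : forall c, central (scal c).

Definition oddi (s : 'I_(n + n)) : bool := (n <= s)%N.
Local Notation sgn b := ((-1) ^+ b : S).
Local Notation mode := ('I_(n + n) * 'I_n)%type.

Context (crea anni : mode -> S).
Hypothesis creaC : forall s t,
  crea s * crea t = sgn (oddi s.1 && oddi t.1) * (crea t * crea s).
Hypothesis anniC : forall s t,
  anni s * anni t = sgn (oddi s.1 && oddi t.1) * (anni t * anni s).
Hypothesis anni_crea : forall s t,
  anni s * crea t = sgn (oddi s.1 && oddi t.1) * (crea t * anni s) + (s == t)%:R.

Lemma mulr_signCA (b : bool) x y : x * (sgn b * y) = sgn b * (x * y).
Proof. by rewrite mulrA -central_sign mulrA. Qed.

(** Both products are brought to the order crea crea anni anni. The quartic parts agree up to the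
    sign, and the contractions are the quadratic terms left over. *)
Lemma quad_comm (s t u v : mode) :
  crea s * anni t * (crea u * anni v)
  = sgn ((oddi s.1 (+) oddi t.1) && (oddi u.1 (+) oddi v.1)) * (crea u * anni v * (crea s * anni t))
    + (t == u)%:R * (crea s * anni v)
    - sgn ((oddi s.1 (+) oddi t.1) && (oddi u.1 (+) oddi v.1)) * ((v == s)%:R * (crea u * anni t)).
Proof.
have natC m : central (m%:R : S) by move=> x; apply/commr_sym/commr_nat.
have E1 : crea s * anni t * (crea u * anni v)
    = sgn (oddi t.1 && oddi u.1) * (crea s * crea u * (anni t * anni v))
      + (t == u)%:R * (crea s * anni v).
  rewrite -mulrA (mulrA (anni t)) anni_crea mulrDl mulrDr; congr (_ + _).
    by rewrite -!mulrA mulr_signCA.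
  by rewrite mulrA -(natC _ (crea s)) -mulrA.
have E2 : crea u * anni v * (crea s * anni t)
    = sgn (oddi v.1 && oddi s.1) * sgn (oddi u.1 && oddi s.1) * sgn (oddi v.1 && oddi t.1)
        * (crea s * crea u * (anni t * anni v))
      + (v == s)%:R * (crea u * anni t).
  rewrite -mulrA (mulrA (anni v)) anni_crea mulrDl mulrDr; congr (_ + _); last first.
    by rewrite mulrA -(natC _ (crea u)) -mulrA.
  rewrite -!mulrA mulr_signCA (mulrA (crea u)) creaC (anniC v t) -!mulrA.
  by rewrite (mulr_signCA _ (crea u)) (mulr_signCA _ (crea s)).
rewrite E1 E2 mulrDr addrAC addrK [in RHS]mulrA; congr (_ * _ + _).
rewrite !mulrA -!signr_addb; congr (_ ^+ _).
by case: (oddi s.1); case: (oddi t.1); case: (oddi u.1); case: (oddi v.1).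
Qed.

(** The elementary matrix E_{s,t} acts as x_s d/dx_t, summed over the n copies of the oscillator
    representation. *)
Definition quad (s t : 'I_(n + n)) : S := \sum_i crea (s, i) * anni (t, i).
Definition osc (x : 'M[k]_(n + n)) : S := \sum_s \sum_t scal (x s t) * quad s t.

Lemma quad_bracket s t u v (b c : bool) : oddi s (+) oddi t = b -> oddi u (+) oddi v = c ->
  quad s t * quad u v - sgn (b && c) * (quad u v * quad s t)
  = (t == u)%:R * quad s v - sgn (b && c) * ((v == s)%:R * quad u t).
Proof.
move=> hb hc; have prod2 s1 t1 u1 v1 : quad s1 t1 * quad u1 v1
    = \sum_i \sum_j crea (s1, i) * anni (t1, i) * (crea (u1, j) * anni (v1, j)).
  by rewrite /quad mulr_suml; apply: eq_bigr => i _; rewrite mulr_sumr.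
have diag (s1 t1 : 'I_(n + n)) i (F : 'I_n -> S) :
    \sum_j ((s1, i) == (t1, j))%:R * F j = (s1 == t1)%:R * F i.
  rewrite (bigD1 i) //= big1 ?addr0 => [|j ji]; first by rewrite xpair_eqE eqxx andbT.
  by rewrite xpair_eqE [i == j]eq_sym (negbTE ji) andbF mul0r.
rewrite !prod2 [X in _ - _ * X]exchange_big /= /quad !mulr_sumr -!sumrB.
apply: eq_bigr => i _; rewrite !mulr_sumr -!sumrB.
rewrite -(diag t u i (fun j => crea (s, i) * anni (v, j))).
rewrite -[crea (u, i) * anni (t, i)]/((fun j => crea (u, j) * anni (t, i)) i).
have -> : (v == s)%:R = (s == v)%:R :> S by rewrite eq_sym.
rewrite -(diag s v i (fun j => crea (u, j) * anni (t, i))) mulr_sumr -sumrB.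
apply: eq_bigr => j _; rewrite quad_comm /= hb hc [(v, j) == _]eq_sym.
by rewrite -[X in X - _]addrA [X in X - _]addrC addrK.
Qed.

Lemma osc_is_linear a x y : osc (a *: x + y) = scal a * osc x + osc y.
Proof.
rewrite /osc mulr_sumr -big_split; apply: eq_bigr => s _ /=.
rewrite mulr_sumr -big_split; apply: eq_bigr => t _ /=.
by rewrite !mxE rmorphD rmorphM mulrDl mulrA.
Qed.

Lemma oddil i : oddi (lshift n i) = false.
Proof. by rewrite /oddi /= leqNgt ltn_ord. Qed.

Lemma oddir i : oddi (rshift n i) = true.
Proof. by rewrite /oddi /= leq_addr. Qed.

Lemma homog_oddi b (x : 'M[k]_(n + n)) s t :
  homog b x -> x s t != 0 -> oddi s (+) oddi t = b.
Proof.
move=> hx; case: (split_ordP s) => i ->; case: (split_ordP t) => j ->;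
  rewrite ?oddil ?oddir /=; case: b hx => -[h1 h2] //;
  rewrite -(submxK x) ?(block_mxEul, block_mxEur, block_mxEdl, block_mxEdr)
    ?h1 ?h2 mxE eqxx //.
Qed.

Lemma osc_sbracket b c x y : homog b x -> homog c y ->
  osc (sbracket b c x y) = osc x * osc y - sgn (b && c) * (osc y * osc x).
Proof.
move=> hx hy.
have oscE x1 : osc x1 = \sum_(st : 'I_(n + n) * 'I_(n + n)) scal (x1 st.1 st.2) * quad st.1 st.2.
  by rewrite /osc (pair_bigA _ (fun s t => scal (x1 s t) * quad s t)).
have prod2 x1 y1 : osc x1 * osc y1
    = \sum_st \sum_uv scal (x1 st.1 st.2 * y1 uv.1 uv.2) * (quad st.1 st.2 * quad uv.1 uv.2).
  rewrite !oscE mulr_suml; apply: eq_bigr => st _; rewrite mulr_sumr; apply: eq_bigr => uv _.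
  by rewrite rmorphM -!mulrA (mulrA (quad _ _)) -scal_central !mulrA.
have prodE x1 y1 : osc (x1 *m y1)
    = \sum_st \sum_uv scal (x1 st.1 st.2 * y1 uv.1 uv.2)
        * ((st.2 == uv.1)%:R * quad st.1 uv.2).
  rewrite /osc; under [RHS]eq_bigr => st _.
    rewrite -(pair_bigA _ (fun u v => scal (x1 st.1 st.2 * y1 u v)
        * ((st.2 == u)%:R * quad st.1 v))) /= (bigD1 st.2) //= [X in _ + X]big1 ?addr0; last first.
      move=> u ut; rewrite big1 // => v _.
      by rewrite eq_sym (negbTE ut) mul0r mulr0.
    rewrite eqxx; under eq_bigr => v _ do rewrite mul1r; over.
  rewrite -(pair_bigA _ (fun s t => \sum_v scal (x1 s t * y1 t v) * quad s v)) /=.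
  apply: eq_bigr => s _; rewrite exchange_big /=; apply: eq_bigr => v _.
  by rewrite mxE rmorph_sum mulr_suml.
have -> : osc (sbracket b c x y) = osc (x *m y) - sgn (b && c) * osc (y *m x).
  rewrite /sbracket -scaleNr addrC osc_is_linear addrC rmorphN mulNr.
  by rewrite rmorph_sign.
rewrite !prod2 !prodE [X in _ - _ * X]exchange_big [X in _ = _ - _ * X]exchange_big /=.
rewrite !mulr_sumr -!sumrB; apply: eq_bigr => -[s t] _ /=.
rewrite !mulr_sumr -!sumrB; apply: eq_bigr => -[u v] _ /=.
have [->|xst] := eqVneq (x s t) 0; first by rewrite mul0r mulr0 rmorph0 !mul0r !mulr0.
have [->|yuv] := eqVneq (y u v) 0; first by rewrite mul0r mulr0 rmorph0 !mul0r !mulr0.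
rewrite [y u v * _]mulrC -!(mulr_signCA _ (scal _)) -!mulrBr.
by rewrite (quad_bracket (homog_oddi hx xst) (homog_oddi hy yuv)).
Qed.

Lemma oscD x y : osc (x + y) = osc x + osc y.
Proof. by rewrite -[x]scale1r osc_is_linear rmorph1 mul1r scale1r. Qed.

Lemma osc0 : osc 0 = 0.
Proof. by apply: (addrI (osc 0)); rewrite -oscD !addr0. Qed.

Lemma oscZ a x : osc (a *: x) = scal a * osc x.
Proof. by rewrite -[a *: x]addr0 osc_is_linear osc0 addr0. Qed.

Lemma oscB x y : osc (x - y) = osc x - osc y.
Proof. by rewrite oscD -scaleN1r oscZ rmorphN rmorph1 mulN1r. Qed.

Lemma osc_delta s t : osc (delta_mx s t) = quad s t.
Proof.
rewrite /osc (bigD1 s) //= (bigD1 t) //= mxE !eqxx rmorph1 mul1r.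
rewrite big1 ?addr0 => [|u us]; last by rewrite mxE (negbTE us) andbF rmorph0 mul0r.
rewrite big1 ?addr0 // => v vs; rewrite big1 // => u _.
by rewrite mxE (negbTE vs) rmorph0 mul0r.
Qed.

Lemma osc_ptE (a b : 'I_n) : osc (gl_emb (delta_mx a b))
  = quad (lshift n a) (lshift n b) - quad (rshift n b) (rshift n a).
Proof. by rewrite -[delta_mx a b]/(Xgl k a b) Xgl_emb oscB !osc_delta. Qed.

Context (p : nat) (chi : {scalar 'M[k]_n}) (al be : 'I_n -> 'I_n -> k).
Hypothesis kp : p \in [pchar k].
Hypothesis p_gt2 : (2 < p)%N.
Hypothesis chi_reg : regular_nilpotent chi.
Hypothesis crea_p : forall a i, crea (lshift n a, i) ^+ p = scal (al a i).
Hypothesis anni_p : forall a i, anni (lshift n a, i) ^+ p = scal (be a i).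
Hypothesis number_p : forall a i, (crea (lshift n a, i) * anni (lshift n a, i)) ^+ p
  = crea (lshift n a, i) * anni (lshift n a, i).
Hypothesis al_be : forall a b : 'I_n, a != b ->
  \sum_i al a i * be b i = (a == b.+1 :> nat)%:R.

Lemma pchar_S : p \in [pchar S].
Proof. by rewrite inE (pcharf_prime kp) -(rmorph_nat scal) (pcharf0 kp) rmorph0 eqxx. Qed.

(** The summands are even and belong to different copies, so they commute and Frobenius applies. *)
Lemma quad_exp s t : oddi s = oddi t ->
  quad s t ^+ p = \sum_i (crea (s, i) * anni (t, i)) ^+ p.
Proof.
move=> st; apply: expr_prime_sum; [exact: pcharf_prime kp|exact: pcharf0 pchar_S|].
move=> i j _ _; have [->//|ij] := eqVneq i j.
rewrite /GRing.comm quad_comm /= st addbb expr0 !mul1r.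
by rewrite !xpair_eqE (negbTE ij) [j == i]eq_sym (negbTE ij) !andbF !mul0r addr0 subr0.
Qed.

Lemma quad_even_diag a : quad (lshift n a) (lshift n a) ^+ p = quad (lshift n a) (lshift n a).
Proof. by rewrite quad_exp //; apply: eq_bigr => i _; exact: number_p. Qed.

(** For different indices creation and annihilation commute, so the p-th power splits into the
    scalars [al] and [be]; [al_be] demands that their sum over the copies be the value of chi. *)
Lemma quad_even_off a b : a != b ->
  quad (lshift n a) (lshift n b) ^+ p = scal (a == b.+1 :> nat)%:R.
Proof.
move=> ab; rewrite quad_exp ?oddil // -al_be // rmorph_sum; apply: eq_bigr => i _.
rewrite exprMn_comm ?crea_p ?anni_p ?rmorphM //.
rewrite /GRing.comm anni_crea /= !oddil mul1r xpair_eqE eqxx andbT.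
by rewrite (inj_eq (@lshift_inj n n)) eq_sym (negbTE ab) addr0.
Qed.

Lemma eq_opp0 (x : S) : x = - x -> x = 0.
Proof.
move/eqP; rewrite -addr_eq0 -mulr2n => /eqP x2; apply: (mulrn_pchar_inj pchar_S (i := 2)) => //.
by rewrite mul0rn.
Qed.

Lemma crea_odd_sqr a i : crea (rshift n a, i) * crea (rshift n a, i) = 0.
Proof. by apply: eq_opp0; rewrite {1}creaC /= oddir mulN1r. Qed.

Lemma quad_odd_diag a : quad (rshift n a) (rshift n a) ^+ p = quad (rshift n a) (rshift n a).
Proof.
rewrite quad_exp //; apply: eq_bigr => i _; set u := crea _; set v := anni _.
have idem : u * v * (u * v) = u * v.
  rewrite mulrA -(mulrA u v u) anni_crea /= oddir eqxx /= mulrDr mulr1 mulN1r mulrN mulrA.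
  by rewrite crea_odd_sqr mul0r oppr0 add0r.
have -> : p = (p - 1).+1 by lia.
by elim: (p - 1)%N => [|m ih]; [rewrite expr1|rewrite exprS ih].
Qed.

Lemma quad_odd_off a b : a != b -> quad (rshift n b) (rshift n a) ^+ p = 0.
Proof.
move=> ab; rewrite quad_exp ?oddir // big1 // => i _; set u := crea _; set v := anni _.
have sqr0 : u * v * (u * v) = 0.
  rewrite mulrA -(mulrA u v u) anni_crea /= !oddir xpair_eqE (inj_eq (@rshift_inj n n)).
  by rewrite (negbTE ab) addr0 /= mulN1r mulrN mulrA crea_odd_sqr mul0r oppr0 mul0r.
have -> : p = (p - 2).+2 by lia.
by rewrite !exprS mulrA sqr0 mul0r.
Qed.

Lemma ptE_exp_p (a b : 'I_n) :
  (delta_mx a b : 'M[k]_n) ^+ p = if a == b then delta_mx a b else 0.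
Proof.
have -> : p = (p - 2).+2 by lia.
case: eqVneq => [<-|ab]; last first.
  have z : (delta_mx a b : 'M[k]_n) * delta_mx a b = 0.
    by apply: mul_delta_mx_0; rewrite eq_sym.
  by rewrite !exprS mulrA z mul0r.
elim: (p - 2)%N => [|m ih]; first by rewrite expr2; exact: mul_delta_mx.
by rewrite exprS ih; exact: mul_delta_mx.
Qed.

Definition defect (A : 'M[k]_n) : S := osc (gl_emb A) ^+ p - osc (gl_emb (A ^+ p)).

Lemma defect_delta (a b : 'I_n) : defect (delta_mx a b) = scal (chi (delta_mx a b)).
Proof.
rewrite /defect osc_ptE (chi_delta chi_reg).
have cc : GRing.comm (quad (lshift n a) (lshift n b)) (quad (rshift n b) (rshift n a)).
  apply/eqP; rewrite -subr_eq0 -[X in _ - X]mul1r; apply/eqP.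
  have := @quad_bracket (lshift n a) (lshift n b) (rshift n b) (rshift n a) false false.
  rewrite !oddil !oddir => /(_ erefl erefl) ->.
  by rewrite eq_lrshift eq_rlshift !mul0r mulr0 subr0.
rewrite -(pFrobenius_autE pchar_S) (pFrobenius_autB_comm pchar_S cc) !pFrobenius_autE ptE_exp_p.
have [<-|ab] := eqVneq a b.
  by rewrite quad_even_diag quad_odd_diag osc_ptE subrr ltn_eqF // rmorph0.
by rewrite quad_even_off // quad_odd_off // linear0 osc0 !subr0.
Qed.

(** Given additivity both sides are p-semilinear in A, so it is enough to compare them on elementary
    matrices. *)
Lemma osc_p_of_additive : (forall A B, defect (A + B) = defect A + defect B) ->
  forall A, defect A = scal (chi A ^+ p).
Proof.
move=> dD A; have d0 : defect 0 = 0 by apply: (addrI (defect 0)); rewrite -dD !addr0.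
have dZ a B : defect (a *: B) = scal (a ^+ p) * defect B.
  rewrite /defect linearZ /= oscZ exprMn_comm; last exact: scal_central.
  have -> : (a *: B) ^+ p = a ^+ p *: B ^+ p.
    elim: (p) => [|m ih]; first by rewrite !expr0 scale1r.
    by rewrite !exprS ih -[LHS]/((a *: B) *m (a ^+ m *: B ^+ m)) -scalemxAl -scalemxAr scalerA.
  by rewrite linearZ /= oscZ mulrBr rmorphXn.
have dS (I : finType) (F : I -> 'M[k]_n) : defect (\sum_i F i) = \sum_i defect (F i).
  by elim/big_rec2: _ => // i x y _ <-; rewrite dD.
have frobS (I : finType) (F : I -> k) : (\sum_i F i) ^+ p = \sum_i F i ^+ p.
  by apply: expr_prime_sum => [||i j _ _]; [exact: pcharf_prime kp|exact: pcharf0 kp|exact: mulrC].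
rewrite {1}[A]matrix_sum_delta dS (chi_entries chi_reg) frobS rmorph_sum; apply: eq_bigr => i _.
rewrite dS frobS rmorph_sum; apply: eq_bigr => j _.
rewrite dZ defect_delta (chi_delta chi_reg) exprMn [RHS]rmorphM.
by case: (i == _ :> nat); rewrite ?expr1n // expr0n gtn_eqF ?prime_gt0 ?(pcharf_prime kp).
Qed.

End Oscillators.

Lemma osc_p (k : fieldType) (n : nat) (S : nzRingType) (scal : {rmorphism k -> S}) :
  (forall c, central (scal c)) ->
  forall crea anni : 'I_(n + n) * 'I_n -> S,
  (forall s t, crea s * crea t = (-1) ^+ (oddi s.1 && oddi t.1) * (crea t * crea s)) ->
  (forall s t, anni s * anni t = (-1) ^+ (oddi s.1 && oddi t.1) * (anni t * anni s)) ->
  (forall s t, anni s * crea t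
     = (-1) ^+ (oddi s.1 && oddi t.1) * (crea t * anni s) + (s == t)%:R) ->
  forall (p : nat) (chi : {scalar 'M[k]_n}) (al be : 'I_n -> 'I_n -> k),
  p \in [pchar k] -> (2 < p)%N -> regular_nilpotent chi ->
  (forall a i, crea (lshift n a, i) ^+ p = scal (al a i)) ->
  (forall a i, anni (lshift n a, i) ^+ p = scal (be a i)) ->
  (forall a i, (crea (lshift n a, i) * anni (lshift n a, i)) ^+ p
     = crea (lshift n a, i) * anni (lshift n a, i)) ->
  (forall a b : 'I_n, a != b -> \sum_i al a i * be b i = (a == b.+1 :> nat)%:R) ->
  forall A, osc scal crea anni (gl_emb A) ^+ p - osc scal crea anni (gl_emb (A ^+ p))
    = scal (chi A ^+ p).
Proof.
move=> sC crea anni cC aC ac p chi al be kp p2 reg cp ap np albe A.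
apply: (osc_p_of_additive sC cC aC ac kp p2 reg cp ap np albe).
(* Jacobson's formula is stated for nonzero rings, and matrices form one only in positive size; in
   size 0 every defect is 0. *)
case: n scal sC crea anni cC aC ac chi reg al be cp ap np albe A
  => [|n] scal sC crea anni cC aC ac chi reg al be cp ap np albe _.
  have d0 A : defect scal crea anni p A = 0.
    rewrite /defect [A]flatmx0 [0 ^+ p]flatmx0 linear0 osc0 expr0n.
    by rewrite gtn_eqF ?subr0 ?prime_gt0 // (pcharf_prime kp).
  by move=> A B; rewrite !d0 addr0.
pose phi A := osc scal crea anni (gl_emb A).
have phi_add : zmod_morphism phi by move=> A B; rewrite /phi linearB oscB.
pose phiA := GRing.isZmodMorphism.Build 'M[k]_n.+1 S phi phi_add.
pose Phi : {additive 'M[k]_n.+1 -> S} := HB.pack phi phiA.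
have pM : p \in [pchar 'M[k]_n.+1].
  by rewrite inE (pcharf_prime kp) -(rmorph_nat (@scalar_mx k n.+1)) (pcharf0 kp) rmorph0 eqxx.
have Phi_ad A B : Phi (ad A B) = ad (Phi A) (Phi B).
  have h (C : 'M[k]_n.+1) : homog false (gl_emb C).
    by rewrite /gl_emb /= block_mxKur block_mxKdl.
  have := osc_sbracket sC cC aC ac (h A) (h B).
  rewrite expr0 mul1r /Phi /= /phi /ad => <-; congr (osc _ _ _ _).
  rewrite /sbracket expr0 scale1r /gl_emb !mulmx_block opp_block_mx add_block_mx.
  rewrite !(mul0mx, mulmx0, addr0, add0r, subr0, oppr0) !(mulNmx, mulmxN) !opprK.
  by rewrite -[A * B]/(A *m B) -[B * A]/(B *m A) linearB /= !trmx_mul opprB.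
move=> A B; exact: (jacobson_defect_additive pM (pchar_S scal kp) Phi_ad A B).
Qed.

(** * A highest weight vector *)

Section WeightedComposition.
Context (k : fieldType) (T : finType) (t0 : T).
Local Notation N := #|T|.-1.
Implicit Types (c d : T -> k) (f g : T -> T).

Lemma card_predn : N.+1 = #|T|.
Proof. by rewrite prednK //; apply/card_gt0P; exists t0. Qed.

Definition point (i : 'I_N.+1) : T := enum_val (cast_ord card_predn i).
Definition point_idx (x : T) : 'I_N.+1 := cast_ord (esym card_predn) (enum_rank x).

Lemma point_idxK : cancel point_idx point.
Proof. by move=> x; rewrite /point /point_idx cast_ordKV enum_rankK. Qed.

Lemma pointK : cancel point point_idx.
Proof. by move=> i; rewrite /point /point_idx enum_valK cast_ordK. Qed.

(* The operator [u |-> c * (u o f)] on functions on [T]. *)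
Definition wcomp c f : 'M[k]_N.+1 :=
  \matrix_(i, j) (c (point i) * (point j == f (point i))%:R).

Lemma wcomp_ext c f d g :
  (forall x, c x = d x) -> (forall x, c x != 0 -> f x = g x) -> wcomp c f = wcomp d g.
Proof.
move=> cd fg; apply/matrixP => i j; rewrite !mxE -cd.
by have [->|/fg ->] := eqVneq (c (point i)) 0; rewrite ?mul0r.
Qed.

Lemma wcompM c f d g :
  wcomp c f * wcomp d g = wcomp (fun x => c x * d (f x)) (fun x => g (f x)).
Proof.
apply/matrixP => i j; rewrite !mxE (bigD1 (point_idx (f (point i)))) //=.
rewrite big1 ?addr0 => [|l li]; rewrite !mxE.
  by rewrite !point_idxK eqxx mulr1 mulrA.
case: eqP => [E|_]; last by rewrite mulr0 mul0r.
by move: li; rewrite -E pointK eqxx.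
Qed.

Lemma wcompD c d f : wcomp c f + wcomp d f = wcomp (fun x => c x + d x) f.
Proof. by apply/matrixP => i j; rewrite !mxE mulrDl. Qed.

Lemma wcompN c f : - wcomp c f = wcomp (fun x => - c x) f.
Proof. by apply/matrixP => i j; rewrite !mxE mulNr. Qed.

Lemma wcomp_scalar a : a%:M = wcomp (fun=> a) id.
Proof.
apply/matrixP => i j; by rewrite !mxE (inj_eq (can_inj pointK)) [j == i]eq_sym mulr_natr.
Qed.

Lemma wcomp0 c f : (forall x, c x = 0) -> wcomp c f = 0.
Proof. by move=> c0; apply/matrixP => i j; rewrite !mxE c0 mul0r. Qed.

Lemma wcomp_exp c f m :
  wcomp c f ^+ m = wcomp (fun x => \prod_(i < m) c (iter i f x)) (iter m f).
Proof.
elim: m => [|m ih].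
  by rewrite expr0 -[1]/(1%:M) wcomp_scalar; apply: wcomp_ext => // x; rewrite big_ord0.
rewrite exprS ih wcompM; apply: wcomp_ext => x; last by rewrite -iterSr.
by rewrite big_ord_recl; congr (_ * _); apply: eq_bigr => i _; rewrite -iterSr.
Qed.

Lemma wcomp_diag_exp c m : wcomp c id ^+ m = wcomp (fun x => c x ^+ m) id.
Proof.
elim: m => [|m ih]; first by rewrite expr0 -[1]/(1%:M) wcomp_scalar.
by rewrite exprS ih wcompM; apply: wcomp_ext => x; rewrite ?exprS.
Qed.

Lemma wcomp_comm c f d g : (forall x, c (g x) = c x) -> (forall x, d (f x) = d x) ->
  (forall x, g (f x) = f (g x)) -> wcomp c f * wcomp d g = wcomp d g * wcomp c f.
Proof. by move=> cg df fg; rewrite !wcompM; apply: wcomp_ext => x; rewrite ?cg ?df // mulrC. Qed.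

(** At every point exactly one of the two coefficient functions changes sign under the other map. *)
Lemma wcomp_anticomm c f d g (e : T -> bool) :
  (forall x, c (g x) = (-1) ^+ e x * c x) -> (forall x, d (f x) = (-1) ^+ (~~ e x) * d x) ->
  (forall x, g (f x) = f (g x)) -> wcomp c f * wcomp d g = - (wcomp d g * wcomp c f).
Proof.
move=> cg df fg; rewrite !wcompM wcompN; apply: wcomp_ext => x; rewrite ?cg ?df //.
by case: (e x); rewrite /= ?expr0 ?expr1; ring.
Qed.

Definition spike (x : T) : 'cV[k]_N.+1 := \col_i (point i == x)%:R.

Lemma spike_neq0 x : spike x != 0.
Proof.
apply/eqP => /matrixP/(_ (point_idx x) 0); rewrite !mxE point_idxK eqxx => /eqP.
by rewrite oner_eq0.
Qed.

Lemma wcomp_spike0 c f x : (forall y, f y = x -> c y = 0) -> wcomp c f *m spike x = 0.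
Proof.
move=> H; apply/matrixP => i j; rewrite mxE [RHS]mxE big1 // => l _; rewrite !mxE.
case: eqP => [E|_]; last by rewrite mulr0 mul0r.
by case: eqP => [E'|_]; [rewrite H ?mul0r // -E|rewrite mulr0].
Qed.

Lemma wcomp_spike_id c x : wcomp c id *m spike x = c x *: spike x.
Proof.
apply/matrixP => i j; rewrite !mxE (bigD1 i) //= big1 ?addr0 => [|l li]; rewrite !mxE.
  by rewrite eqxx mulr1; case: eqP => [->//|_]; rewrite !mulr0.
by rewrite (inj_eq (can_inj pointK)) (negbTE li) mulr0 mul0r.
Qed.

End WeightedComposition.

Section CyclicShift.
Context (p : nat).
Implicit Types x : 'I_p.

Lemma iter_ordS i x : iter i (@ordS p) x = ((x + i) %% p)%N :> nat.
Proof.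
elim: i => [|i ih]; first by rewrite addn0 modn_small.
by rewrite iterS /= ih -addn1 modnDml addn1 addnS.
Qed.

Lemma iter_ord_pred i x : (i <= p)%N -> iter i (@ord_pred p) x = ((x + p - i) %% p)%N :> nat.
Proof.
elim: i => [|i ih] ip; first by rewrite subn0 modnDr modn_small.
rewrite iterS /= ih; last exact: ltnW.
rewrite -subn1 -addnBA; last by lia.
rewrite modnDml; have -> : (x + p - i + (p - 1) = x + p - i.+1 + p)%N by have := ltn_ord x; lia.
by rewrite modnDr.
Qed.

Lemma iter_ord_pred_p x : iter p (@ord_pred p) x = x.
Proof. by apply: val_inj; rewrite /= iter_ord_pred // addnK modn_small. Qed.

Lemma iter_ord_pred_eq0 (i : 'I_p) x : (iter i (@ord_pred p) x == 0%N :> nat) = (i == x).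
Proof.
rewrite iter_ord_pred; last exact: ltnW.
have [hi hx] := (ltn_ord i, ltn_ord x); rewrite -val_eqE /=.
have [le|lt] := leqP i x.
  have -> : (x + p - i = x - i + p)%N by lia.
  by rewrite modnDr modn_small; lia.
by rewrite modn_small; lia.
Qed.

End CyclicShift.

(** * Bosonic modes on k[t]/(t^p - c) and fermionic modes on an exterior algebra *)

Section Model.
Context (k : fieldType) (p n : nat).
Hypothesis kp : p \in [pchar k].
Local Notation P := ('I_n * 'I_n)%type.
Local Notation T := ({ffun P -> 'I_p} * {ffun P -> bool})%type.
Implicit Types (q r : P) (x : T).

Let p_gt0 : (0 < p)%N. Proof. exact: prime_gt0 (pcharf_prime kp). Qed.

Definition vacuum : T := ([ffun=> Ordinal p_gt0], [ffun=> false]).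

Definition move_exp (f : 'I_p -> 'I_p) q x : T :=
  ([ffun r => if r == q then f (x.1 r) else x.1 r], x.2).
Definition flip q x : T := (x.1, [ffun r => if r == q then ~~ x.2 r else x.2 r]).

Lemma move_exp_eq f q x : (move_exp f q x).1 q = f (x.1 q).
Proof. by rewrite ffunE eqxx. Qed.

Lemma move_exp_neq f q r x : r != q -> (move_exp f q x).1 r = x.1 r.
Proof. by rewrite ffunE => /negbTE ->. Qed.

Lemma move_expC f g q r x : q != r ->
  move_exp f q (move_exp g r x) = move_exp g r (move_exp f q x).
Proof.
move=> qr; congr (_, _); apply/ffunP => s; rewrite !ffunE.
by have [->|//] := eqVneq s q; rewrite (negbTE qr).
Qed.

Lemma move_exp_comp f g q x : move_exp f q (move_exp g q x) = move_exp (f \o g) q x.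
Proof. by congr (_, _); apply/ffunP => s; rewrite !ffunE; case: eqP. Qed.

Lemma move_exp_id f q x : f (x.1 q) = x.1 q -> move_exp f q x = x.
Proof.
case: x => a b /= fx; congr (_, _); apply/ffunP => s; rewrite !ffunE /=.
by case: eqP => // ->.
Qed.

Lemma iter_move_exp f q i x : iter i (move_exp f q) x = move_exp (iter i f) q x.
Proof.
elim: i => [|i ih]; first by rewrite move_exp_id.
by rewrite iterS ih move_exp_comp.
Qed.

Lemma flipC q r x : flip q (flip r x) = flip r (flip q x).
Proof.
congr (_, _); apply/ffunP => s; rewrite !ffunE.
by case: (s == q); case: (s == r).
Qed.

Lemma flipK q x : flip q (flip q x) = x.
Proof.
case: x => a b; congr (_, _); apply/ffunP => s; rewrite !ffunE /=.
by case: eqP => // _; rewrite negbK.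
Qed.

Lemma flip_eq q x : (flip q x).2 q = ~~ x.2 q.
Proof. by rewrite ffunE eqxx. Qed.

Lemma flip_neq q r x : r != q -> (flip q x).2 r = x.2 r.
Proof. by rewrite ffunE => /negbTE ->. Qed.

(* The Jordan-Wigner sign, which makes operators at different fermionic modes
   anticommute. *)
Definition jw q x : bool :=
  \big[addb/false]_(r | (enum_rank r < enum_rank q)%N) x.2 r.

Lemma jw_flip q r x : jw q (flip r x) = (enum_rank r < enum_rank q)%N (+) jw q x.
Proof.
rewrite /jw; case: ltnP => [rq|qr].
  rewrite (bigD1 r) //= [in RHS](bigD1 r) //= flip_eq addNb; congr (~~ (_ (+) _)).
  by apply: eq_bigr => s /andP[_ sr]; rewrite flip_neq.
apply: eq_bigr => s sq; rewrite flip_neq //.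
by apply: contraTneq sq => ->; rewrite -leqNgt.
Qed.

Context (c : P -> k).
Local Notation wc := (@wcomp k T vacuum).

(** In the variable [q] a function of exponents is the coefficient list of an element of k[t]/(t^p -
    c q). Multiplication by t reads the coefficient one step below and wraps around at exponent 0
    with the factor [c q]; [lower] is d/dt, well defined because p = 0. *)
Definition raise q :=
  wc (fun x => if x.1 q == 0%N :> nat then c q else 1) (move_exp (@ord_pred p) q).
Definition lower q := wc (fun x => (x.1 q).+1%:R) (move_exp (@ordS p) q).
Definition fraise q := wc (fun x => (x.2 q)%:R * (-1) ^+ jw q x) (flip q).
Definition flower q := wc (fun x => (~~ x.2 q)%:R * (-1) ^+ jw q x) (flip q).

Lemma boson_comm (f g : 'I_p -> 'I_p) (u w : 'I_p -> k) q r : q != r ->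
  wc (fun x => u (x.1 q)) (move_exp f q) * wc (fun x => w (x.1 r)) (move_exp g r)
  = wc (fun x => w (x.1 r)) (move_exp g r) * wc (fun x => u (x.1 q)) (move_exp f q).
Proof.
move=> qr; apply: wcomp_comm => x; rewrite ?move_exp_neq // 1?eq_sym //.
exact/esym/move_expC.
Qed.

Lemma boson_fermion_comm (f : 'I_p -> 'I_p) (u : 'I_p -> k) (w : bool -> k) q r :
  wc (fun x => u (x.1 q)) (move_exp f q) * wc (fun x => w (x.2 r) * (-1) ^+ jw r x) (flip r)
  = wc (fun x => w (x.2 r) * (-1) ^+ jw r x) (flip r) * wc (fun x => u (x.1 q)) (move_exp f q).
Proof. by apply: wcomp_comm. Qed.

(** Flipping one mode alters the sign attached to the other exactly when it precedes it in the
    enumeration, and of two distinct modes exactly one precedes. *)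
Lemma fermion_anticomm (u w : bool -> k) q r : q != r ->
  wc (fun x => u (x.2 q) * (-1) ^+ jw q x) (flip q)
    * wc (fun x => w (x.2 r) * (-1) ^+ jw r x) (flip r)
  = - (wc (fun x => w (x.2 r) * (-1) ^+ jw r x) (flip r)
       * wc (fun x => u (x.2 q) * (-1) ^+ jw q x) (flip q)).
Proof.
move=> qr; apply: (@wcomp_anticomm _ _ _ _ _ _ _ (fun=> (enum_rank r < enum_rank q)%N)) => x.
- by rewrite flip_neq // jw_flip signr_addb mulrCA.
- rewrite flip_neq 1?eq_sym // jw_flip signr_addb mulrCA -leqNgt ltn_neqAle.
  by rewrite (inj_eq (@ord_inj _)) (inj_eq enum_rank_inj) qr.
- exact: flipC.
Qed.

Lemma fraise_sqr q : fraise q * fraise q = 0.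
Proof.
rewrite wcompM wcomp0 // => x; rewrite flip_eq.
by case: (x.2 q); rewrite /= ?mul0r // mulr0.
Qed.

Lemma flower_sqr q : flower q * flower q = 0.
Proof.
rewrite wcompM wcomp0 // => x; rewrite flip_eq.
by case: (x.2 q); rewrite /= ?mul0r // mulr0.
Qed.

Lemma flower_fraise q : flower q * fraise q + fraise q * flower q = 1.
Proof.
have jwq x : jw q (flip q x) = jw q x by rewrite jw_flip ltnn.
have f2 f : wc f (fun x => flip q (flip q x)) = wc f id by apply: wcomp_ext => // x _; exact: flipK.
rewrite !wcompM !f2 wcompD -[RHS]/(1%:M) (wcomp_scalar vacuum); apply: wcomp_ext => // x.
rewrite jwq flip_eq.
by case: (x.2 q); rewrite /= ?mul0r ?mul1r ?add0r ?addr0 -signr_addb addbb.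
Qed.

(** At the wrap-around the coefficient of the derivative is p, so the cyclic model still obeys the
    Weyl relation. *)
Lemma ordS_eq0 (i : 'I_p) : ordS i = 0%N :> nat -> i.+1%:R = 0 :> k.
Proof. by move=> E; rewrite -(GRing.natr_mod_pchar kp) [(_ %% _)%N]E. Qed.

Lemma lower_raise q : lower q * raise q = wc (fun x => (x.1 q).+1%:R) id.
Proof.
rewrite wcompM; apply: wcomp_ext => x; rewrite move_exp_eq.
  by case: eqP => [/ordS_eq0 ->|_]; rewrite ?mul0r ?mulr1.
by rewrite move_exp_comp move_exp_id //= ordSK.
Qed.

Lemma raise_lower q : raise q * lower q = wc (fun x => (x.1 q)%:R) id.
Proof.
rewrite wcompM; apply: wcomp_ext => x; rewrite move_exp_eq; last first.
  by rewrite move_exp_comp move_exp_id //= ord_predK.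
have := ltn_ord (x.1 q); rewrite /=; move: (nat_of_ord (x.1 q)) => y hy.
case: y hy => [_|y hy]; first by rewrite add0n modn_small ?prednK // (pcharf0 kp) mulr0.
by rewrite addSn /= modnDr modn_small ?mul1r // ltnW.
Qed.

Lemma raise_exp q : raise q ^+ p = (c q)%:M.
Proof.
rewrite wcomp_exp (wcomp_scalar vacuum); apply: wcomp_ext => x; last first.
  by rewrite iter_move_exp move_exp_id // iter_ord_pred_p.
rewrite (bigD1 (x.1 q)) //= iter_move_exp move_exp_eq iter_ord_pred_eq0 eqxx.
rewrite big1 ?mulr1 // => i ix.
by rewrite iter_move_exp move_exp_eq iter_ord_pred_eq0 (negbTE ix).
Qed.

Lemma lower_exp q : lower q ^+ p = 0.
Proof.
rewrite wcomp_exp wcomp0 // => x.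
(* After this many shifts the exponent is p - 1, where the coefficient of [lower] is p = 0; one
   factor of the product vanishes. *)
have hi : (p.-1 - x.1 q < p)%N by lia.
rewrite (bigD1 (Ordinal hi)) //= iter_move_exp move_exp_eq iter_ordS.
have hx := ltn_ord (x.1 q).
have -> : ((x.1 q + (p.-1 - x.1 q)) %% p = p.-1)%N by rewrite modn_small; lia.
by rewrite prednK // (pcharf0 kp) mul0r.
Qed.

End Model.

(** X^p - X has at most p roots, and the p residues already are roots. *)
Lemma frobenius_fixed_nat (k : fieldType) p (x : k) : p \in [pchar k] -> x ^+ p = x ->
  exists s : 'I_p, x = s%:R.
Proof.
move=> kp xp; pose f : {poly k} := 'X^p - 'X.
have p1 := prime_gt1 (pcharf_prime kp).
have f0 : f != 0.
  apply/eqP => /(congr1 (fun g : {poly k} => g`_p)); rewrite coefB coefXn coefX coef0 eqxx.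
  by rewrite gtn_eqF // subr0 => /eqP; rewrite oner_eq0.
have sf : (size f <= p.+1)%N.
  apply: leq_trans (size_polyD _ _) _; rewrite size_polyN size_polyXn size_polyX geq_max leqnn.
  exact: ltnW.
have rootf y : root f y = (y ^+ p == y).
  by rewrite /root /f !hornerE subr_eq0.
pose r := [seq ((s : nat)%:R : k) | s : 'I_p <- enum 'I_p].
have inj : {in enum 'I_p &, injective (fun s : 'I_p => s%:R : k)}.
  move=> s t _ _ /=.
  wlog st : s t / (s <= t)%N.
    by move=> H E; case/orP: (leq_total s t) => h; [apply: H|apply/esym/H].
  move=> E; apply/val_inj/eqP; rewrite eqn_leq st /= -subn_eq0 -leqn0 leqNgt; apply/negP => pos.
  have : (p %| t - s)%N by rewrite (dvdn_pcharf kp) natrB // E subrr.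
  by rewrite gtnNdvd // (leq_ltn_trans (leq_subr _ _)).
have [xr|xr] := boolP (x \in r).
  by have /mapP[s _ ->] := xr; exists s.
have := max_poly_roots f0 (rs := x :: r).
rewrite /= xr map_inj_in_uniq // enum_uniq rootf xp eqxx /= size_map size_enum_ord => H.
suff rs : all (root f) r by have := H rs isT; rewrite ltnNge sf.
apply/allP => _ /mapP[s _ ->]; rewrite rootf -(pFrobenius_autE kp).
by rewrite pFrobenius_aut_nat.
Qed.

(* In copy [i] of the oscillator representation multiplication and
   differentiation are interchanged for the indices [a <= i]. *)
Section FourierTwist.
Context (n : nat) (R : nzRingType) (up down fup fdown : 'I_n * 'I_n -> R).
Local Notation mode := ('I_(n + n) * 'I_n)%type.
Hypothesis up_up : forall q r, up q * up r = up r * up q.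
Hypothesis down_down : forall q r, down q * down r = down r * down q.
Hypothesis down_up : forall q r, down q * up r = up r * down q + (q == r)%:R.
Hypothesis up_fup : forall q r, up q * fup r = fup r * up q.
Hypothesis up_fdown : forall q r, up q * fdown r = fdown r * up q.
Hypothesis down_fup : forall q r, down q * fup r = fup r * down q.
Hypothesis down_fdown : forall q r, down q * fdown r = fdown r * down q.
Hypothesis fup_fup : forall q r, fup q * fup r = - (fup r * fup q).
Hypothesis fdown_fdown : forall q r, fdown q * fdown r = - (fdown r * fdown q).
Hypothesis fdown_fup : forall q r, fdown q * fup r = - (fup r * fdown q) + (q == r)%:R.

(** The minus sign keeps the Weyl relation under the exchange: t (-d) - (-d) t = [d, t] = 1. *)
Definition crea (s : mode) : R :=
  match fintype.split s.1 with
  | inl a => if (a <= s.2)%N then - down (a, s.2) else up (a, s.2)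
  | inr a => fup (a, s.2)
  end.
Definition anni (s : mode) : R :=
  match fintype.split s.1 with
  | inl a => if (a <= s.2)%N then up (a, s.2) else down (a, s.2)
  | inr a => fdown (a, s.2)
  end.

Lemma crea_l a i : crea (lshift n a, i) = if (a <= i)%N then - down (a, i) else up (a, i).
Proof. by rewrite /crea (unsplitK (inl a)). Qed.
Lemma crea_r a i : crea (rshift n a, i) = fup (a, i).
Proof. by rewrite /crea (unsplitK (inr a)). Qed.
Lemma anni_l a i : anni (lshift n a, i) = if (a <= i)%N then up (a, i) else down (a, i).
Proof. by rewrite /anni (unsplitK (inl a)). Qed.
Lemma anni_r a i : anni (rshift n a, i) = fdown (a, i).
Proof. by rewrite /anni (unsplitK (inr a)). Qed.

(** A twisted mode differs from an untwisted one, so two creation operators, or two annihilation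
    operators, never have a contraction. *)
Lemma twist_neq (a b i j : 'I_n) : (a <= i)%N -> (j < b)%N ->
  ((a, i) == (b, j))%:R = 0 :> R.
Proof.
move=> ai jb; case: eqP => // -[ab ij].
by move: jb; rewrite -ab -ij ltnNge ai.
Qed.

Lemma creaC s t : crea s * crea t = (-1) ^+ (oddi s.1 && oddi t.1) * (crea t * crea s).
Proof.
case: s t => [s i] [t j]; rewrite /=.
case: (split_ordP s) => a ->; case: (split_ordP t) => b ->;
  rewrite ?oddil ?oddir ?crea_l ?crea_r /= ?mul1r ?mulN1r.
- case: leqP => ai; case: leqP => bj; rewrite ?(mulrN, mulNr) ?opprK //.
  + by rewrite down_up twist_neq ?addr0.
  + by rewrite down_up twist_neq ?addr0.
- by case: leqP => _; rewrite ?mulNr ?mulrN ?down_fup.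
- by case: leqP => _; rewrite ?mulNr ?mulrN ?down_fup ?up_fup.
- exact: fup_fup.
Qed.

Lemma anniC s t : anni s * anni t = (-1) ^+ (oddi s.1 && oddi t.1) * (anni t * anni s).
Proof.
case: s t => [s i] [t j]; rewrite /=.
case: (split_ordP s) => a ->; case: (split_ordP t) => b ->;
  rewrite ?oddil ?oddir ?anni_l ?anni_r /= ?mul1r ?mulN1r.
- case: leqP => ai; case: leqP => bj //.
  + by rewrite down_up [(b, j) == _]eq_sym twist_neq ?addr0.
  + by rewrite down_up [(a, i) == _]eq_sym twist_neq ?addr0.
- by case: leqP => _.
- by case: leqP => _; rewrite ?down_fdown ?up_fdown.
- exact: fdown_fdown.
Qed.

Lemma anni_crea s t :
  anni s * crea t = (-1) ^+ (oddi s.1 && oddi t.1) * (crea t * anni s) + (s == t)%:R.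
Proof.
case: s t => [s i] [t j]; rewrite /=.
case: (split_ordP s) => a ->; case: (split_ordP t) => b ->;
  rewrite ?oddil ?oddir ?anni_l ?anni_r ?crea_l ?crea_r /= ?mul1r ?mulN1r xpair_eqE
    ?eq_lrshift ?eq_rlshift /= ?addr0 ?(inj_eq (@lshift_inj n n)) ?(inj_eq (@rshift_inj n n))
    -?xpair_eqE.
- case: leqP => ai; case: leqP => bj; rewrite ?(mulrN, mulNr) ?opprK.
  + by rewrite down_up [(b, j) == _]eq_sym opprD subrK.
  + by rewrite twist_neq ?addr0.
  + by rewrite [(a, i) == _]eq_sym twist_neq // addr0 down_down.
  + exact: down_up.
- by case: leqP => _.
- by case: leqP => _; rewrite ?(mulrN, mulNr) ?up_fdown ?down_fdown.
- exact: fdown_fup.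
Qed.

End FourierTwist.

(** * Choice of the parameters and of the weight vector *)

Section HighestWeightModel.
Context (k : fieldType) (p n : nat) (chi : {scalar 'M[k]_n}) (lambda : 'I_n -> k).
Hypothesis kp : p \in [pchar k].
Hypothesis p_gt2 : (2 < p)%N.
Hypothesis chi_reg : regular_nilpotent chi.
Hypothesis lambda_chi : in_Lambda p chi lambda.
Local Notation T := ({ffun 'I_n * 'I_n -> 'I_p} * {ffun 'I_n * 'I_n -> bool})%type.
Local Notation S := 'M[k]_(#|{: T}|.-1.+1).

(** In copy i only t_i and t_{i+1} have p-th power 1, all other variables have p-th power 0. After
    the twist E_{i+1,i} acts there through t_{i+1} t_i, whose p-th power is 1; this is the value of
    chi at the root vector of -alpha_i. *)
Definition coupling (q : 'I_n * 'I_n) : k := ((q.1 == q.2) || (q.1 == q.2.+1 :> nat))%:R.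

Let cup q (i : 'I_p) : k := if i == 0%N :> nat then coupling q else 1.
Let cdown (i : 'I_p) : k := i.+1%:R.

Lemma raise_raise (q r : 'I_n * 'I_n) : raise kp coupling q * raise kp coupling r
  = raise kp coupling r * raise kp coupling q.
Proof. by have [->//|] := eqVneq q r; exact: (boson_comm kp _ _ (cup q) (cup r)). Qed.

Lemma lower_lower (q r : 'I_n * 'I_n) : lower kp q * lower kp r = lower kp r * lower kp q.
Proof. by have [->//|] := eqVneq q r; exact: (boson_comm kp _ _ cdown cdown). Qed.

Lemma lower_raise_comm (q r : 'I_n * 'I_n) : lower kp q * raise kp coupling r
  = raise kp coupling r * lower kp q + (q == r)%:R.
Proof.
have [<-|qr] := eqVneq q r; last by rewrite addr0; exact: (boson_comm kp _ _ cdown (cup r)).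
rewrite lower_raise raise_lower -[X in _ + X]/(1%:M) (wcomp_scalar (vacuum n kp)) wcompD.
by apply: wcomp_ext => // x; rewrite -natr1.
Qed.

Let ftrue (b : bool) : k := b%:R.
Let ffalse (b : bool) : k := (~~ b)%:R.

Lemma fraise_fraise (q r : 'I_n * 'I_n) : fraise kp q * fraise kp r = - (fraise kp r * fraise kp q).
Proof.
have [->|] := eqVneq q r; first by rewrite fraise_sqr oppr0.
exact: (fermion_anticomm kp ftrue ftrue).
Qed.

Lemma flower_flower (q r : 'I_n * 'I_n) : flower kp q * flower kp r = - (flower kp r * flower kp q).
Proof.
have [->|] := eqVneq q r; first by rewrite flower_sqr oppr0.
exact: (fermion_anticomm kp ffalse ffalse).
Qed.

Lemma flower_fraise_comm (q r : 'I_n * 'I_n) :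
  flower kp q * fraise kp r = - (fraise kp r * flower kp q) + (q == r)%:R.
Proof.
have [<-|qr] := eqVneq q r; first by rewrite -(flower_fraise kp q) addrC addrK.
by rewrite addr0; exact: (fermion_anticomm kp ffalse ftrue).
Qed.

Lemma raise_fraise (q r : 'I_n * 'I_n) :
  raise kp coupling q * fraise kp r = fraise kp r * raise kp coupling q.
Proof. exact: (boson_fermion_comm kp _ (cup q) ftrue). Qed.

Lemma raise_flower (q r : 'I_n * 'I_n) :
  raise kp coupling q * flower kp r = flower kp r * raise kp coupling q.
Proof. exact: (boson_fermion_comm kp _ (cup q) ffalse). Qed.

Lemma lower_fraise (q r : 'I_n * 'I_n) : lower kp q * fraise kp r = fraise kp r * lower kp q.
Proof. exact: (boson_fermion_comm kp _ cdown ftrue). Qed.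

Lemma lower_flower (q r : 'I_n * 'I_n) : lower kp q * flower kp r = flower kp r * lower kp q.
Proof. exact: (boson_fermion_comm kp _ cdown ffalse). Qed.

Local Notation Cr := (crea (raise kp coupling) (@lower k p n kp) (@fraise k p n kp)).
Local Notation An := (anni (raise kp coupling) (@lower k p n kp) (@flower k p n kp)).

Definition crea_pth (a i : 'I_n) : k := if (a <= i)%N then 0 else (a == i.+1 :> nat)%:R.
Definition anni_pth (a i : 'I_n) : k := if (a <= i)%N then (a == i)%:R else 0.

Lemma Cr_p a i : Cr (lshift n a, i) ^+ p = (crea_pth a i)%:M.
Proof.
rewrite crea_l /crea_pth; case: leqP => ai.
  by rewrite exprNn lower_exp mulr0 raddf0.
rewrite raise_exp /coupling /=; congr ((_ _)%:M).
by case: eqP => // E; move: ai; rewrite E ltnn.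
Qed.

Lemma An_p a i : An (lshift n a, i) ^+ p = (anni_pth a i)%:M.
Proof.
rewrite anni_l /anni_pth; case: leqP => ai; last by rewrite lower_exp raddf0.
by rewrite raise_exp /coupling /= [(a == _.+1 :> nat)]ltn_eqF ?orbF.
Qed.

Lemma crea_anni_pth (a b : 'I_n) : a != b ->
  \sum_i crea_pth a i * anni_pth b i = (a == b.+1 :> nat)%:R.
Proof.
move=> ab; rewrite (bigD1 b) //= big1 ?addr0 => [|i ib].
  rewrite /crea_pth /anni_pth leqnn eqxx mulr1; case: leqP => // le.
  by rewrite ltn_eqF.
by rewrite /anni_pth eq_sym (negbTE ib); case: ifP; rewrite mulr0.
Qed.

Lemma number_l a i : Cr (lshift n a, i) * An (lshift n a, i)
  = wcomp (vacuum n kp) (fun x => if (a <= i)%N then - (x.1 (a, i)).+1%:R else (x.1 (a, i))%:R) id.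
Proof.
rewrite crea_l anni_l; case: leqP => _; last exact: raise_lower.
by rewrite mulNr lower_raise wcompN.
Qed.

Lemma number_p a i : (Cr (lshift n a, i) * An (lshift n a, i)) ^+ p
  = Cr (lshift n a, i) * An (lshift n a, i).
Proof.
rewrite number_l wcomp_diag_exp; apply: wcomp_ext => // x; rewrite -(pFrobenius_autE kp).
by case: ifP => _; rewrite ?rmorphN /= pFrobenius_aut_nat.
Qed.

(** As chi vanishes on the torus, [lambda a] is fixed by Frobenius and lies in the prime field. The
    sum counts the twisted modes with index [a]: each has number operator -d t, with value -1 at
    exponent 0. *)
Lemma weight_exponent_exists a : exists s : 'I_p,
  lambda a = - s%:R - \sum_(i : 'I_n) (a <= i)%N%:R.
Proof.
have [h1 _ _] := chi_reg; have := lambda_chi a; rewrite h1.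
rewrite expr0n gtn_eqF ?prime_gt0 ?(pcharf_prime kp) // => /eqP; rewrite subr_eq0 => /eqP la.
have [|s E] := @frobenius_fixed_nat _ _ (- lambda a - \sum_(i : 'I_n) (a <= i)%N%:R) kp.
  rewrite -(pFrobenius_autE kp) rmorphB rmorphN rmorph_sum /= pFrobenius_autE la.
  by congr (_ - _); apply: eq_bigr => i _; rewrite pFrobenius_aut_nat.
by exists s; rewrite -E opprB addrAC subrr add0r opprK.
Qed.

(** The monomial with exponent [s a] in the variable (a, a) and no fermions. Copy [a] adjusts
    coordinate [a] of the weight, whence n copies although there are only n - 1 simple roots. *)
Definition hw_point (s : 'I_n -> 'I_p) : T :=
  ([ffun q => if q.1 == q.2 then s q.1 else (vacuum n kp).1 q], (vacuum n kp).2).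

Context (s : 'I_n -> 'I_p).
Hypothesis weight_s : forall a, lambda a = - (s a)%:R - \sum_(i : 'I_n) (a <= i)%N%:R.
Local Notation v := (spike k (vacuum n kp) (hw_point s)).

Lemma lower_hw (a i : 'I_n) : a != i -> lower kp (a, i) *m v = 0.
Proof.
move=> ai; apply: wcomp_spike0 => y E; apply: (ordS_eq0 kp).
rewrite -(move_exp_eq (@ordS p) (a, i) y) E ffunE /= (negbTE ai).
by rewrite ffunE.
Qed.

Lemma flower_hw (q : 'I_n * 'I_n) : flower kp q *m v = 0.
Proof.
apply: wcomp_spike0 => y E; have := flip_eq q y; rewrite E ffunE => /esym/negbFE ->.
by rewrite mul0r.
Qed.

Local Notation Osc := (osc (@scalar_mx k #|{: T}|.-1.+1) Cr An).
Local Notation Quad := (quad Cr An).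

Lemma quad_hw_r (t : 'I_(n + n)) (b : 'I_n) : Quad t (rshift n b) *m v = 0.
Proof.
rewrite /quad mulmx_suml big1 // => i _.
by rewrite -[_ * _]/(_ *m _) -mulmxA anni_r flower_hw mulmx0.
Qed.

(** In copies i < b the derivative falls on the variable (b, i). In copies i >= b both indices are
    twisted, and it falls on (a, i) with a < i. Neither is a variable (i, i), so its exponent in [v]
    is 0. *)
Lemma quad_hw_lt (a b : 'I_n) : (a < b)%N -> Quad (lshift n a) (lshift n b) *m v = 0.
Proof.
move=> ab; rewrite /quad mulmx_suml big1 // => i _; rewrite -[_ * _]/(_ *m _).
have [bi|ib] := leqP b i; last first.
  by rewrite -mulmxA anni_l leqNgt ib /= lower_hw ?mulmx0 // neq_ltn ib orbT.
have ai : (a < i)%N := leq_trans ab bi.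
rewrite crea_l anni_l (ltnW ai) bi mulNmx -[_ *m raise _ _ _]/(_ * _) lower_raise_comm.
have -> : ((a, i) == (b, i)) = false by rewrite xpair_eqE eqxx andbT; apply: ltn_eqF.
by rewrite addr0 mulNmx -[_ * _]/(_ *m _) -mulmxA lower_hw ?mulmx0 ?oppr0 // neq_ltn ai.
Qed.

Lemma quad_hw_diag (a : 'I_n) : Quad (lshift n a) (lshift n a) *m v = lambda a *: v.
Proof.
rewrite /quad mulmx_suml.
under eq_bigr => i _.
  rewrite number_l wcomp_spike_id ffunE /=; over.
rewrite -scaler_suml weight_s; congr (_ *: _).
have -> : \sum_(i : 'I_n) (if (a <= i)%N
      then - (if a == i then s a else (vacuum n kp).1 (a, i)).+1%:R
      else (if a == i then s a else (vacuum n kp).1 (a, i))%:R)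
    = \sum_(i : 'I_n) (- (if a == i then (s a)%:R else 0) - (a <= i)%N%:R) :> k.
  apply: eq_bigr => i _; case: eqP => [<-|_]; first by rewrite leqnn -natr1 opprD.
  by rewrite ffunE /= oppr0 sub0r; case: leqP => _; rewrite ?mulr0n ?oppr0.
rewrite big_split /= sumrN sumrN; congr (- _ - _).
by rewrite (bigD1 a) //= eqxx big1 ?addr0 // => i ia; rewrite eq_sym (negbTE ia).
Qed.

Lemma osc_hw x : x \in @borel k n ->
  Osc x *m v = (\sum_i lambda i * ulsubmx x i i) *: v.
Proof.
move=> /borelP[_ ux lx]; rewrite /osc mulmx_suml big_split_ord /=.
rewrite [X in _ + X]big1 ?addr0 => [|a _]; last first.
  rewrite mulmx_suml big1 // => t _; rewrite -[_ * _]/(_ *m _).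
  case: (split_ordP t) => b ->; last by rewrite -mulmxA quad_hw_r mulmx0.
  have -> : x (rshift n a) (lshift n b) = 0.
    by move/matrixP/(_ a b): lx; rewrite !mxE.
  by rewrite rmorph0 !mul0mx.
rewrite scaler_suml; apply: eq_bigr => a _; rewrite mulmx_suml big_split_ord /=.
rewrite [X in _ + X]big1 ?addr0 => [|b _]; last first.
  by rewrite -[_ * _]/(_ *m _) -mulmxA quad_hw_r mulmx0.
rewrite (bigD1 a) //= big1 ?addr0 => [|b ba]; rewrite -[_ * _]/(_ *m _) -mulmxA.
  rewrite quad_hw_diag mul_scalar_mx scalerA mulrC; congr (_ * _ *: _).
  by rewrite !mxE.
have [ab|lt] := ltnP a b; first by rewrite quad_hw_lt ?mulmx0.
have -> : x (lshift n a) (lshift n b) = 0.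
  have := ux a b; rewrite !mxE; apply.
  by rewrite ltn_neqAle lt andbT.
by rewrite rmorph0 mul0mx.
Qed.

End HighestWeightModel.

Lemma highest_weight_model (k : fieldType) (p n : nat) (chi : {scalar 'M[k]_n})
    (lambda : 'I_n -> k) :
  p \in [pchar k] -> (2 < p)%N -> regular_nilpotent chi -> in_Lambda p chi lambda ->
  exists (N : nat) (O : 'M[k]_(n + n) -> 'M[k]_N.+1) (v : 'cV[k]_N.+1),
  [/\ forall a x y, O (a *: x + y) = a%:M * O x + O y,
      forall b c x y, homog b x -> homog c y ->
        O (sbracket b c x y) = O x * O y - (-1) ^+ (b && c) * (O y * O x),
      forall A, O (gl_emb A) ^+ p - O (gl_emb (A ^+ p)) = (chi A ^+ p)%:M,
      v != 0
    & forall x, x \in @borel k n -> O x *m v = (\sum_i lambda i * ulsubmx x i i) *: v].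
Proof.
move=> kp p2 reg lam.
have [s weight_s] : exists s : 'I_n -> 'I_p,
    forall a, lambda a = - (s a)%:R - \sum_(i : 'I_n) (a <= i)%N%:R.
  exact: fin_all_exists (weight_exponent_exists kp reg lam).
have sC (m : nat) (c : k) : central (c%:M : 'M_m.+1) by move=> B; exact/esym/scalar_mxC.
have cC := creaC (raise_raise kp) (lower_lower kp) (lower_raise_comm kp) (raise_fraise kp)
  (lower_fraise kp) (fraise_fraise kp).
have aC := anniC (raise_raise kp) (lower_lower kp) (lower_raise_comm kp) (raise_flower kp)
  (lower_flower kp) (flower_flower kp).
have ac := anni_crea (raise_raise kp) (lower_lower kp) (lower_raise_comm kp) (raise_fraise kp)
  (raise_flower kp) (lower_fraise kp) (lower_flower kp) (flower_fraise_comm kp).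
exists #|{: {ffun 'I_n * 'I_n -> 'I_p} * {ffun 'I_n * 'I_n -> bool}}|.-1.
exists (osc (@scalar_mx k _)
  (crea (raise kp (@coupling k n)) (@lower k p n kp) (@fraise k p n kp))
  (anni (raise kp (@coupling k n)) (@lower k p n kp) (@flower k p n kp))).
exists (spike k (vacuum n kp) (hw_point kp s)); split.
- exact: osc_is_linear.
- by move=> b c x y hx hy; apply: (osc_sbracket _ (cC n) (aC n) (ac n) hx hy); exact: sC.
- apply: (osc_p _ (cC n) (aC n) (ac n) kp p2 reg (Cr_p kp) (An_p kp) (number_p kp)
    (@crea_anni_pth k n)).
  exact: sC.
- exact: spike_neq0.
exact: osc_hw weight_s.
Qed.

(** * The baby Verma module *)

Section TensorOneDim.
Context (k : fieldType) (R A : pzRingType) (j : {rmorphism R -> A}) (rho : {rmorphism R -> k}).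
Local Notation one := (1 : one_dim rho).

(** The map sending a pair (b, c) to c G(b) is balanced over [R], so it factors through the tensor
    product and detects nonzero tensors. *)
Lemma tens_neq0 (W : lmodType k) (G : A -> W) a :
  zmod_morphism G -> (forall b r, G (b * j r) = rho r *: G b) ->
  tens j a one = 0 -> G a = 0.
Proof.
move=> GB GM.
pose ga (q : (A * one_dim rho)%type) : {additive int -> W} := *~%R ((q.2 : k) *: G q.1).
have GD b c : G (b + c) = G b + G c.
  have G0 : G 0 = 0 by rewrite -(subrr 0) GB subrr.
  by rewrite -{1}[c]opprK GB -(sub0r c) GB G0 sub0r opprK.
have kill x : tens_rel j x -> malg_ext ga x = 0.
  case=> [b c y|b y z|b r y].
  - by rewrite raddfB raddfD /= !malg_extU /= /ga /= GD scalerDr !mulr1z subrr.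
  - by rewrite raddfB raddfD /= !malg_extU /= /ga /= !mulr1z -scalerDl subrr.
  - by rewrite raddfB /= !malg_extU /= /ga /= GM scalerA mulrC !mulr1z subrr.
rewrite -[RHS](raddf0 (zpi (tens_rel j (N := one_dim rho)))) => /zpi_eq; rewrite subr0.
move/(in_span_kill kill); rewrite /= malg_extU /= /ga /= mulr1z scale1r.
by [].
Qed.

Lemma tens_one_neq0 N (L : {rmorphism A -> 'M[k]_N.+1}) (v : 'cV[k]_N.+1) :
  (forall r, L (j r) *m v = rho r *: v) -> v != 0 -> tens j 1 one <> 0.
Proof.
move=> Lv v0 t0; have : L 1 *m v = 0.
  apply: (tens_neq0 (G := fun a => L a *m v) _ _ t0) => [a b|a r].
    by rewrite rmorphB mulmxBl.
  by rewrite rmorphM -[L a * _]/(_ *m _) -mulmxA Lv -scalemxAr.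
by rewrite rmorph1 mul1mx => E; rewrite E eqxx in v0.
Qed.

(** A weight vector needs to be checked on generators only. The induction principle is a hypothesis,
    so the computation takes place in abstract rings. *)
Lemma intertwine_ind (X : Type) (s : k -> R) (g : X -> R) N
    (L : {rmorphism A -> 'M[k]_N.+1}) (v : 'cV[k]_N.+1) :
  (forall Q : R -> Prop, (forall c, Q (s c)) -> (forall a b, Q a -> Q b -> Q (a + b)) ->
    (forall x a, Q a -> Q (g x * a)) -> forall a, Q a) ->
  (forall c, L (j (s c)) *m v = rho (s c) *: v) ->
  (forall x, L (j (g x)) *m v = rho (g x) *: v) -> forall r, L (j r) *m v = rho r *: v.
Proof.
move=> ind Ls Lg r; elim/ind: r => [c|a b ha hb|x a ha]; first exact: Ls.
  by rewrite !rmorphD mulmxDl ha hb scalerDl.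
rewrite !rmorphM -[L _ * _]/(_ *m _) -mulmxA ha -scalemxAr Lg scalerA.
by rewrite mulrC.
Qed.

Context (sR : {rmorphism k -> R}) (sA : {rmorphism k -> A}).
Hypothesis rho_sR : forall c, rho (sR c) = c.
Hypothesis j_sR : forall c, j (sR c) = sA c.

Lemma act_tens1 a : a *: tens j 1 one = tens j a one.
Proof. by rewrite -[LHS]/(tens_act a (tens j 1 one)) tens_actE mulr1. Qed.

Lemma tens_one_dim a (c : one_dim rho) : tens j a c = (a * sA c) *: tens j 1 one.
Proof.
rewrite act_tens1 -j_sR tensM; congr (tens j a _).
by rewrite -[RHS]/(rho (sR c) * 1) rho_sR mulr1.
Qed.

Lemma act_sub_tens1 r : j r *: tens j 1 one = sA (rho r) *: tens j 1 one.
Proof.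
rewrite act_tens1 -[j r]mul1r tensM tens_one_dim mul1r; congr (sA _ *: _).
exact: mulr1.
Qed.

Lemma tensor_one_dim_ind (P : tensor j (one_dim rho) -> Prop) :
  (forall u w, P u -> P w -> P (u + w)) -> (forall a, P (a *: tens j 1 one)) -> forall u, P u.
Proof.
move=> PD Pa u; suff [a ->] : exists a, u = a *: tens j 1 one by [].
elim/tensorW: u => [|x y [a ->] [b ->]|x [a ->]|a c].
- by exists 0; rewrite scale0r.
- by exists (a + b); rewrite scalerDl.
- by exists (- a); rewrite scaleNr.
by exists (a * sA c); exact: tens_one_dim.
Qed.

End TensorOneDim.

Lemma generated_ind (k : fieldType) (A : pzRingType) (X : Type) (s : k -> A) (g : X -> A)
    (M : lmodType A) (v : M) (P : M -> Prop) :
  (forall Q : A -> Prop, (forall c, Q (s c)) -> (forall a b, Q a -> Q b -> Q (a + b)) ->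
    (forall x a, Q a -> Q (g x * a)) -> forall a, Q a) ->
  P v -> (forall u w, P u -> P w -> P (u + w)) -> (forall c u, P u -> P (s c *: u)) ->
  (forall x u, P u -> P (g x *: u)) -> forall a, P (a *: v).
Proof.
move=> ind Pv PD PZ PX a; elim/ind: a => [c|a b ha hb|x a ha]; first exact: PZ.
  by rewrite scalerDl; exact: PD.
by rewrite -scalerA; exact: PX.
Qed.

Lemma submod_dichotomy (A : pzRingType) (M : lmodType A) (N : {pred M}) :
  submod_closed N ->
  (0 \in N -> (forall u w, u \in N -> w \in N -> u + w \in N) ->
   (forall a u, u \in N -> a *: u \in N) ->
   (exists2 u, u \in N & u != 0) -> forall u, u \in N) ->
  (forall x, x \in N -> x = 0) \/ (forall x, x \in N).
Proof.
move=> [N0 NP] H; have [E|nE] := pselect (exists2 u, u \in N & u != 0).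
  right; apply: H => // [u w hu hw|a u hu].
    by have := NP 1 _ _ hu hw; rewrite scale1r.
  by have := NP a _ _ hu N0; rewrite addr0.
left=> x Nx; apply/eqP; apply: contra_notT nE => x0; by exists x.
Qed.

Lemma act_eq (A : pzRingType) (M : lmodType A) (a b c : A) (v : M) :
  a = b -> b *: v = c *: v -> a *: v = c *: v.
Proof. by move=> ->. Qed.

(** The heights give the strictly lower entries of the A block and all entries of the C block
    negative degree, so nonnegative degree leaves b_0 + g_1. *)
Lemma hom_borel (k : fieldType) n b d (x : 'M[k]_(n + n)) :
  hom b d x -> 0 <= d -> x \in @borel k n.
Proof.
move=> [px _ dx] d0; apply/borelP; split=> //.
  move=> i j ji; apply/eqP; apply: contraTT d0; rewrite 2!mxE => /dx.
  by rewrite !heightl; lia.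
apply/matrixP => i j; rewrite [RHS]mxE; apply/eqP; apply: contraTT d0.
rewrite 2!mxE => /dx; rewrite heightl heightr.
by have [hi hj] := (ltn_ord i, ltn_ord j); lia.
Qed.

(** * Generation and nonvanishing of the highest weight vector *)

Section BabyVermaSimple.
Context (k : fieldType) (p n : nat) (chi : {scalar 'M[k]_n}) (lambda : 'I_n -> k).
Hypothesis kp : p \in [pchar k].
Hypothesis p_gt2 : (2 < p)%N.
Hypothesis chi_reg : regular_nilpotent chi.
Hypothesis lambda_chi : in_Lambda p chi lambda.
Local Notation nplus := (regular_nilpotent_nplus chi_reg).
Local Notation Ug := (redenv p chi (@ptilde k n)).
Local Notation Ub := (redenv p chi (@borel k n)).
Local Notation j := (borel_incl p chi).
Local Notation rho := (borel_char kp nplus lambda_chi).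
Local Notation Z := (baby_verma kp nplus lambda_chi).
Local Notation scal := (red_scal p chi (@ptilde k n)).

Definition hw : Z := tens j 1 (1 : one_dim rho).

Lemma rho_scal c : rho (red_scal p chi (@borel k n) c) = c.
Proof. exact: red_lift_scal. Qed.

Lemma rho_gen x : rho (red_gen p chi x) = weight_ext lambda x.
Proof. exact: red_lift_gen. Qed.

Lemma j_scal c : j (red_scal p chi (@borel k n) c) = scal c.
Proof. exact: red_lift_scal. Qed.

Lemma j_gen x : j (red_gen p chi x) = red_gen p chi (borel_elt x).
Proof. exact: red_lift_gen. Qed.

Lemma borel_act_hw (r : Ub) : j r *: hw = scal (rho r) *: hw.
Proof. exact: (act_sub_tens1 (sR := red_scal p chi (@borel k n)) rho_scal j_scal). Qed.

Lemma hw_borel b d x : hom b d x -> 0 <= d ->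
  exists c, redenv_mx p chi x *: hw = scal c *: hw.
Proof.
move=> hx d0; have bx := hom_borel hx d0; have [px _ _] := hx.
pose y : elt (@borel k n) := exist _ x bx; exists (rho (red_gen p chi y)).
have ey : exist _ x px = borel_elt y by exact: val_inj.
have E : redenv_mx p chi x = j (red_gen p chi y).
  apply: etrans (redenv_mxE _ _ px) (etrans _ (esym (j_gen y))).
  exact: (congr1 (@red_gen k p n chi (@ptilde k n)) ey).
exact: (act_eq E (borel_act_hw (red_gen p chi y))).
Qed.

Lemma hw_gen (P : Z -> Prop) : P hw -> (forall u w, P u -> P w -> P (u + w)) ->
  (forall c u, P u -> P (scal c *: u)) ->
  (forall x u, x \in @ptilde k n -> P u -> P (redenv_mx p chi x *: u)) -> forall u, P u.
Proof.
move=> Pv PD PZ PX.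
apply: (tensor_one_dim_ind (sR := red_scal p chi (@borel k n)) (sA := scal) rho_scal j_scal PD).
apply: (generated_ind (@redenv_ind k p n chi (@ptilde k n)) Pv PD PZ) => -[x px] u Pu.
have := PX x u px Pu; rewrite (redenv_mxE _ _ px); exact.
Qed.

(** The oscillator operators satisfy the defining relations, so they give a representation of
    [U_chi(g)]. Since [v] has weight lambda under the Borel subalgebra, u (x) 1 goes to u v, and
    [hw] to [v], which is nonzero. *)
Lemma hw_neq0 : hw <> 0.
Proof.
have [N [O [v [OL OB OP v0 Ov]]]] := highest_weight_model kp p_gt2 chi_reg lambda_chi.
have sC (c : k) (B : 'M[k]_N.+1) : GRing.comm (c%:M : 'M[k]_N.+1) B.
  exact/esym/scalar_mxC.
pose L : {rmorphism Ug -> 'M[k]_N.+1} :=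
  red_lift (f := @scalar_mx k N.+1) (phi := fun x : elt (@ptilde k n) => O (val x)) sC
    (fun a x y z => fun h => etrans (congr1 O h) (OL a (val x) (val y)))
    (fun b c x y z => fun hx hy h => etrans (congr1 O h) (OB b c _ _ hx hy))
    (fun A x z => fun hx hz =>
       etrans (f_equal2 (fun u w => u ^+ p - w) (congr1 O hx) (congr1 O hz)) (OP A)).
apply: (tens_one_neq0 (L := L) (v := v) _ v0).
apply: (intertwine_ind (@redenv_ind k p n chi (@borel k n))) => [c|x].
- have E : L (j (red_scal p chi (@borel k n) c)) = c%:M.
    exact: etrans (congr1 L (j_scal c)) (red_lift_scal _ _ _ _ _).
  by rewrite E rho_scal mul_scalar_mx.
have E : L (j (red_gen p chi x)) = O (val x).
  exact: etrans (congr1 L (j_gen x)) (red_lift_gen _ _ _ _ _).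
by rewrite E rho_gen Ov ?(valP x).
Qed.

End BabyVermaSimple.

Theorem proposition2p8 (k : closedFieldType) (p n : nat)
    (kp : p \in [pchar k]) (p_gt2 : (2 < p)%N)
    (chi : {scalar 'M[k]_n}) (chi_reg : regular_nilpotent chi)
    (lambda : 'I_n -> k) (lambda_chi : in_Lambda p chi lambda) :
  super_irreducible
    (@baby_verma_par k p n chi lambda kp (regular_nilpotent_nplus chi_reg) lambda_chi).
Proof.
split.
  exists (hw kp chi_reg lambda_chi); apply/eqP.
  exact: hw_neq0.
move=> N [Nsub _]; apply: (submod_dichotomy Nsub) => N0 ND NZ Nn0.
exact: (simple_abstract (@red_scal_comm k p n chi (@ptilde k n)) (@redenv_mxP k p n chi)
  (@redenv_mx_sbracket k p n chi) (@redenv_mx_p k p n chi) kp p_gt2 chi_reg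
  (@hw_borel k p n chi lambda kp chi_reg lambda_chi)
  (@hw_gen k p n chi lambda kp chi_reg lambda_chi) N0 ND NZ Nn0).
Qed.
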